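(* Let $K$ be a field and $(E,w)$ a row-finite weighted graph. Then the Grothendieck group $K_0(L_K(E,w))$ of the weighted Leavitt path algebra $L_K(E,w)$ is isomorphic to the abelian group presented by the generating set $E^0$ and the relations $$w(v)\,v=\sum_{e\in s^{-1}(v)}r(e)\qquad(v\in E^0).$$
   Context: $\mathbb{N}$ denotes the positive integers. A directed graph is a quadruple $E=(E^0,E^1,s,r)$ with sets $E^0$ (vertices), $E^1$ (edges) and maps $s,r:E^1\to E^0$ (source, range). A weighted graph $(E,w)$ is a directed graph $E$ with a map $w:E^1\to\mathbb{N}$; it is row-finite if $s^{-1}(v)$ is finite for every $v\in E^0$. For $v\in E^0$ put $w(v):=\max\{w(e)\mid e\in s^{-1}(v)\}$, with $\max\emptyset=0$ (so for a vertex emitting no edges the relation reads $0=0$). The weighted Leavitt path algebra $L_K(E,w)$ is the associative $K$-algebra presented by generators $E^0\cup\{e_i,e_i^*\mid e\in E^1,1\le i\le w(e)\}$ and relations (i) $uv=\delta_{uv}u$ for $u,v\in E^0$; (ii) $s(e)e_i=e_i=e_ir(e)$ and $r(e)e_i^*=e_i^*=e_i^*s(e)$ for $e\in E^1$, $1\le i\le w(e)$; (iii) $\sum_{e\in s^{-1}(v)}e_ie_j^*=\delta_{ij}v$ for $v\in E^0$, $1\le i,j\le w(v)$; (iv) $\sum_{1\le i\le w(v)}e_i^*f_i=\delta_{ef}r(e)$ for $v\in E^0$, $e,f\in s^{-1}(v)$; where in (iii), (iv) one sets $e_i=e_i^*=0$ whenever $i>w(e)$. The algebra need not be unital (when $E^0$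 is infinite), but it is a ring with local units. For an associative ring $R$, let $\mathbb{M}_\infty(R)$ be the directed union of the matrix rings $\mathbb{M}_n(R)$, $n\in\mathbb{N}$, along $x\mapsto\begin{pmatrix}x&0\\0&0\end{pmatrix}$. For idempotents $e,f\in\mathbb{M}_\infty(R)$ write $e\sim f$ iff there are $x,y\in\mathbb{M}_\infty(R)$ with $e=xy$, $f=yx$. $V(R)$ is the abelian monoid of $\sim$-classes of idempotents with addition $[e]+[f]=\left[\begin{pmatrix}e&0\\0&f\end{pmatrix}\right]$. For a ring $R$ with local units, $K_0(R)$ is the group completion $V(R)^+$ of $V(R)$. *)

(* Defs.v *)
From HB Require Import structures.
From mathcomp Require Import all_boot all_order all_algebra generic_quotient.
From mathcomp Require Import ring_quotient freeg finmap.
From mathcomp Require Import zify.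
From mathcomp Require Import boolp classical_sets functions cardinality fsbigop.

Set Implicit Arguments.
Unset Strict Implicit.
Unset Printing Implicit Defensive.

Import GRing.Theory.
Local Open Scope classical_set_scope.
Local Open Scope quotient_scope.
Local Open Scope ring_scope.

(* Associative rings and algebras, not necessarily with 1.  The ring          *)
(* structures of ssralg all have a unit.                                      *)

Reserved Notation "x ** y" (at level 40, left associativity).

HB.mixin Record Zmodule_isNURing R of GRing.Zmodule R := {
  numul : R -> R -> R;
  numulA : associative numul;
  numulDl : left_distributive numul +%R;
  numulDr : right_distributive numul +%R
}.

#[short(type="nuRingType")]
HB.structure Definition NURing := {R of GRing.Zmodule R & Zmodule_isNURing R}.

Notation "x ** y" := (numul x y) : ring_scope.

HB.mixin Record Lmodule_isNUAlgebra (K : pzRingType) A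
    of GRing.Lmodule K A & NURing A := {
  nuscaleAl : forall (a : K) (x y : A), a *: (x ** y) = (a *: x) ** y;
  nuscaleAr : forall (a : K) (x y : A), a *: (x ** y) = x ** (a *: y)
}.

#[short(type="nuAlgType")]
HB.structure Definition NUAlgebra (K : pzRingType) :=
  {A of GRing.Lmodule K A & NURing A & Lmodule_isNUAlgebra K A}.

Section NURingTheory.
Variable R : nuRingType.
Implicit Types x y : R.

Lemma numul0r x : 0 ** x = 0.
Proof. by apply: (addrI (0 ** x)); rewrite -numulDl !addr0. Qed.

Lemma numulr0 x : x ** 0 = 0.
Proof. by apply: (addrI (x ** 0)); rewrite -numulDr !addr0. Qed.

Lemma numul_suml I r (P : pred I) (F : I -> R) x :
  (\sum_(i <- r | P i) F i) ** x = \sum_(i <- r | P i) (F i ** x).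
Proof.
apply: (big_morph (fun y => y ** x)) => [y z|]; last exact: numul0r.
exact: numulDl.
Qed.

Lemma numul_sumr I r (P : pred I) (F : I -> R) x :
  x ** (\sum_(i <- r | P i) F i) = \sum_(i <- r | P i) (x ** F i).
Proof.
apply: (big_morph (fun y => x ** y)) => [y z|]; last exact: numulr0.
exact: numulDr.
Qed.

End NURingTheory.

(* The K-algebra (without 1) presented by generators X and relations rel: the *)
(* formal expressions in X modulo the least congruence that contains rel and  *)
(* makes the quotient an associative K-algebra.                               *)

Section PresentedAlgebra.
Variables (K : fieldType) (X : Type).

Inductive nuterm :=
| NUGen of X
| NUZero
| NUAdd of nuterm & nuterm
| NUOpp of nuterm
| NUScale of K & nuterm
| NUMul of nuterm & nuterm.

Definition NUSum (s : seq nuterm) : nuterm := foldr NUAdd NUZero s.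

HB.instance Definition _ := gen_eqMixin nuterm.
HB.instance Definition _ := gen_choiceMixin nuterm.

Variable rel : nuterm -> nuterm -> Prop.

Inductive nucong : nuterm -> nuterm -> Prop :=
| nucong_rel s t : rel s t -> nucong s t
| nucong_refl t : nucong t t
| nucong_sym s t : nucong s t -> nucong t s
| nucong_trans s t u : nucong s t -> nucong t u -> nucong s u
| nucong_add s s' t t' :
    nucong s s' -> nucong t t' -> nucong (NUAdd s t) (NUAdd s' t')
| nucong_opp s s' : nucong s s' -> nucong (NUOpp s) (NUOpp s')
| nucong_scale a s s' : nucong s s' -> nucong (NUScale a s) (NUScale a s')
| nucong_mul s s' t t' :
    nucong s s' -> nucong t t' -> nucong (NUMul s t) (NUMul s' t')
| nucong_addA s t u : nucong (NUAdd s (NUAdd t u)) (NUAdd (NUAdd s t) u)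
| nucong_addC s t : nucong (NUAdd s t) (NUAdd t s)
| nucong_add0 t : nucong (NUAdd NUZero t) t
| nucong_addN t : nucong (NUAdd (NUOpp t) t) NUZero
| nucong_scaleA a b t :
    nucong (NUScale a (NUScale b t)) (NUScale (a * b) t)
| nucong_scale1 t : nucong (NUScale 1 t) t
| nucong_scaleDr a s t :
    nucong (NUScale a (NUAdd s t)) (NUAdd (NUScale a s) (NUScale a t))
| nucong_scaleDl a b t :
    nucong (NUScale (a + b) t) (NUAdd (NUScale a t) (NUScale b t))
| nucong_mulA s t u : nucong (NUMul s (NUMul t u)) (NUMul (NUMul s t) u)
| nucong_mulDl s t u :
    nucong (NUMul (NUAdd s t) u) (NUAdd (NUMul s u) (NUMul t u))
| nucong_mulDr s t u :
    nucong (NUMul s (NUAdd t u)) (NUAdd (NUMul s t) (NUMul s u))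
| nucong_scaleAl a s t :
    nucong (NUScale a (NUMul s t)) (NUMul (NUScale a s) t)
| nucong_scaleAr a s t :
    nucong (NUScale a (NUMul s t)) (NUMul s (NUScale a t)).

Definition nucongb s t := `[< nucong s t >].

Lemma nucongb_equiv : equiv_class_of nucongb.
Proof.
split=> [s|s t|t s u]; first exact/asboolP/nucong_refl.
- by apply/asboolP/asboolP => /nucong_sym.
- by move=> /asboolP st /asboolP tu; apply/asboolP/(nucong_trans st).
Qed.

Canonical nucongb_equiv_rel := EquivRelPack nucongb_equiv.
Canonical nucongb_encModRel := defaultEncModRel nucongb.

Definition presented_alg := {eq_quot nucongb}.
Local Notation A := presented_alg.

HB.instance Definition _ := Choice.on A.
HB.instance Definition _ : EqQuotient _ nucongb A := EqQuotient.on A.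

Definition pres_class (t : nuterm) : A := \pi_A t.

Lemma pres_classP s t : pres_class s = pres_class t <-> nucong s t.
Proof. by split=> [/eqmodP/asboolP|st]; last exact/eqmodP/asboolP. Qed.

Lemma pres_reprK x : pres_class (repr x) = x.
Proof. exact: reprK. Qed.

Lemma pres_repr t : nucong (repr (pres_class t)) t.
Proof. by apply/pres_classP/pres_reprK. Qed.

Definition pres_add (x y : A) : A := pres_class (NUAdd (repr x) (repr y)).
Definition pres_opp (x : A) : A := pres_class (NUOpp (repr x)).
Definition pres_scale a (x : A) : A := pres_class (NUScale a (repr x)).
Definition pres_mul (x y : A) : A := pres_class (NUMul (repr x) (repr y)).

Lemma pres_addE s t :
  pres_add (pres_class s) (pres_class t) = pres_class (NUAdd s t).
Proof. by apply/pres_classP/nucong_add; apply: pres_repr. Qed.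

Lemma pres_oppE s : pres_opp (pres_class s) = pres_class (NUOpp s).
Proof. by apply/pres_classP/nucong_opp; apply: pres_repr. Qed.

Lemma pres_scaleE a s : pres_scale a (pres_class s) = pres_class (NUScale a s).
Proof. by apply/pres_classP/nucong_scale; apply: pres_repr. Qed.

Lemma pres_mulE s t :
  pres_mul (pres_class s) (pres_class t) = pres_class (NUMul s t).
Proof. by apply/pres_classP/nucong_mul; apply: pres_repr. Qed.

Let presE := (pres_addE, pres_oppE, pres_scaleE, pres_mulE).

Let pres_addA : associative pres_add.
Proof.
elim/quotW=> s; elim/quotW=> t; elim/quotW=> u.
rewrite -!/(pres_class _) !presE; exact/pres_classP/nucong_addA.
Qed.
Let pres_addC : commutative pres_add.
Proof.
elim/quotW=> s; elim/quotW=> t.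
rewrite -!/(pres_class _) !presE; exact/pres_classP/nucong_addC.
Qed.
Let pres_add0 : left_id (pres_class NUZero) pres_add.
Proof.
elim/quotW=> s; rewrite -!/(pres_class _) !presE.
exact/pres_classP/nucong_add0.
Qed.
Let pres_addN : left_inverse (pres_class NUZero) pres_opp pres_add.
Proof.
elim/quotW=> s; rewrite -!/(pres_class _) !presE.
exact/pres_classP/nucong_addN.
Qed.

HB.instance Definition _ :=
  GRing.isZmodule.Build A pres_addA pres_addC pres_add0 pres_addN.

Lemma pres_class0 : pres_class NUZero = 0. Proof. by []. Qed.

Lemma pres_classD s t :
  pres_class (NUAdd s t) = pres_class s + pres_class t.
Proof. exact/esym/pres_addE. Qed.

Lemma pres_classN s : pres_class (NUOpp s) = - pres_class s.
Proof. exact/esym/pres_oppE. Qed.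

Lemma pres_classS s : pres_class (NUSum s) = \sum_(t <- s) pres_class t.
Proof.
by elim: s => [|t s IHs]; rewrite ?big_nil // big_cons -IHs -pres_classD.
Qed.

Let pres_scaleA a b x : pres_scale a (pres_scale b x) = pres_scale (a * b) x.
Proof.
elim/quotW: x => s; rewrite -!/(pres_class _) !presE.
exact/pres_classP/nucong_scaleA.
Qed.
Let pres_scale1 : left_id 1 pres_scale.
Proof.
elim/quotW=> s; rewrite -!/(pres_class _) !presE.
exact/pres_classP/nucong_scale1.
Qed.
Let pres_scaleDr : right_distributive pres_scale +%R.
Proof.
move=> a; elim/quotW=> s; elim/quotW=> t.
rewrite -!/(pres_class _) ?(presE, =^~ pres_classD).
exact/pres_classP/nucong_scaleDr.
Qed.
Let pres_scaleDl x : {morph pres_scale^~ x : a b / a + b}.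
Proof.
elim/quotW: x => s a b; rewrite -!/(pres_class _) ?(presE, =^~ pres_classD).
exact/pres_classP/nucong_scaleDl.
Qed.

HB.instance Definition _ := GRing.Zmodule_isLmodule.Build K A
  pres_scaleA pres_scale1 pres_scaleDr pres_scaleDl.

Lemma pres_classZ a s : pres_class (NUScale a s) = a *: pres_class s.
Proof. exact/esym/pres_scaleE. Qed.

Let pres_mulA : associative pres_mul.
Proof.
elim/quotW=> s; elim/quotW=> t; elim/quotW=> u.
rewrite -!/(pres_class _) !presE; exact/pres_classP/nucong_mulA.
Qed.
Let pres_mulDl : left_distributive pres_mul +%R.
Proof.
elim/quotW=> s; elim/quotW=> t; elim/quotW=> u.
rewrite -!/(pres_class _) ?(presE, =^~ pres_classD).
exact/pres_classP/nucong_mulDl.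
Qed.
Let pres_mulDr : right_distributive pres_mul +%R.
Proof.
elim/quotW=> s; elim/quotW=> t; elim/quotW=> u.
rewrite -!/(pres_class _) ?(presE, =^~ pres_classD).
exact/pres_classP/nucong_mulDr.
Qed.

HB.instance Definition _ :=
  Zmodule_isNURing.Build A pres_mulA pres_mulDl pres_mulDr.

Lemma pres_classM s t : pres_class (NUMul s t) = pres_class s ** pres_class t.
Proof. exact/esym/pres_mulE. Qed.

Let pres_scaleAl (a : K) (x y : A) : a *: (x ** y) = (a *: x) ** y.
Proof.
elim/quotW: x => s; elim/quotW: y => t.
rewrite -!/(pres_class _) -!(pres_classM, pres_classZ).
exact/pres_classP/nucong_scaleAl.
Qed.
Let pres_scaleAr (a : K) (x y : A) : a *: (x ** y) = x ** (a *: y).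
Proof.
elim/quotW: x => s; elim/quotW: y => t.
rewrite -!/(pres_class _) -!(pres_classM, pres_classZ).
exact/pres_classP/nucong_scaleAr.
Qed.

HB.instance Definition _ :=
  Lmodule_isNUAlgebra.Build K A pres_scaleAl pres_scaleAr.

End PresentedAlgebra.

Arguments NUZero {K X}.

(* The union of the M_n(R) along x |-> (x 0; 0 0): the matrices indexed by    *)
(* nat * nat that vanish outside a finite square [0, n[ * [0, n[.             *)

Section InfiniteMatrices.
Variable R : nuRingType.
Implicit Types F G : nat -> nat -> R.

Definition mx_within n F := forall i j, (n <= i)%N || (n <= j)%N -> F i j = 0.

Record infmx := InfMx {
  infmx_val :> nat -> nat -> R;
  infmx_fin : exists n, mx_within n infmx_val
}.

(* Some n such that A lies in M_n(R). *)
Definition infmx_dim (A : infmx) : nat := sval (cid (infmx_fin A)).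

Lemma infmx_dimP A : mx_within (infmx_dim A) A.
Proof. exact: svalP (cid (infmx_fin A)). Qed.

Lemma infmx_ext (A B : infmx) : (forall i j, A i j = B i j) -> A = B.
Proof.
case: A B => [F FP] [G GP] /= FG.
have E : F = G by apply/funext => i; apply/funext => j.
by case: _ / E in GP *; congr InfMx; apply: Prop_irrelevance.
Qed.

Definition mulf F G : nat -> nat -> R :=
  fun i j => \sum_(k \in [set: nat]) (F i k ** G k j).

(* block_mx on infinite matrices, with upper left block of size n * m *)
Definition blockf n m F00 F01 F10 F11 : nat -> nat -> R := fun i j =>
  if (i < n)%N then if (j < m)%N then F00 i j else F01 i (j - m)%N
  else if (j < m)%N then F10 (i - n)%N j else F11 (i - n)%N (j - m)%N.

Definition zerof : nat -> nat -> R := fun _ _ => 0.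

Lemma mulf_within n F G :
  mx_within n F -> mx_within n G -> mx_within n (mulf F G).
Proof.
move=> Fn Gn i j ij; apply: fsbig1 => k _.
case/orP: ij => h; first by rewrite Fn ?h // numul0r.
by rewrite Gn ?h ?orbT // numulr0.
Qed.

Lemma mx_withinW n m F : (n <= m)%N -> mx_within n F -> mx_within m F.
Proof.
move=> nm Fn i j /orP[] h; apply: Fn; first by rewrite (leq_trans nm h).
by rewrite (leq_trans nm h) orbT.
Qed.

Lemma infmx_common (A B C D : infmx) : exists N,
  [/\ mx_within N A, mx_within N B, mx_within N C & mx_within N D].
Proof.
exists (maxn (maxn (infmx_dim A) (infmx_dim B))
             (maxn (infmx_dim C) (infmx_dim D))).
by split; apply: (mx_withinW _ (@infmx_dimP _)); rewrite !leq_max leqnn ?orbT.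
Qed.

Lemma zerof_within n : mx_within n zerof. Proof. by []. Qed.

Lemma infmx_mul_fin (A B : infmx) : exists n, mx_within n (mulf A B).
Proof.
by have [N [? ? _ _]] := infmx_common A B A B; exists N; apply: mulf_within.
Qed.

Lemma blockf_within n m N F00 F01 F10 F11 :
  mx_within N F00 -> mx_within N F01 -> mx_within N F10 -> mx_within N F11 ->
  mx_within (n + m + N) (blockf n m F00 F01 F10 F11).
Proof.
move=> h00 h01 h10 h11 i j h; rewrite /blockf.
by case: ltnP => hi; case: ltnP => hj; [apply: h00|apply: h01|apply: h10|apply: h11];
  lia.
Qed.

Lemma infmx_block_fin n m (A B C D : infmx) :
  exists N, mx_within N (blockf n m A B C D).
Proof.
have [N [? ? ? ?]] := infmx_common A B C D.
by exists (n + m + N)%N; apply: blockf_within.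
Qed.

Definition infmx0 : infmx := InfMx (ex_intro _ 0%N (@zerof_within 0%N)).
Definition infmx_mul (A B : infmx) : infmx := InfMx (infmx_mul_fin A B).
Definition infmx_block n m (A B C D : infmx) : infmx :=
  InfMx (infmx_block_fin n m A B C D).

(* (A 0; 0 B) for A in M_n(R) *)
Definition infmx_dsum_at n (A B : infmx) : infmx :=
  infmx_block n n A infmx0 infmx0 B.
Definition infmx_dsum (A B : infmx) : infmx :=
  infmx_dsum_at (infmx_dim A) A B.

Record idempmx := IdempMx {
  idempmx_val :> infmx;
  idempmxP : infmx_mul idempmx_val idempmx_val = idempmx_val
}.

HB.instance Definition _ := gen_eqMixin idempmx.
HB.instance Definition _ := gen_choiceMixin idempmx.

Definition idempmx_equiv (e f : idempmx) : Prop :=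
  exists x y : infmx, e = infmx_mul x y :> infmx /\ f = infmx_mul y x :> infmx.

Lemma idempmx_ext (e f : idempmx) : e = f :> infmx -> e = f.
Proof.
case: e f => [A AP] [B BP] /= E.
by case: _ / E in BP *; congr IdempMx; apply: Prop_irrelevance.
Qed.

Definition rowb n F := forall i j, (n <= i)%N -> F i j = 0.
Definition colb n F := forall i j, (n <= j)%N -> F i j = 0.

Lemma within_row n F : mx_within n F -> rowb n F.
Proof. by move=> Fn i j h; apply: Fn; rewrite h. Qed.

Lemma within_col n F : mx_within n F -> colb n F.
Proof. by move=> Fn i j h; apply: Fn; rewrite h orbT. Qed.

Lemma mulf_rowb n F G : rowb n F -> rowb n (mulf F G).
Proof. by move=> Fn i j h; apply: fsbig1 => k _; rewrite Fn ?numul0r. Qed.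

Lemma mulf_colb n F G : colb n G -> colb n (mulf F G).
Proof. by move=> Gn i j h; apply: fsbig1 => k _; rewrite Gn ?numulr0. Qed.

Lemma mulf0l G i j : mulf zerof G i j = 0.
Proof. by apply: fsbig1 => k _; rewrite numul0r. Qed.

Lemma mulf0r F i j : mulf F zerof i j = 0.
Proof. by apply: fsbig1 => k _; rewrite numulr0. Qed.

Lemma fsum_nat N (H : nat -> R) : (forall k, (N <= k)%N -> H k = 0) ->
  \sum_(k \in [set: nat]) H k = \sum_(k < N) H k.
Proof.
move=> H0; rewrite fsbig_ord; apply/esym/fsbig_widen => // k [_] /=.
by move=> /negP; rewrite -leqNgt => /H0.
Qed.

Lemma mulf_ord m F G i j :
  colb m F -> mulf F G i j = \sum_(k < m) (F i k ** G k j).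
Proof. by move=> Fm; apply: fsum_nat => k h; rewrite Fm ?numul0r. Qed.

Lemma infmx_mulA : associative infmx_mul.
Proof.
move=> A B C; have [N [hA hB hC _]] := infmx_common A B C C.
apply: infmx_ext => i j /=.
rewrite (mulf_ord _ _ _ (within_col hA)).
rewrite (mulf_ord _ _ _ (within_col (mulf_within hA hB))).
under eq_bigr do rewrite (mulf_ord _ _ _ (within_col hB)) numul_sumr.
under [RHS]eq_bigr do rewrite (mulf_ord _ _ _ (within_col hA)) numul_suml.
rewrite exchange_big /=; apply: eq_bigr => k _; apply: eq_bigr => l _.
exact: numulA.
Qed.

Lemma mulf_block n m p (A B C D A' B' C' D' : infmx) i j :
  colb m A -> colb m C ->
  mulf (blockf n m A B C D) (blockf m p A' B' C' D') i j =
  blockf n p (fun i j => mulf A A' i j + mulf B C' i j)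
             (fun i j => mulf A B' i j + mulf B D' i j)
             (fun i j => mulf C A' i j + mulf D C' i j)
             (fun i j => mulf C B' i j + mulf D D' i j) i j.
Proof.
move=> hA hC; have [N [_ hB _ hD]] := infmx_common A B C D.
rewrite (@mulf_ord (m + N)%N); last first.
  move=> i' j' h; rewrite /blockf; have hj : (j' < m)%N = false by lia.
  by rewrite hj; case: ifP => _; [apply: (within_col hB)|apply: (within_col hD)];
    lia.
rewrite big_split_ord /= /blockf.
have lt1 (k : 'I_m) : (k < m)%N by [].
have lt2 (k : 'I_N) : (m + k < m)%N = false by lia.
case: ifP => hi; case: ifP => hj; rewrite (mulf_ord _ _ _ hA, mulf_ord _ _ _ hC);
  rewrite (mulf_ord _ _ _ (within_col hB), mulf_ord _ _ _ (within_col hD));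
  by congr (_ + _); apply: eq_bigr => k _; rewrite ?lt1 ?lt2 ?addKn.
Qed.

Lemma eqv_refl e : idempmx_equiv e e.
Proof. by exists e, e; rewrite idempmxP. Qed.

Lemma eqv_sym e f : idempmx_equiv e f -> idempmx_equiv f e.
Proof. by case=> x [y [ex fx]]; exists y, x. Qed.

Lemma eqv_trans e f g :
  idempmx_equiv e f -> idempmx_equiv f g -> idempmx_equiv e g.
Proof.
case=> x [y [exy fyx]] [z [w [fzw gwz]]].
exists (infmx_mul x z), (infmx_mul w y); split.
  rewrite -infmx_mulA (infmx_mulA z) -fzw fyx -infmx_mulA (infmx_mulA x).
  by rewrite -exy idempmxP.
rewrite -infmx_mulA (infmx_mulA y) -fyx fzw -infmx_mulA (infmx_mulA w).
by rewrite -gwz idempmxP.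
Qed.

Lemma eqv_corner e f : idempmx_equiv e f -> exists x y : infmx,
  [/\ infmx_mul e x = x, infmx_mul x f = x, infmx_mul f y = y & infmx_mul y e = y]
  /\ e = infmx_mul x y :> infmx /\ f = infmx_mul y x :> infmx.
Proof.
case=> x [y [exy fyx]].
have exf : infmx_mul e x = infmx_mul x f by rewrite exy fyx infmx_mulA.
have fye : infmx_mul f y = infmx_mul y e by rewrite exy fyx infmx_mulA.
exists (infmx_mul e x), (infmx_mul f y); split; first split.
- by rewrite infmx_mulA idempmxP.
- by rewrite exf -infmx_mulA idempmxP.
- by rewrite infmx_mulA idempmxP.
- by rewrite fye -infmx_mulA idempmxP.
split.
  by rewrite fye -infmx_mulA (infmx_mulA x) -exy !idempmxP.
by rewrite exf -infmx_mulA (infmx_mulA y) -fyx !idempmxP.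
Qed.

Lemma dsum_mul n m p (A B A' B' : infmx) : colb m A ->
  infmx_mul (infmx_block n m A infmx0 infmx0 B)
            (infmx_block m p A' infmx0 infmx0 B') =
  infmx_block n p (infmx_mul A A') infmx0 infmx0 (infmx_mul B B').
Proof.
move=> hA; apply: infmx_ext => i j; rewrite [LHS]mulf_block // /= /blockf.
by do 2 case: ifP => _; rewrite !(mulf0l, mulf0r, addr0, add0r).
Qed.

Lemma dsum_idem_at n (e f : idempmx) : mx_within n e ->
  infmx_mul (infmx_dsum_at n e f) (infmx_dsum_at n e f) = infmx_dsum_at n e f.
Proof. by move=> en; rewrite dsum_mul ?idempmxP //; apply: within_col. Qed.

Definition idempmx0 : idempmx.
Proof.
by exists infmx0; apply: infmx_ext => i j; apply: mulf0l.
Defined.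

Definition idempmx_dsum (e f : idempmx) : idempmx :=
  IdempMx (dsum_idem_at f (@infmx_dimP e)).

Lemma eqv_dsum_at n n' (e f e' f' g g' : idempmx) :
  mx_within n e -> mx_within n' e' ->
  g = infmx_dsum_at n e f :> infmx -> g' = infmx_dsum_at n' e' f' :> infmx ->
  idempmx_equiv e e' -> idempmx_equiv f f' -> idempmx_equiv g g'.
Proof.
move=> en en' gE g'E.
case/eqv_corner => x [y [[_ hx _ hy] [exy e'yx]]] [z [w [fzw f'wz]]].
exists (infmx_block n n' x infmx0 infmx0 z).
exists (infmx_block n' n y infmx0 infmx0 w).
rewrite gE g'E !dsum_mul -?exy -?e'yx -?fzw -?f'wz //.
  by rewrite -hy; apply: mulf_colb; apply: within_col.
by rewrite -hx; apply: mulf_colb; apply: within_col.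
Qed.

Lemma eqv_dsumC n m (e f g g' : idempmx) :
  mx_within n e -> mx_within m f ->
  g = infmx_dsum_at n e f :> infmx -> g' = infmx_dsum_at m f e :> infmx ->
  idempmx_equiv g g'.
Proof.
move=> en fm gE g'E; rewrite /idempmx_equiv gE g'E.
exists (infmx_block n m infmx0 e f infmx0).
exists (infmx_block m n infmx0 f e infmx0).
have mulee (h : idempmx) i j : mulf h h i j = h i j.
  exact: (f_equal (fun A : infmx => A i j) (idempmxP h)).
split; apply: infmx_ext => i j; rewrite [RHS]mulf_block ?/= /blockf //.
- by do 2 case: ifP => _; rewrite !(mulf0l, mulf0r, addr0, add0r, mulee).
- exact: within_col.
- by do 2 case: ifP => _; rewrite !(mulf0l, mulf0r, addr0, add0r, mulee).
- exact: within_col.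
Qed.

End InfiniteMatrices.

Arguments infmx0 {R}.
Arguments idempmx0 {R}.

Section VMonoid.
Variable R : nuRingType.

Definition idempmx_equivb (e f : idempmx R) := `[< idempmx_equiv e f >].

Lemma idempmx_equivb_equiv : equiv_class_of idempmx_equivb.
Proof.
split=> [e|e f|f e g]; first exact/asboolP/eqv_refl.
- by apply/asboolP/asboolP => /eqv_sym.
- by move=> /asboolP ef /asboolP fg; apply/asboolP/(eqv_trans ef).
Qed.

Canonical idempmx_equivb_rel := EquivRelPack idempmx_equivb_equiv.
Canonical idempmx_equivb_encModRel := defaultEncModRel idempmx_equivb.

Definition Vmonoid := {eq_quot idempmx_equivb}.

HB.instance Definition _ := Choice.on Vmonoid.
HB.instance Definition _ : EqQuotient _ idempmx_equivb Vmonoid :=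
  EqQuotient.on Vmonoid.

Definition Vclass (e : idempmx R) : Vmonoid := \pi_Vmonoid e.

Lemma VclassP e f : Vclass e = Vclass f <-> idempmx_equiv e f.
Proof. by split=> [/eqmodP/asboolP|ef]; last exact/eqmodP/asboolP. Qed.

Definition Vadd (a b : Vmonoid) : Vmonoid :=
  Vclass (idempmx_dsum (repr a) (repr b)).

Lemma VaddE n (e f g : idempmx R) : mx_within n e ->
  g = infmx_dsum_at n e f :> infmx R -> Vadd (Vclass e) (Vclass f) = Vclass g.
Proof.
have eqv_repr h : idempmx_equiv (repr (Vclass h)) h.
  by apply/VclassP; apply: reprK.
move=> en gE; apply/VclassP; set a := repr (Vclass e); set b := repr (Vclass f).
apply: (@eqv_dsum_at _ (infmx_dim a) n a b e f) gE _ _ => //.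
- exact: infmx_dimP.
- exact: eqv_repr.
- exact: eqv_repr.
Qed.

Lemma VaddE_dsum e f : Vadd (Vclass e) (Vclass f) = Vclass (idempmx_dsum e f).
Proof. exact: (VaddE (@infmx_dimP _ e)). Qed.

Let VaddC : commutative Vadd.
Proof.
elim/quotW=> e; elim/quotW=> f; rewrite -!/(Vclass _) !VaddE_dsum.
by apply/VclassP/(eqv_dsumC (@infmx_dimP _ e) (@infmx_dimP _ f)).
Qed.

Let Vadd0 : left_id (Vclass idempmx0) Vadd.
Proof.
elim/quotW=> e; apply: (@VaddE 0%N) => //.
by apply: infmx_ext => i j; rewrite /= /blockf /= !subn0.
Qed.

Let VaddA : associative Vadd.
Proof.
elim/quotW=> e; elim/quotW=> f; elim/quotW=> g.
rewrite -!/(Vclass _) (VaddE_dsum f g) (VaddE_dsum e f) VaddE_dsum.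
set n := infmx_dim e; set m := infmx_dim f.
have hn : mx_within n e := @infmx_dimP _ e.
have hm : mx_within m f := @infmx_dimP _ f.
apply/esym; apply: (@VaddE (n + m)%N).
  move=> i j h; rewrite /= /blockf.
  by do 2 case: ltnP => ?; rewrite // ?(hn, hm) //; lia.
apply: infmx_ext => i j; rewrite /= /blockf -/n -/m !subnDA.
have -> : (i < n + m)%N = (i < n)%N || (i - n < m)%N by lia.
have -> : (j < n + m)%N = (j < n)%N || (j - n < m)%N by lia.
by do 4 case: ltnP => ? //=.
Qed.

HB.instance Definition _ := GRing.isNmodule.Build Vmonoid VaddA VaddC Vadd0.

End VMonoid.

Section GroupCompletion.
Variable M : nmodType.
Implicit Types a b c : M * M.

(* (a, b) stands for the formal difference a - b; as M need not be            *)
(* cancellative, equality of differences is stable equality.                  *)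
Definition gc_equiv a b := `[< exists k, a.1 + b.2 + k = b.1 + a.2 + k >].

Lemma gc_equiv_equiv : equiv_class_of gc_equiv.
Proof.
split=> [a|a b|b a c]; first by apply/asboolP; exists 0.
- by apply/asboolP/asboolP => -[k E]; exists k.
- move=> /asboolP[k E] /asboolP[l E']; apply/asboolP; exists (b.1 + b.2 + k + l).
  have -> : a.1 + c.2 + (b.1 + b.2 + k + l) = (a.1 + b.2 + k) + (b.1 + c.2 + l).
    by rewrite !addrA [in LHS](ACl (1*4*5*3*2*6)).
  by rewrite E E' !addrA (ACl (4*2*1*5*3*6)).
Qed.

Canonical gc_equiv_rel := EquivRelPack gc_equiv_equiv.
Canonical gc_encModRel := defaultEncModRel gc_equiv.

Definition group_completion := {eq_quot gc_equiv}.
Local Notation G := group_completion.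

HB.instance Definition _ := Choice.on G.
HB.instance Definition _ : EqQuotient _ gc_equiv G := EqQuotient.on G.

Definition gc_class (a : M * M) : G := \pi_G a.

Lemma gc_classP a b :
  gc_class a = gc_class b <-> exists k, a.1 + b.2 + k = b.1 + a.2 + k.
Proof. by split=> [/eqmodP/asboolP|ab]; last exact/eqmodP/asboolP. Qed.

Definition gc_add (x y : G) : G :=
  gc_class ((repr x).1 + (repr y).1, (repr x).2 + (repr y).2).
Definition gc_opp (x : G) : G := gc_class ((repr x).2, (repr x).1).

Lemma gc_repr a : exists k,
  (repr (gc_class a)).1 + a.2 + k = a.1 + (repr (gc_class a)).2 + k.
Proof. by apply/gc_classP/reprK. Qed.

Lemma gc_addE a b :
  gc_add (gc_class a) (gc_class b) = gc_class (a.1 + b.1, a.2 + b.2).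
Proof.
apply/gc_classP => /=; have [k Ek] := gc_repr a; have [l El] := gc_repr b.
exists (k + l); rewrite !addrA.
rewrite [LHS](ACl ((1*3*5)*(2*4*6))) [RHS](ACl ((1*3*5)*(2*4*6))) /=.
by rewrite Ek El.
Qed.

Lemma gc_oppE a : gc_opp (gc_class a) = gc_class (a.2, a.1).
Proof.
apply/gc_classP => /=; have [k Ek] := gc_repr a; exists k.
by rewrite [_ + a.1]addrC [a.2 + _]addrC Ek.
Qed.

Let gc_addA : associative gc_add.
Proof.
elim/quotW=> a; elim/quotW=> b; elim/quotW=> c.
by rewrite -!/(gc_class _) !gc_addE /= !addrA.
Qed.
Let gc_addC : commutative gc_add.
Proof.
elim/quotW=> a; elim/quotW=> b; rewrite -!/(gc_class _) !gc_addE.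
by rewrite (addrC a.1) (addrC a.2).
Qed.
Let gc_add0 : left_id (gc_class (0, 0)) gc_add.
Proof.
by elim/quotW=> -[a b]; rewrite -!/(gc_class _) gc_addE /= !add0r.
Qed.
Let gc_addN : left_inverse (gc_class (0, 0)) gc_opp gc_add.
Proof.
elim/quotW=> a; rewrite -!/(gc_class _) gc_oppE gc_addE.
by apply/gc_classP; exists 0; rewrite /= !addr0 add0r addrC.
Qed.

HB.instance Definition _ :=
  GRing.isZmodule.Build G gc_addA gc_addC gc_add0 gc_addN.

End GroupCompletion.

(* This is the usual K_0 when R has local units. *)
Definition K0 (R : nuRingType) : zmodType := group_completion (Vmonoid R).

Record weighted_graph := WeightedGraph {
  vertex : choiceType;
  edge : choiceType;
  esource : edge -> vertex;
  erange : edge -> vertex;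
  weight : edge -> nat;
  weight_gt0 : forall e, (0 < weight e)%N
}.

Arguments esource {w} _.
Arguments erange {w} _.
Arguments weight {w} _.

Section WeightedGraph.
Variable E : weighted_graph.
Implicit Types (u v : vertex E) (e f : edge E).

Definition row_finite : Prop :=
  forall v, finite_set [set e : edge E | esource e = v].

(* The edges emitted by v, without repetition; fset_set is empty by           *)
(* convention on infinite sets, which row-finiteness excludes.                *)
Definition out_edges v : seq (edge E) :=
  enum_fset (fset_set [set e | esource e = v]).

Definition vertex_weight v : nat := \max_(e <- out_edges v) weight e.

End WeightedGraph.

Section WeightedLeavittPathAlgebra.
Variables (K : fieldType) (E : weighted_graph).
Implicit Types (u v : vertex E) (e f : edge E).

(* Indices are shifted: i : 'I_(weight e) stands for the index i + 1, and    *)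
(* real_edge, ghost_edge below are zero for i >= weight e.                    *)
Inductive wlpa_gen :=
| Vertex of vertex E
| RealEdge e of 'I_(weight e)
| GhostEdge e of 'I_(weight e).

Local Notation term := (nuterm K wlpa_gen).

Definition vtx v : term := NUGen K (Vertex v).

Definition real_edge e (i : nat) : term :=
  if insub i is Some i' then NUGen K (@RealEdge e i') else NUZero.

Definition ghost_edge e (i : nat) : term :=
  if insub i is Some i' then NUGen K (@GhostEdge e i') else NUZero.

Inductive wlpa_rel : term -> term -> Prop :=
| wlpa_vertex u v :
    wlpa_rel (NUMul (vtx u) (vtx v)) (if u == v then vtx u else NUZero)
| wlpa_source e i : (i < weight e)%N ->
    wlpa_rel (NUMul (vtx (esource e)) (real_edge e i)) (real_edge e i)
| wlpa_range e i : (i < weight e)%N ->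
    wlpa_rel (NUMul (real_edge e i) (vtx (erange e))) (real_edge e i)
| wlpa_ghost_range e i : (i < weight e)%N ->
    wlpa_rel (NUMul (vtx (erange e)) (ghost_edge e i)) (ghost_edge e i)
| wlpa_ghost_source e i : (i < weight e)%N ->
    wlpa_rel (NUMul (ghost_edge e i) (vtx (esource e))) (ghost_edge e i)
| wlpa_out v i j : (i < vertex_weight v)%N -> (j < vertex_weight v)%N ->
    wlpa_rel
      (NUSum [seq NUMul (real_edge e i) (ghost_edge e j) | e <- out_edges v])
      (if i == j then vtx v else NUZero)
| wlpa_index v e f : esource e = v -> esource f = v ->
    wlpa_rel
      (NUSum [seq NUMul (ghost_edge e i) (real_edge f i)
             | i <- iota 0 (vertex_weight v)])
      (if e == f then vtx (erange e) else NUZero).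

Definition wlpa : nuAlgType K := presented_alg wlpa_rel.

End WeightedLeavittPathAlgebra.

Section PresentedAbelianGroup.
Variables (X : choiceType) (rel : set {freeg X}).

Definition relator_subgroup : {pred {freeg X}} := fun x =>
  `[< forall S : zmodClosed {freeg X}, (forall r, rel r -> r \in S) -> x \in S >].

Lemma relator_subgroup_zmod : zmod_closed relator_subgroup.
Proof.
split; first by apply/asboolP => S _; apply: rpred0.
move=> x y /asboolP xS /asboolP yS; apply/asboolP => S relS.
by rewrite rpredB ?xS ?yS.
Qed.

HB.instance Definition _ :=
  GRing.isZmodClosed.Build {freeg X} relator_subgroup relator_subgroup_zmod.

(* The abelian group with generators X and relations r = 0 for r in rel.      *)
Definition presented_group : zmodType := Quotient.quot relator_subgroup.

End PresentedAbelianGroup.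

Definition graph_group (E : weighted_graph) : zmodType :=
  presented_group [set r | exists v : vertex E,
    r = << v >> *+ vertex_weight v - \sum_(e <- out_edges v) << erange e >>].

(* Main.v *)
(* Write v^k for k copies of the vertex v, and let q(v, k) be the complement   *)
(* in v^k of the sum of the r(e), e of weight at most k; it is cut out by an  *)
(* idempotent over L = L_K(E, w).  The isomorphisms                           *)
(*     v + q(v, k) = q(v, k + 1) + the r(e), e of weight k + 1 from v,        *)
(* for k < w(v), with q(v, 0) = q(v, w(v)) = 0, define an algebra Lam in      *)
(* which each of them is a generic invertible matrix, and L maps to Lam.  In  *)
(* K_0(L) they give the relations of the graph group and put the classes of   *)
(* all q(v, k) in the span of those of the vertices.                          *)
(*                                                                            *)
(* Introducing a variable for each letter turns a matrix over Lam into a      *)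
(* linear system ("pencil") that has coefficients in K in the generators of   *)
(* Lam.  If one of the coefficient maps of a pencil is not injective, then    *)
(* the pencil can be shortened, without change of its solutions nor of its    *)
(* Euler characteristic.  If all are injective, then any right-hand side over *)
(* a Lam-module M is solved in an extension of M, because an isomorphism of   *)
(* finite-dimensional subspaces of large spaces extends to the large spaces.  *)
(* This has two consequences.                                                 *)
(* - A uniquely solvable pencil shortens to the empty one, hence has Euler    *)
(*   characteristic 0 in every group with the relations above.  So a stable   *)
(*   isomorphism of sums of vertices over L, pushed to Lam, forces equality   *)
(*   in the graph group: the graph group embeds in K_0(L).                    *)
(* - The image of an idempotent e over Lam is presented by an injective       *)
(*   pencil, that is e + F_1 = F_0 with F_0, F_1 sums of objects.  A          *)
(*   Lam-module of columns over L transports this back to L and shows that    *)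
(*   the vertices generate K_0(L).                                            *)

Require Import Defs.
From HB Require Import structures.
From mathcomp Require Import all_boot all_algebra generic_quotient.
From mathcomp Require Import ring_quotient freeg finmap zify.
From mathcomp Require Import boolp classical_sets functions cardinality.

Set Implicit Arguments.
Unset Strict Implicit.
Unset Printing Implicit Defensive.

Import GRing.Theory.
Local Open Scope ring_scope.

(** * Idempotent matrices over finite index types *)

(** Relations (iii) and (iv) say that the matrix of the [e_i] is an isomorphism from [w(v)] copies
    of the projective [v] to the sum of the [r(e)]. So [v] maps to its class by a homomorphism from
    the graph group to K_0(L) ([vcls_relation], [graph_group_to_K0]). This homomorphism is shown to
    be bijective; its inverse is the required isomorphism.

    Edges of different weights make the matrix at [v] ragged. It is therefore factored into [w(v)]
    steps, one for each weight, and each step is replaced by a generic invertible matrix. The result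
    is an algebra Lam, with a homomorphism [wlpa_hom] from L to Lam. In the other direction [theta]
    turns elements of Lam into matrices over L, and [theta_hom] says that nothing is lost on L.

    Linear algebra over Lam reduces to linear algebra over K. A pencil presents a Lam-module;
    [kill_exists] and [reduces_inj] shorten it until its coefficient maps are injective, and
    [embedding] then solves every right-hand side in a larger module. Hence an acyclic pencil has
    Euler characteristic 0 ([acyclic_chi]), and an injective pencil that presents an idempotent
    splits ([presents_unique_solution]).

    Injectivity: by [labelled_class] and [vlabelled_complement], an equality in K_0(L) between sums
    of vertices becomes, after adding further vertices, an isomorphism over L. Its image in Lam is
    an invertible matrix, and [invertible_balanced], applied to the function [xi] into the graph
    group, equates the two sides ([vcls_sum_inj]).

    Surjectivity: [idempotent_resolution] writes an idempotent over Lam as a difference of objects,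
    [class_resolution] carries this back to L, and [kappa_complement] expresses the class of every
    object by vertices. *)

Lemma numulNr (R : nuRingType) (x y : R) : x ** (- y) = - (x ** y).
Proof. by apply/eqP; rewrite -addr_eq0 -numulDr addNr numulr0. Qed.

Lemma numulNl (R : nuRingType) (x y : R) : (- x) ** y = - (x ** y).
Proof. by apply/eqP; rewrite -addr_eq0 -numulDl addNr numul0r. Qed.

Section FiniteIdempotents.
Variable R : nuRingType.

(** Matrices are indexed by arbitrary finite types, so that direct sums, families and restrictions
    become sums, products and injections of index types. The indices are numbered by [finmx] only to
    form a class in [Vmonoid]. *)
Definition fmul (I J L : finType) (x : I -> J -> R) (y : J -> L -> R) : I -> L -> R :=
  fun i l => \sum_j x i j ** y j l.

Definition idemf (I : finType) (e : I -> I -> R) := fmul e e = e.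

Lemma idemfE (I : finType) (e : I -> I -> R) : idemf e ->
  forall i j, e i j = \sum_k e i k ** e k j.
Proof. by move=> ee i j; rewrite -[LHS](congr1 (fun g => g i j) ee). Qed.

Lemma fmulA (I J L M : finType) (x : I -> J -> R) (y : J -> L -> R) (z : L -> M -> R) :
  fmul x (fmul y z) = fmul (fmul x y) z.
Proof.
apply/funext => i; apply/funext => m; rewrite /fmul.
under eq_bigr do rewrite numul_sumr.
rewrite exchange_big; apply: eq_bigr => l _; rewrite numul_suml.
by apply: eq_bigr => j _; rewrite numulA.
Qed.

Definition natmx (I J : finType) (x : I -> J -> R) : nat -> nat -> R := fun i j =>
  if insub i is Some i' then
    if insub j is Some j' then x (@enum_val I predT i') (@enum_val J predT j') else 0
  else 0.

Lemma natmx_row (I J : finType) (x : I -> J -> R) : rowb #|I| (natmx x).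
Proof. by move=> i j h; rewrite /natmx insubF // ltnNge h. Qed.

Lemma natmx_col (I J : finType) (x : I -> J -> R) : colb #|J| (natmx x).
Proof. by move=> i j h; rewrite /natmx; case: insubP => // *; rewrite insubF // ltnNge h. Qed.

Lemma natmx_fin (I J : finType) (x : I -> J -> R) : exists n, mx_within n (natmx x).
Proof.
exists (#|I| + #|J|)%N => i j /orP[] h.
  by apply: natmx_row; apply: leq_trans h; rewrite leq_addr.
by apply: natmx_col; apply: leq_trans h; rewrite leq_addl.
Qed.

Definition finmx (I J : finType) (x : I -> J -> R) : infmx R := InfMx (natmx_fin x).

Lemma natmxE (I J : finType) (x : I -> J -> R) (i : 'I_#|I|) (j : 'I_#|J|) :
  natmx x i j = x (enum_val i) (enum_val j).
Proof. by rewrite /natmx !valK. Qed.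

Lemma finmx_mul (I J L : finType) (x : I -> J -> R) (y : J -> L -> R) :
  infmx_mul (finmx x) (finmx y) = finmx (fmul x y).
Proof.
apply: infmx_ext => i l /=; rewrite (mulf_ord _ _ _ (@natmx_col _ _ x)).
case: (ltnP i #|I|) => hi; last first.
  rewrite natmx_row // big1 // => j _; by rewrite natmx_row // numul0r.
case: (ltnP l #|L|) => hl; last first.
  rewrite natmx_col // big1 // => j _; by rewrite [natmx y _ _]natmx_col // numulr0.
rewrite -[i]/(val (Ordinal hi)) -[l]/(val (Ordinal hl)) natmxE /fmul.
rewrite [RHS](reindex (@enum_val J predT)); last first.
  by exists enum_rank => j _; rewrite ?enum_valK ?enum_rankK.
by apply: eq_bigr => j _; rewrite !natmxE.
Qed.

Lemma finmx_idem (I : finType) (e : I -> I -> R) :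
  idemf e -> infmx_mul (finmx e) (finmx e) = finmx e.
Proof. by move=> ee; rewrite finmx_mul ee. Qed.

(** The value 0 on matrices that are not idempotent makes the class a total function of the matrix,
    so that equal matrices can be rewritten inside it; [fclsE] gives the intended value. *)
Definition fcls (I : finType) (e : I -> I -> R) : Vmonoid R :=
  if pselect (idemf e) is left ee then Vclass (IdempMx (finmx_idem ee)) else 0.

Lemma fclsE (I : finType) (e : I -> I -> R) (ee : idemf e) :
  fcls e = Vclass (IdempMx (finmx_idem ee)).
Proof. by rewrite /fcls; case: pselect => // e'; congr Vclass; apply: idempmx_ext. Qed.

Lemma fcls_eq (I J : finType) (e : I -> I -> R) (f : J -> J -> R) (x : I -> J -> R) (y : J -> I -> R) :
  idemf e -> idemf f -> fmul x y = e -> fmul y x = f -> fcls e = fcls f.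
Proof.
move=> ee ff xy yx; rewrite !fclsE; apply/VclassP.
by exists (finmx x), (finmx y); rewrite /= !finmx_mul xy yx.
Qed.

(** The corner conditions of [eqv_corner] confine the infinite matrices [x] and [y] to finite
    rectangles, so they come from matrices over the index types. *)
Lemma fcls_inv (I J : finType) (e : I -> I -> R) (f : J -> J -> R) :
  idemf e -> idemf f -> fcls e = fcls f ->
  exists x : I -> J -> R, exists y : J -> I -> R,
    [/\ fmul x y = e, fmul y x = f, fmul e (fmul x f) = x & fmul f (fmul y e) = y].
Proof.
move=> ee ff; rewrite !fclsE => /VclassP/eqv_corner [x [y [[ex xf fy ye] [/= exy fyx]]]].
have xr : rowb #|I| x by rewrite -ex; apply: mulf_rowb; apply: natmx_row.
have xc : colb #|J| x by rewrite -xf; apply: mulf_colb; apply: natmx_col.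
have yr : rowb #|J| y by rewrite -fy; apply: mulf_rowb; apply: natmx_row.
have yc : colb #|I| y by rewrite -ye; apply: mulf_colb; apply: natmx_col.
pose x' (i : I) (j : J) := x (enum_rank i) (enum_rank j).
pose y' (j : J) (i : I) := y (enum_rank j) (enum_rank i).
have fin_inj (A B : finType) (u v : A -> B -> R) : finmx u = finmx v -> u = v.
  move=> uv; apply/funext => a; apply/funext => b.
  by rewrite -[a]enum_rankK -[b]enum_rankK -!natmxE; move: (congr1 (@infmx_val R) uv) => /= ->.
have xE : finmx x' = x.
  apply: infmx_ext => i j /=.
  case: (ltnP i #|I|) => hi; last by rewrite natmx_row ?xr.
  case: (ltnP j #|J|) => hj; last by rewrite natmx_col ?xc.
  by rewrite -[i]/(val (Ordinal hi)) -[j]/(val (Ordinal hj)) natmxE /x' !enum_valK.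
have yE : finmx y' = y.
  apply: infmx_ext => j i /=.
  case: (ltnP i #|I|) => hi; last by rewrite natmx_col ?yc.
  case: (ltnP j #|J|) => hj; last by rewrite natmx_row ?yr.
  by rewrite -[i]/(val (Ordinal hi)) -[j]/(val (Ordinal hj)) natmxE /y' !enum_valK.
exists x', y'; split; apply: fin_inj; rewrite -!finmx_mul ?xE ?yE //.
- by rewrite xf ex.
- by rewrite ye fy.
Qed.

Definition fblock (I J : finType) (e : I -> I -> R) (f : J -> J -> R) : I + J -> I + J -> R :=
  fun a b => match a, b with
  | inl i, inl i' => e i i' | inr j, inr j' => f j j' | _, _ => 0 end.

Lemma fblock_idem (I J : finType) (e : I -> I -> R) (f : J -> J -> R) :
  idemf e -> idemf f -> idemf (fblock e f).
Proof.
move=> ee ff; apply/funext => a; apply/funext => b; rewrite /fmul big_sumType /=.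
case: a => a; case: b => b /=.
- by rewrite [X in _ + X]big1 ?addr0 -?idemfE // => k _; rewrite numulr0.
- by rewrite !big1 ?addr0 // => k _; rewrite ?numulr0 ?numul0r.
- by rewrite !big1 ?addr0 // => k _; rewrite ?numulr0 ?numul0r.
- by rewrite [X in X + _]big1 ?add0r -?idemfE // => k _; rewrite numulr0.
Qed.

(** The enumeration of [I + J] need not list [I] before [J], whereas [g] does. The matrices [u] and
    [v] are [g] with its rows, respectively its columns, renumbered by [pos]; as [g] is idempotent,
    [u v] and [v u] are the two idempotents to be compared. *)
Lemma fcls_block (I J : finType) (e : I -> I -> R) (f : J -> J -> R) :
  idemf e -> idemf f -> fcls (fblock e f) = fcls e + fcls f.
Proof.
move=> ee ff; have ef := fblock_idem ee ff; rewrite (fclsE ef) (fclsE ee) (fclsE ff).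
have en : mx_within #|I| (finmx e).
  by move=> i j /orP[]; [apply: natmx_row|apply: natmx_col].
set g := IdempMx (dsum_idem_at (IdempMx (finmx_idem ff)) (en : mx_within _ (IdempMx (finmx_idem ee)))).
rewrite [RHS](@VaddE _ #|I| _ _ g) //; apply/VclassP.
pose pos (a : I + J) : nat := match a with inl i => enum_rank i | inr j => #|I| + enum_rank j end.
have pos_lt a : (pos a < #|I| + #|J|)%N.
  by case: a => a /=; rewrite ?ltn_add2l ?ltn_ord // ltn_addr ?ltn_ord.
have gE a b : infmx_val g (pos a) (pos b) = fblock e f a b.
  rewrite /= /blockf; case: a => a; case: b => b /=;
    rewrite ?ltn_ord ?[(_ + _ < _)%N]ltnNge ?leq_addr /= ?addKn ?natmxE ?enum_rankK //.
have posK (i : nat) : (i < #|I| + #|J|)%N -> exists a, pos a = i.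
  case: (ltnP i #|I|) => hi h; first by exists (inl (enum_val (Ordinal hi))); rewrite /= enum_valK.
  have hj : (i - #|I| < #|J|)%N by lia.
  by exists (inr (enum_val (Ordinal hj))); rewrite /pos enum_valK; apply: subnKC.
have gw : mx_within (#|I| + #|J|) g.
  move=> i j h; rewrite /= /blockf; case: ltnP => hi; case: ltnP => hj //=.
    by case/orP: h => /(leq_trans (leq_addr _ _)); rewrite leqNgt ?hi ?hj.
  case/orP: h => h; [rewrite (@natmx_row _ _ f)|rewrite (@natmx_col _ _ f)] => //.
    by rewrite leq_subRL.
  by rewrite leq_subRL.
have pos_inj : injective pos.
  move=> [a|a] [b|b] /=.
  - by move/val_inj/enum_rank_inj ->.
  - by move=> h; have := ltn_ord (enum_rank a); rewrite h ltnNge leq_addr.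
  - by move=> h; have := ltn_ord (enum_rank b); rewrite -h ltnNge leq_addr.
  - by move/addnI/val_inj/enum_rank_inj ->.
pose u : nat -> nat -> R := fun i j => if insub i is Some i' then
  infmx_val g (pos (@enum_val (I + J)%type predT i')) j else 0.
pose v : nat -> nat -> R := fun i j => if insub j is Some j' then
  infmx_val g i (pos (@enum_val (I + J)%type predT j')) else 0.
have cardE : #|{: I + J}| = (#|I| + #|J|)%N by rewrite card_sum.
have uw : mx_within (#|I| + #|J|) u.
  move=> i j h; rewrite /u; case: insubP => // i' hi' iE.
  by apply: gw; case/orP: h => h; [move: hi'; rewrite cardE; lia|rewrite h orbT].
have vw : mx_within (#|I| + #|J|) v.
  move=> i j h; rewrite /v; case: insubP => // j' hj' jE.
  by apply: gw; case/orP: h => h; [rewrite h|move: hj'; rewrite cardE; lia].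
exists (InfMx (ex_intro (fun n => mx_within n u) _ uw)), (InfMx (ex_intro (fun n => mx_within n v) _ vw)).
split; apply: infmx_ext => i j.
  case: (ltnP i #|{: I + J}|) => hi; last first.
    rewrite [LHS]natmx_row // [RHS](@mulf_rowb _ #|{: I + J}|) // => i' j' h; rewrite /= /u insubF //.
    by rewrite ltnNge h.
  case: (ltnP j #|{: I + J}|) => hj; last first.
    rewrite [LHS]natmx_col // [RHS](@mulf_colb _ #|{: I + J}|) // => i' j' h; rewrite /= /v insubF //.
    by rewrite ltnNge h.
  rewrite [LHS](natmxE _ (Ordinal hi) (Ordinal hj)) -gE -{1}(idempmxP g) /=.
  rewrite !(mulf_ord _ _ _ (within_col gw)) [RHS](mulf_ord _ _ _ (within_col uw)).
  by apply: eq_bigr => k _; rewrite /u /v !insubT.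
rewrite [RHS](@mulf_ord _ #|{: I + J}|); last by rewrite cardE; apply: within_col.
rewrite -{1}(idempmxP g) [LHS](mulf_ord _ _ _ (within_col gw)) /=.
rewrite (reindex (fun k : 'I_#|{: I + J}| => Ordinal (pos_lt (enum_val k)))) /=; last first.
  pose q (k : 'I_(#|I| + #|J|)) := enum_rank (sval (cid (posK k (ltn_ord k)))).
  exists q => k _; last by apply: val_inj; rewrite /= /q enum_rankK; case: cid.
  by rewrite /q; case: cid => a /= /pos_inj ->; rewrite enum_valK.
by apply: eq_bigr => k _; rewrite /u /v !valK.
Qed.

Lemma fcls_surj (e : idempmx R) : exists n (f : 'I_n -> 'I_n -> R), idemf f /\ Vclass e = fcls f.
Proof.
pose n := infmx_dim e; have en := @infmx_dimP _ e.
pose f (i j : 'I_n) := infmx_val e i j.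
have fE : finmx f = e.
  have c : #|'I_n| = n by rewrite card_ord.
  apply: infmx_ext => i j /=; case: (ltnP i #|'I_n|) => hi; last first.
    by rewrite natmx_row // (within_row en) // -/n -c.
  case: (ltnP j #|'I_n|) => hj; last by rewrite natmx_col // (within_col en) // -/n -c.
  by rewrite (natmxE f (Ordinal hi) (Ordinal hj)) /f !enum_val_ord.
have ff : idemf f.
  apply/funext => i; apply/funext => j.
  by rewrite [RHS]/f -idempmxP /= (mulf_ord _ _ _ (within_col en)).
by exists n, f; split=> //; rewrite fclsE; congr Vclass; apply: idempmx_ext.
Qed.

Lemma fcls0 (I : finType) : fcls (fun _ _ : I => 0 : R) = 0.
Proof.
have z : idemf (fun _ _ : I => 0 : R).
  by apply/funext => i; apply/funext => j; rewrite /fmul big1 // => k _; rewrite numulr0.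
rewrite fclsE; apply/VclassP; exists infmx0, infmx0; split; apply: infmx_ext => i j /=.
  by rewrite mulf0l /natmx; do 2 case: insub => //.
by rewrite mulf0l.
Qed.

End FiniteIdempotents.

(** * Modules over presented algebras *)

Section TermEvaluation.
Variables (K : fieldType) (X : Type) (B : nuAlgType K) (g : X -> B).

Fixpoint aeval (t : nuterm K X) : B :=
  match t with
  | NUGen x => g x
  | NUZero => 0
  | NUAdd s t => aeval s + aeval t
  | NUOpp t => - aeval t
  | NUScale a t => a *: aeval t
  | NUMul s t => aeval s ** aeval t
  end.

Lemma aeval_sum (s : seq (nuterm K X)) : aeval (NUSum s) = \sum_(t <- s) aeval t.
Proof. by elim: s => [|t s IH] /=; rewrite ?big_nil // big_cons IH. Qed.

Variable rel : nuterm K X -> nuterm K X -> Prop.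
Hypothesis grel : forall s t, rel s t -> aeval s = aeval t.

Lemma aeval_cong s t : nucong rel s t -> aeval s = aeval t.
Proof.
elim=> //=.
- by move=> > _ -> _ ->.
- by move=> > _ -> _ ->.
- by move=> > _ ->.
- by move=> > _ ->.
- by move=> > _ -> _ ->.
- by move=> *; rewrite addrA.
- by move=> *; rewrite addrC.
- by move=> *; rewrite add0r.
- by move=> *; rewrite addNr.
- by move=> *; rewrite scalerA.
- by move=> *; rewrite scale1r.
- by move=> *; rewrite scalerDr.
- by move=> *; rewrite scalerDl.
- by move=> *; rewrite numulA.
- by move=> *; rewrite numulDl.
- by move=> *; rewrite numulDr.
- by move=> *; rewrite nuscaleAl.
- by move=> *; rewrite nuscaleAr.
Qed.

Definition pres_map (x : presented_alg rel) : B := aeval (repr x).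

Lemma pres_map_class t : pres_map (pres_class rel t) = aeval t.
Proof. exact/aeval_cong/pres_repr. Qed.

Lemma pres_mapD : {morph pres_map : x y / x + y}.
Proof. by elim/quotW=> s; elim/quotW=> t; rewrite -!/(pres_class _ _) -pres_classD !pres_map_class. Qed.

Lemma pres_map0 : pres_map 0 = 0.
Proof. by rewrite -pres_class0 pres_map_class. Qed.

Lemma pres_map_sum I (r : seq I) (P : pred I) F :
  pres_map (\sum_(i <- r | P i) F i) = \sum_(i <- r | P i) pres_map (F i).
Proof. by apply: big_morph; [exact: pres_mapD|exact: pres_map0]. Qed.

Lemma pres_mapM x y : pres_map (x ** y) = pres_map x ** pres_map y.
Proof.
by move: x y; elim/quotW=> s; elim/quotW=> t; rewrite -!/(pres_class _ _) -pres_classM !pres_map_class.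
Qed.

End TermEvaluation.

Lemma presented_ind (K : fieldType) (X : Type) (rel : nuterm K X -> nuterm K X -> Prop)
    (P : presented_alg rel -> Prop) :
  (forall x, P (pres_class rel (NUGen K x))) -> P 0 ->
  (forall a b, P a -> P b -> P (a + b)) -> (forall a, P a -> P (- a)) ->
  (forall k a, P a -> P (k *: a)) -> (forall a b, P a -> P b -> P (a ** b)) ->
  forall a, P a.
Proof.
move=> Pg P0 PD PN PZ PM a; rewrite -(pres_reprK a); elim: (repr a) => //.
- by move=> s Ps t Pt; rewrite pres_classD; apply: PD.
- by move=> s Ps; rewrite pres_classN; apply: PN.
- by move=> k s Ps; rewrite pres_classZ; apply: PZ.
- by move=> s Ps t Pt; rewrite pres_classM; apply: PM.
Qed.

(** The algebra has no 1, so no unit law can be imposed. The components of a module are singled out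
    by equations such as [rX x $* m = m] instead. *)
Record nmod (K : fieldType) (A : nuAlgType K) := NMod {
  nmod_car :> lmodType K;
  nact : A -> nmod_car -> nmod_car;
  nactDl : forall a b m, nact (a + b) m = nact a m + nact b m;
  nactDr : forall a m m', nact a (m + m') = nact a m + nact a m';
  nactZl : forall k a m, nact (k *: a) m = k *: nact a m;
  nactZr : forall k a m, nact a (k *: m) = k *: nact a m;
  nactM : forall a b m, nact (a ** b) m = nact a (nact b m)
}.

Notation "a $* m" := (nact a m) (at level 38, right associativity).

Section NmodTheory.
Variables (K : fieldType) (A : nuAlgType K) (M : nmod A).
Implicit Types (a : A) (m : M).

Lemma nact0r a : a $* (0 : M) = 0.
Proof. by rewrite -(scale0r (0 : M)) nactZr !scale0r. Qed.

Lemma nact0l m : 0 $* m = 0.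
Proof. by have := nactZl 0 (0 : A) m; rewrite !scale0r. Qed.

Lemma nactNr a m : a $* (- m) = - (a $* m).
Proof. by rewrite -scaleN1r nactZr scaleN1r. Qed.

Lemma nactNl a m : (- a) $* m = - (a $* m).
Proof. by have := nactZl (-1) a m; rewrite !scaleN1r. Qed.

Lemma nactBr a m m' : a $* (m - m') = a $* m - a $* m'.
Proof. by rewrite nactDr nactNr. Qed.

Lemma nact_sumr a I (r : seq I) (P : pred I) (F : I -> M) :
  a $* (\sum_(i <- r | P i) F i) = \sum_(i <- r | P i) a $* F i.
Proof. by apply: (big_morph (nact a)); [exact: nactDr|exact: nact0r]. Qed.

Lemma nact_suml m I (r : seq I) (P : pred I) (F : I -> A) :
  (\sum_(i <- r | P i) F i) $* m = \sum_(i <- r | P i) F i $* m.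
Proof.
apply: (big_morph (fun a => a $* m)); [by move=> a b; exact: nactDl|exact: nact0l].
Qed.

End NmodTheory.

Section OperatorModules.
Variables (K : fieldType) (X : Type) (M : lmodType K) (op : X -> M -> M).

Fixpoint oeval (t : nuterm K X) : M -> M := fun m =>
  match t with
  | NUGen x => op x m
  | NUZero => 0
  | NUAdd s t => oeval s m + oeval t m
  | NUOpp t => - oeval t m
  | NUScale a t => a *: oeval t m
  | NUMul s t => oeval s (oeval t m)
  end.

Lemma oeval_add s t m : oeval (NUAdd s t) m = oeval s m + oeval t m. Proof. by []. Qed.

Lemma oeval_opp t m : oeval (NUOpp t) m = - oeval t m. Proof. by []. Qed.

Lemma oeval_scale k t m : oeval (NUScale k t) m = k *: oeval t m. Proof. by []. Qed.

Lemma oeval_mul s t m : oeval (NUMul s t) m = oeval s (oeval t m). Proof. by []. Qed.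

Lemma oeval_sum (s : seq (nuterm K X)) m : oeval (NUSum s) m = \sum_(t <- s) oeval t m.
Proof. by elim: s => [|t s IH] /=; rewrite ?big_nil // big_cons IH. Qed.

Variable rel : nuterm K X -> nuterm K X -> Prop.
Hypothesis opD : forall x m m', op x (m + m') = op x m + op x m'.
Hypothesis opZ : forall x k m, op x (k *: m) = k *: op x m.
Hypothesis oprel : forall s t, rel s t -> forall m, oeval s m = oeval t m.

Lemma oevalD t m m' : oeval t (m + m') = oeval t m + oeval t m'.
Proof.
elim: t m m' => //=.
- by move=> *; rewrite addr0.
- by move=> s IHs t IHt m m'; rewrite IHs IHt addrACA.
- by move=> t IH m m'; rewrite IH opprD.
- by move=> k t IH m m'; rewrite IH scalerDr.
- by move=> s IHs t IHt m m'; rewrite IHt IHs.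
Qed.

Lemma oevalZ t k m : oeval t (k *: m) = k *: oeval t m.
Proof.
elim: t m => //=.
- by move=> *; rewrite scaler0.
- by move=> s IHs t IHt m; rewrite IHs IHt scalerDr.
- by move=> t IH m; rewrite IH scalerN.
- by move=> l t IH m; rewrite IH !scalerA mulrC.
- by move=> s IHs t IHt m; rewrite IHt IHs.
Qed.

Lemma oeval_cong s t : nucong rel s t -> forall m, oeval s m = oeval t m.
Proof.
elim=> //=.
- by move=> > _ + _ + m => -> ->.
- by move=> > _ + _ + m => -> ->.
- by move=> > _ + m => ->.
- by move=> > _ + m => ->.
- by move=> > _ + _ + m => -> ->.
- by move=> *; rewrite addrA.
- by move=> *; rewrite addrC.
- by move=> *; rewrite add0r.
- by move=> *; rewrite addNr.
- by move=> *; rewrite scalerA.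
- by move=> *; rewrite scale1r.
- by move=> *; rewrite scalerDr.
- by move=> *; rewrite scalerDl.
- by move=> *; rewrite oevalD.
- by move=> *; rewrite oevalZ.
Qed.

Definition omod_act (a : presented_alg rel) : M -> M := oeval (repr a).

Lemma omod_class t m : omod_act (pres_class rel t) m = oeval t m.
Proof. exact/oeval_cong/pres_repr. Qed.

Definition omod : nmod (presented_alg rel).
Proof.
refine (@NMod K (presented_alg rel) M omod_act _ _ _ _ _).
- by elim/quotW=> s; elim/quotW=> t m; rewrite -!/(pres_class _ _) -pres_classD !omod_class.
- by move=> a m m'; apply: oevalD.
- by move=> k; elim/quotW=> s m; rewrite -!/(pres_class _ _) -pres_classZ !omod_class.
- by move=> k a m; apply: oevalZ.
- by elim/quotW=> s; elim/quotW=> t m; rewrite -!/(pres_class _ _) -pres_classM !omod_class.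
Defined.

Lemma omod_gen x (m : M) : pres_class rel (NUGen K x) $* (m : omod) = op x m.
Proof. exact: omod_class. Qed.

End OperatorModules.

(** * Linear systems over the algebra of a hypergraph *)

(* A hyperedge z stands for a generic invertible matrix between the direct    *)
(* sums of its slots in A z and of its slots in B z: rps z is the matrix of   *)
(* the isomorphism from the B-side to the A-side, rph z that of its inverse,  *)
(* and rX x is the projection onto the component labelled x.                  *)
Record hypergraph := Hypergraph {
  hvtx : choiceType;
  hslot : choiceType;
  hyp : choiceType;
  hlab : hslot -> hvtx;
  hA : hyp -> seq hslot;
  hB : hyp -> seq hslot;
  hA_uniq : forall z, uniq (hA z);
  hB_uniq : forall z, uniq (hB z);
  hA_neq0 : forall z, exists a, a \in hA z;
  hB_neq0 : forall z, exists b, b \in hB z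
}.

Definition hswap (H : hypergraph) : hypergraph :=
  Hypergraph (@hlab H) (@hB_uniq H) (@hA_uniq H) (@hB_neq0 H) (@hA_neq0 H).

Record hrep (K : fieldType) (H : hypergraph) (Lam : nuAlgType K) := HRep {
  rX : hvtx H -> Lam;
  rph : hyp H -> hslot H -> hslot H -> Lam;
  rps : hyp H -> hslot H -> hslot H -> Lam;
  rXX : forall x y, rX x ** rX y = if x == y then rX x else 0;
  rphl : forall z b a, rX (hlab b) ** rph z b a = rph z b a;
  rphr : forall z b a, rph z b a ** rX (hlab a) = rph z b a;
  rpsl : forall z a b, rX (hlab a) ** rps z a b = rps z a b;
  rpsr : forall z a b, rps z a b ** rX (hlab b) = rps z a b;
  rphps : forall z b b', b \in hB z -> b' \in hB z ->
    \sum_(a <- hA z) rph z b a ** rps z a b' = if b == b' then rX (hlab b) else 0;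
  rpsph : forall z a a', a \in hA z -> a' \in hA z ->
    \sum_(b <- hB z) rps z a b ** rph z b a' = if a == a' then rX (hlab a) else 0
}.

Definition rswap (K : fieldType) H (Lam : nuAlgType K) (r : hrep H Lam) : @hrep K (hswap H) Lam :=
  @HRep K (hswap H) Lam (rX r) (rps r) (rph r) (rXX r) (rpsl r) (rpsr r) (rphl r) (rphr r)
    (rpsph r) (rphps r).

(* A finite-dimensional representation, in bases: V with basis 'I_pn labelled *)
(* by vertices, W with basis 'I_pm labelled by hyperedges, and the components *)
(* W_z -> V_(hlab s) for s in A z and in B z.  Coordinates of pa j s and      *)
(* pb j s at basis vectors with a label other than hlab s are ignored.        *)
Record pencil (K : fieldType) (X S Z : Type) := Pencil {
  pn : nat;
  plab : 'I_pn -> X;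
  pm : nat;
  pz : 'I_pm -> Z;
  pa : 'I_pm -> S -> 'I_pn -> K;
  pb : 'I_pm -> S -> 'I_pn -> K
}.

Arguments plab {K X S Z} p _.
Arguments pz {K X S Z} p _.
Arguments pa {K X S Z} p _ _ _.
Arguments pb {K X S Z} p _ _ _.

Definition pswap K X S Z (Q : pencil K X S Z) : pencil K X S Z :=
  Pencil (plab Q) (pz Q) (pb Q) (pa Q).

Section Vectors.
Variables (K : fieldType) (M : lmodType K).

Definition ev n (f : 'I_n -> M) (y : 'I_n -> K) : M := \sum_i y i *: f i.

Lemma evD n (f : 'I_n -> M) y y' : ev f (fun i => y i + y' i) = ev f y + ev f y'.
Proof. by rewrite /ev -big_split; apply: eq_bigr => i _; rewrite scalerDl. Qed.

Lemma evN n (f : 'I_n -> M) y : ev f (fun i => - y i) = - ev f y.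
Proof. by rewrite /ev -sumrN; apply: eq_bigr => i _; rewrite scaleNr. Qed.

Lemma evZ n (f : 'I_n -> M) a y : ev f (fun i => a * y i) = a *: ev f y.
Proof. by rewrite /ev scaler_sumr; apply: eq_bigr => i _; rewrite scalerA. Qed.

Lemma ev0 n (f : 'I_n -> M) : ev f (fun=> 0) = 0.
Proof. by rewrite /ev big1 // => i _; rewrite scale0r. Qed.

Lemma ev_sum n (f : 'I_n -> M) I (r : seq I) (P : pred I) F :
  ev f (fun i => \sum_(j <- r | P j) F j i) = \sum_(j <- r | P j) ev f (F j).
Proof. by rewrite /ev exchange_big; apply: eq_bigr => i _; rewrite scaler_suml. Qed.

Lemma ev_delta n (f : 'I_n -> M) i : ev f (fun k => (i == k)%:R) = f i.
Proof.
rewrite /ev (bigD1 i) //= eqxx scale1r big1 ?addr0 // => k ki.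
by rewrite eq_sym (negbTE ki) scale0r.
Qed.

Lemma evfD n (f f' : 'I_n -> M) y : ev (fun i => f i + f' i) y = ev f y + ev f' y.
Proof. by rewrite /ev -big_split; apply: eq_bigr => i _; rewrite scalerDr. Qed.

Lemma evfB n (f f' : 'I_n -> M) y : ev (fun i => f i - f' i) y = ev f y - ev f' y.
Proof. by rewrite /ev -sumrB; apply: eq_bigr => i _; rewrite scalerBr. Qed.

Lemma evf0 n y : ev (fun _ : 'I_n => 0) y = 0.
Proof. by rewrite /ev big1 // => i _; rewrite scaler0. Qed.

(** [T] is a linear map that sends the basis vector [i] to [T i]: [push] is this map on coordinate
    vectors, and [pull] is its transpose on families with values in [M]; [ev_pull] is the
    duality. *)
Definition push n n' (T : 'I_n -> 'I_n' -> K) (u : 'I_n -> K) : 'I_n' -> K :=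
  fun k => \sum_i u i * T i k.

Definition pull n n' (T : 'I_n -> 'I_n' -> K) (f : 'I_n' -> M) : 'I_n -> M :=
  fun i => ev f (T i).

Lemma ev_pull n n' (T : 'I_n -> 'I_n' -> K) f u : ev (pull T f) u = ev f (push T u).
Proof.
rewrite /pull /push ev_sum; rewrite /ev; apply: eq_bigr => i _.
by rewrite scaler_sumr; apply: eq_bigr => k _; rewrite scalerA.
Qed.

Definition msk (X : eqType) n (lb : 'I_n -> X) (x : X) (y : 'I_n -> K) : 'I_n -> K :=
  fun i => if lb i == x then y i else 0.

End Vectors.

(** * Elimination of variables by K-linear relations *)

Section Pencils.
Variables (K : fieldType) (H : hypergraph) (Lam : nuAlgType K) (r : hrep H Lam).
Local Notation X := (hvtx H).
Local Notation S := (hslot H).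
Local Notation Z := (hyp H).
Local Notation rX := (rX r).

Definition labelled (M : nmod Lam) n (lb : 'I_n -> X) (f : 'I_n -> M) :=
  forall i, rX (lb i) $* f i = f i.

Lemma rX_act (M : nmod Lam) x y (m : M) : rX x $* rX y $* m = if x == y then rX x $* m else 0.
Proof. by rewrite -nactM rXX; case: ifP => // _; rewrite nact0l. Qed.

Lemma rX_ev (M : nmod Lam) n (lb : 'I_n -> X) (f : 'I_n -> M) x y :
  labelled lb f -> rX x $* ev f y = ev f (msk lb x y).
Proof.
move=> lf; rewrite /ev nact_sumr; apply: eq_bigr => i _; rewrite nactZr /msk.
rewrite -lf rX_act eq_sym; case: eqP => [->//|_]; by rewrite scaler0 scale0r.
Qed.

Lemma rps_ev (M : nmod Lam) n (lb : 'I_n -> X) (f : 'I_n -> M) z a b y :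
  labelled lb f -> rps r z a b $* ev f y = rps r z a b $* ev f (msk lb (hlab b) y).
Proof. by move=> lf; rewrite -(rX_ev _ _ lf) -nactM rpsr. Qed.

(** The quotient of the variables by the relations [rX (x j) $* ev f (y j) = 0]: [sec] chooses the
    surviving variables, and [T] writes all variables in terms of them, compatibly with the
    labels. *)
Record killing (J : eqType) (s : seq J) (x : J -> X) n (y : J -> 'I_n -> K) (lb : 'I_n -> X)
    n' (sec : 'I_n' -> 'I_n) (T : 'I_n -> 'I_n' -> K) : Prop := Killing {
  kill_lab : forall i k, T i k != 0 -> lb (sec k) = lb i;
  kill_sec : forall k l, T (sec k) l = (k == l)%:R;
  kill_zero : forall j, j \in s -> push T (msk lb (x j) (y j)) = fun=> 0;
  kill_all : forall (M : nmod Lam) (f : 'I_n -> M), labelled lb f ->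
    (forall j, j \in s -> rX (x j) $* ev f (y j) = 0) -> f = pull T (f \o sec)
}.

(** The left-hand sides of the relations can be prescribed freely in [M]. In a spacious module this
    forces the relations to be linearly independent over K. *)
Definition independent (M : nmod Lam) (J : eqType) (s : seq J) (x : J -> X) n
    (y : J -> 'I_n -> K) (lb : 'I_n -> X) :=
  forall mu : J -> M, (forall j, j \in s -> rX (x j) $* mu j = mu j) ->
  exists f : 'I_n -> M, labelled lb f /\ forall j, j \in s -> rX (x j) $* ev f (y j) = mu j.

Definition spacious (M : nmod Lam) := forall x, exists m : M, rX x $* m = m /\ m <> 0.

Section KillingTheory.
Variables (J : eqType) (s : seq J) (x : J -> X) (n : nat) (y : J -> 'I_n -> K) (lb : 'I_n -> X).
Variables (n' : nat) (sec : 'I_n' -> 'I_n) (T : 'I_n -> 'I_n' -> K).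
Hypothesis kT : killing s x y lb sec T.
Variable M : nmod Lam.

Lemma pull_labelled (f : 'I_n' -> M) : labelled (lb \o sec) f -> labelled lb (pull T f).
Proof.
move=> lf i; rewrite /pull (rX_ev _ _ lf); congr ev; apply/funext => k; rewrite /msk /=.
by case: eqP => // ki; apply/esym/eqP; apply: contra_notT ki => /(kill_lab kT).
Qed.

Lemma pull_sec (f : 'I_n' -> M) : pull T f \o sec = f.
Proof.
apply/funext => k; rewrite /pull /= -[RHS]ev_delta; congr ev.
by apply/funext => l; rewrite (kill_sec kT).
Qed.

Lemma pull_zero (f : 'I_n' -> M) j : labelled (lb \o sec) f -> j \in s ->
  rX (x j) $* ev (pull T f) (y j) = 0.
Proof.
move=> lf js; rewrite (rX_ev _ _ (pull_labelled lf)) ev_pull (kill_zero kT js).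
exact: ev0.
Qed.

End KillingTheory.

(** Gaussian elimination, one relation at a time. Modulo the earlier relations, the relation [j] is
    either zero, which independence in a spacious module excludes, or it has a nonzero coordinate
    and eliminates one variable with label [x j]. So each independent relation costs exactly
    [xi (x j)]. *)
Lemma kill_exists (J : eqType) (s : seq J) (x : J -> X) n (y : J -> 'I_n -> K) (lb : 'I_n -> X) :
  exists n' (sec : 'I_n' -> 'I_n) T, killing s x y lb sec T /\
  (forall M0, spacious M0 -> uniq s -> independent M0 s x y lb ->
   forall (D : zmodType) (xi : X -> D),
   \sum_i xi (lb i) = \sum_k xi (lb (sec k)) + \sum_(j <- s) xi (x j)).
Proof.
elim: s => [|j s [n1 [sec1 [T1 [k1 sum1]]]]].
  exists n, id, (fun i k => (i == k)%:R); split; last by move=> *; rewrite big_nil addr0.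
  split=> //.
  - by move=> i k; have [->//|_] := eqVneq i k; rewrite eqxx.
  - by move=> M f lf _; apply/funext => i; rewrite /pull ev_delta.
(* The relation [j], rewritten in the variables that survive the earlier relations. *)
pose y1 := push T1 (msk lb (x j) (y j)).
have ev_y1 (M : nmod Lam) (f : 'I_n -> M) : labelled lb f ->
    (forall i, i \in s -> rX (x i) $* ev f (y i) = 0) ->
    rX (x j) $* ev f (y j) = ev (f \o sec1) y1.
  by move=> lf f0; rewrite (rX_ev _ _ lf) {1}(kill_all k1 lf f0) ev_pull.
case: (pselect (exists k, y1 k != 0)) => [[k0 y1k0]|y10]; last first.
  have {}y10 : y1 = fun=> 0.
    by apply/funext => k; apply/eqP; apply: contra_notT y10 => h; exists k.
  exists n1, sec1, T1; split.
    split.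
    - exact: kill_lab k1.
    - exact: kill_sec k1.
    - by move=> i; rewrite inE => /orP[/eqP->//|]; apply: kill_zero k1 _.
    - by move=> M f lf f0; apply: (kill_all k1 lf) => i si; apply: f0; rewrite inE si orbT.
  (* Prescribing a nonzero value for the relation [j] and 0 for the others is impossible if [j]
     follows from the others. *)
  move=> M0 sp /= /andP[js us] ind; exfalso.
  have [m [xm m0]] := sp (x j).
  have [|f [lf fE]] := ind (fun i => if i == j then m else 0).
    by move=> i _; case: eqP => [->//|_]; rewrite nact0r.
  have := fE j; rewrite inE eqxx => /(_ isT); rewrite ev_y1 // ?y10 ?ev0 => [/esym //|i si].
  rewrite fE ?inE ?si ?orbT //; case: eqP => // ij; by rewrite -ij si in js.
have lab_y1 k : y1 k != 0 -> lb (sec1 k) = x j.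
  move=> h; apply: contra_neqP h => h; rewrite /y1 /push big1 // => i _; rewrite /msk.
  case: eqP => [xi|_]; last by rewrite mul0r.
  by apply/eqP; rewrite mulf_eq0; apply/orP; right; apply: contra_notT h => /(kill_lab k1) ->.
have y1E : push T1 (msk lb (x j) (y j)) = y1 by [].
case: n1 sec1 T1 k1 sum1 y1 ev_y1 k0 y1k0 lab_y1 y1E
  => [|n2] sec1 T1 k1 sum1 y1 ev_y1 k0 y1k0 lab_y1 y1E.
  by case: (k0).
(* The pivot variable [k0] is replaced by the combination of the other ones that solves the
   relation. *)
pose T (i : 'I_n) (k : 'I_n2) := T1 i (fintype.lift k0 k) - T1 i k0 * ((y1 k0)^-1 * y1 (fintype.lift k0 k)).
have pushT u k : push T u k = push T1 u (fintype.lift k0 k) - push T1 u k0 * ((y1 k0)^-1 * y1 (fintype.lift k0 k)).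
  rewrite /push /T mulr_suml -sumrB; apply: eq_bigr => i _; by rewrite mulrBr mulrA.
exists n2, (sec1 \o fintype.lift k0), T; split.
  split.
  - move=> i k /= Tik; have [h|h] := eqVneq (T1 i (fintype.lift k0 k)) 0; last exact: kill_lab k1 _ _ h.
    move: Tik; rewrite /T h add0r oppr_eq0 !mulf_eq0 !negb_or => /and3P[h1 _ h2].
    by rewrite lab_y1 // -(lab_y1 k0) //; apply: kill_lab k1 _ _ h1.
  - move=> k l; rewrite /T /= !(kill_sec k1) [fintype.lift k0 k == k0]eq_sym (negbTE (neq_lift _ _)).
    by rewrite mul0r subr0 (inj_eq (@lift_inj _ _)).
  - move=> i; rewrite inE => si; apply/funext => k; rewrite pushT.
    case: (eqVneq i j) si => [->|_] /=; last first.
      by move=> si; rewrite (kill_zero k1 si) mul0r subr0.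
    by rewrite y1E mulrA divff // mul1r subrr.
  - move=> M f lf f0.
    have f0' i : i \in s -> rX (x i) $* ev f (y i) = 0.
      by move=> si; apply: f0; rewrite inE si orbT.
    have /esym := ev_y1 M f lf f0'; rewrite f0 ?inE ?eqxx // /ev (bigD1_ord k0) //= => e0.
    have fk0 : f (sec1 k0) = - \sum_k ((y1 k0)^-1 * y1 (fintype.lift k0 k)) *: f (sec1 (fintype.lift k0 k)).
      apply: (scalerI y1k0); apply/eqP; rewrite scalerN -addr_eq0 scaler_sumr.
      rewrite -[X in _ == X]e0; apply/eqP; congr (_ + _).
      by apply: eq_bigr => k _; rewrite scalerA mulrA divff // mul1r.
    rewrite {1}(kill_all k1 lf f0'); apply/funext => i.
    rewrite /pull /ev (bigD1_ord k0) //= fk0 scalerN scaler_sumr addrC -sumrB.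
    by apply: eq_bigr => k _; rewrite /T scalerBl !scalerA.
move=> M0 sp /= /andP[js us] ind D xi; rewrite big_cons (sum1 M0) //; last first.
  move=> mu xmu; have [|f [lf fE]] := ind (fun i => if i == j then 0 else mu i).
    by move=> i; rewrite inE; case: eqP => [_ _|_ /= si]; rewrite ?nact0r ?xmu.
  exists f; split=> // i si; rewrite fE ?inE ?si ?orbT //; case: eqP => // ij.
  by rewrite -ij si in js.
by rewrite (bigD1_ord k0) //= lab_y1 // addrA [_ + xi (x j)]addrC.
Qed.

End Pencils.

(** * Solutions of a pencil, and the removal of one equation *)

Section PencilSolutions.
Variables (K : fieldType) (H : hypergraph) (Lam : nuAlgType K) (r : hrep H Lam).
Local Notation X := (hvtx H).
Local Notation S := (hslot H).
Local Notation Z := (hyp H).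
Local Notation rX := (rX r).
Local Notation pencil := (pencil K X S Z).

Definition del (M : nmod Lam) (Q : pencil) (f : 'I_(pn Q) -> M) j s : M :=
  rX (hlab s) $* ev f (pa Q j s)
  - \sum_(b <- hB (pz Q j)) rps r (pz Q j) s b $* ev f (pb Q j b).

Definition rhs (M : nmod Lam) (Q : pencil) (g : 'I_(pm Q) -> S -> M) :=
  forall j s, s \in hA (pz Q j) -> rX (hlab s) $* g j s = g j s.

Definition sol (M : nmod Lam) (Q : pencil) (g : 'I_(pm Q) -> S -> M) f :=
  labelled r (plab Q) f /\ forall j s, s \in hA (pz Q j) -> del f j s = g j s.

(** The homogeneous solutions in [M] are the homomorphisms to [M] from the module that the pencil
    presents; this module is seen only through its functor of solutions. *)
Definition sol0 (M : nmod Lam) (Q : pencil) f := sol (fun _ _ => 0 : M) (f : 'I_(pn Q) -> M).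

Definition acyclic (Q : pencil) := forall (M : nmod Lam) (g : 'I_(pm Q) -> S -> M),
  rhs g -> exists f, sol g f /\ forall f', sol g f' -> f' = f.

(** Generators minus relations. The relations are counted by their A-slots; for balanced [xi] the
    B-slots give the same sum. *)
Definition chi (D : zmodType) (xi : X -> D) (Q : pencil) : D :=
  \sum_i xi (plab Q i) - \sum_j \sum_(a <- hA (pz Q j)) xi (hlab a).

Lemma labelledB (M : nmod Lam) n (lb : 'I_n -> X) (f f' : 'I_n -> M) :
  labelled r lb f -> labelled r lb f' -> labelled r lb (fun i => f i - f' i).
Proof. by move=> lf lf' i; rewrite nactBr lf lf'. Qed.

Lemma labelledD (M : nmod Lam) n (lb : 'I_n -> X) (f f' : 'I_n -> M) :
  labelled r lb f -> labelled r lb f' -> labelled r lb (fun i => f i + f' i).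
Proof. by move=> lf lf' i; rewrite nactDr lf lf'. Qed.

Lemma labelled0 (M : nmod Lam) n (lb : 'I_n -> X) : labelled r lb (fun=> 0 : M).
Proof. by move=> i; rewrite nact0r. Qed.

Lemma delB (M : nmod Lam) Q (f f' : 'I_(pn Q) -> M) j s :
  del (fun i => f i - f' i) j s = del f j s - del f' j s.
Proof.
rewrite /del !evfB nactBr.
under eq_bigr do rewrite evfB nactBr.
by rewrite sumrB !opprD !opprK addrACA.
Qed.

Lemma delD (M : nmod Lam) Q (f f' : 'I_(pn Q) -> M) j s :
  del (fun i => f i + f' i) j s = del f j s + del f' j s.
Proof.
rewrite /del !evfD nactDr.
under eq_bigr do rewrite evfD nactDr.
by rewrite big_split opprD addrACA.
Qed.

Lemma del0 (M : nmod Lam) Q j s : del (fun _ : 'I_(pn Q) => 0 : M) j s = 0.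
Proof.
rewrite /del evf0 nact0r big1 ?subr0 // => b _.
by rewrite evf0 nact0r.
Qed.

Lemma solB (M : nmod Lam) Q (g g' : 'I_(pm Q) -> S -> M) f f' :
  sol g f -> sol g' f' -> sol (fun j s => g j s - g' j s) (fun i => f i - f' i).
Proof.
move=> [lf fg] [lf' fg']; split; first exact: labelledB.
by move=> j s sA; rewrite delB fg ?fg'.
Qed.

Lemma solD (M : nmod Lam) Q (g g' : 'I_(pm Q) -> S -> M) f f' :
  sol g f -> sol g' f' -> sol (fun j s => g j s + g' j s) (fun i => f i + f' i).
Proof.
move=> [lf fg] [lf' fg']; split; first exact: labelledD.
by move=> j s sA; rewrite delD fg ?fg'.
Qed.

Lemma sol0_diff (M : nmod Lam) Q (g : 'I_(pm Q) -> S -> M) f f' :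
  sol g f -> sol g f' -> sol0 (fun i => f i - f' i).
Proof. by move=> sf sf'; have := solB sf sf'; congr sol; do 2 apply/funext => ?; rewrite subrr. Qed.

Lemma sol_sub0 (M : nmod Lam) Q (g : 'I_(pm Q) -> S -> M) f f' :
  sol g f -> sol0 f' -> sol g (fun i => f i - f' i).
Proof. by move=> sf sf'; have := solB sf sf'; congr sol; do 2 apply/funext => ?; rewrite subr0. Qed.

Lemma sol_add0 (M : nmod Lam) Q (g : 'I_(pm Q) -> S -> M) f f' :
  sol g f -> sol0 f' -> sol g (fun i => f i + f' i).
Proof. by move=> sf sf'; have := solD sf sf'; congr sol; do 2 apply/funext => ?; rewrite addr0. Qed.

Lemma sol0_0 (M : nmod Lam) Q : sol0 (fun _ : 'I_(pn Q) => 0 : M).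
Proof. by split=> [|j s _]; [exact: labelled0|rewrite del0]. Qed.

Lemma del_comb (M : nmod Lam) Q (f : 'I_(pn Q) -> M) z w a :
  (forall j, w j != 0 -> pz Q j = z) ->
  \sum_j w j *: del f j a = rX (hlab a) $* ev f (fun i => \sum_j w j * pa Q j a i)
    - \sum_(b <- hB z) rps r z a b $* ev f (fun i => \sum_j w j * pb Q j b i).
Proof.
move=> wz; have wE j (F : Z -> M) : w j *: F (pz Q j) = w j *: F z.
  by have [->|/wz->//] := eqVneq (w j) 0; rewrite !scale0r.
have -> : \sum_j w j *: del f j a = \sum_j w j *: (rX (hlab a) $* ev f (pa Q j a)
    - \sum_(b <- hB z) rps r z a b $* ev f (pb Q j b)).
  apply: eq_bigr => j _.
  exact: (wE j (fun z => rX (hlab a) $* ev f (pa Q j a)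
    - \sum_(b <- hB z) rps r z a b $* ev f (pb Q j b))).
under eq_bigr do rewrite scalerBr.
rewrite sumrB; congr (_ - _).
  by rewrite ev_sum nact_sumr; apply: eq_bigr => j _; rewrite evZ nactZr.
under eq_bigr do rewrite scaler_sumr.
rewrite exchange_big; apply: eq_bigr => b _.
by rewrite ev_sum nact_sumr; apply: eq_bigr => j _; rewrite evZ nactZr.
Qed.

Definition qpencil (Q : pencil) n' (sec : 'I_n' -> 'I_(pn Q)) (T : 'I_(pn Q) -> 'I_n' -> K)
    m' (secW : 'I_m' -> 'I_(pm Q)) : pencil :=
  Pencil (plab Q \o sec) (pz Q \o secW)
    (fun j s => push T (pa Q (secW j) s)) (fun j s => push T (pb Q (secW j) s)).

Lemma del_qpencil (M : nmod Lam) (Q : pencil) n' (sec : 'I_n' -> 'I_(pn Q)) T m'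
    (secW : 'I_m' -> 'I_(pm Q)) (f : 'I_n' -> M) j s :
  @del M (qpencil sec T secW) f j s = del (pull T f) (secW j) s.
Proof.
by rewrite /del ev_pull; congr (_ - _); apply: eq_bigr => b _; rewrite ev_pull.
Qed.

(* Quotient by the image of the representation (w, (hlab a : a in A z)).      *)
Lemma pencil_reduce (Q : pencil) z w (j0 : 'I_(pm Q)) :
  (forall j, w j != 0 -> pz Q j = z) -> w j0 != 0 ->
  (forall b, b \in hB z ->
     msk (plab Q) (hlab b) (fun i => \sum_j w j * pb Q j b i) = fun=> 0) ->
  exists (Q' : pencil) (sec : 'I_(pn Q') -> 'I_(pn Q)) (T : 'I_(pn Q) -> 'I_(pn Q') -> K),
  [/\ pm Q = (pm Q').+1, plab Q' = plab Q \o sec,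
      forall (M : nmod Lam) (f : 'I_(pn Q) -> M), sol0 f -> f = pull T (f \o sec) /\ sol0 (f \o sec),
      forall (M : nmod Lam) (f' : 'I_(pn Q') -> M), sol0 f' -> sol0 (pull T f') /\ pull T f' \o sec = f' &
      forall M0, spacious r M0 -> acyclic Q ->
        acyclic Q' /\ forall (D : zmodType) (xi : X -> D), chi xi Q = chi xi Q'].
Proof.
case: Q w j0 => n lb [|m] zt al be /= w j0; first by case: j0.
set Q := Pencil lb zt al be; move=> wz w0 kerb.
pose y a i := \sum_j w j * al j a i.
have [n' [sec [T [kT sumT]]]] := @kill_exists K H Lam r S (hA z) (fun a => hlab a) n y lb.
pose secW (k : 'I_m) : 'I_m.+1 := fintype.lift j0 k.
pose Q' := @qpencil Q n' sec T m secW.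
have zt0 : zt j0 = z by apply: wz.
(* The B-components of [w] vanish, so the [w]-combination of the equations contains no [rps]: what
   remains is the K-linear relation with coefficients [y a]. *)
have comb (M : nmod Lam) (f : 'I_n -> M) a : labelled r lb f ->
    \sum_j w j *: @del M Q f j a = rX (hlab a) $* ev f (y a).
  move=> lf; rewrite (@del_comb M Q f z w a wz) /= [X in _ - X]big_seq big1 ?subr0 // => b bB.
  by rewrite (rps_ev _ _ _ _ lf) kerb // ev0 nact0r.
(* The value at [j0] is chosen such that the [w]-combination of the right-hand sides is 0, as the
   killed relations demand. *)
pose ext (M : nmod Lam) (g' : 'I_m -> S -> M) (j : 'I_m.+1) : S -> M :=
  if unlift j0 j is Some k then g' k
  else fun a => - ((w j0)^-1 *: \sum_k w (secW k) *: g' k a).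
have extS (M : nmod Lam) (g' : 'I_m -> S -> M) k : ext M g' (secW k) = g' k.
  by rewrite /ext /secW liftK.
have ext0 (M : nmod Lam) : ext M (fun _ _ => 0) = fun _ _ => 0.
  apply/funext => j; apply/funext => a; rewrite /ext; case: unliftP => //= _.
  by rewrite big1 ?scaler0 ?oppr0 // => k _; rewrite scaler0.
have ext_sum (M : nmod Lam) (g' : 'I_m -> S -> M) a : \sum_j w j *: ext M g' j a = 0.
  rewrite (bigD1_ord j0) //= {1}/ext unlift_none scalerN scalerA divff // scale1r.
  by rewrite addrC; under eq_bigr do rewrite -/(secW _) extS; rewrite subrr.
have G1 (M : nmod Lam) (g' : 'I_m -> S -> M) : @rhs M Q' g' -> @rhs M Q (ext M g').
  move=> okg j a /=; have [k ->|->] := unliftP j0 j.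
    by rewrite -/(secW k) extS; apply: okg.
  rewrite zt0 /ext unlift_none => aA; rewrite nactNr nactZr nact_sumr; congr (- (_ *: _)).
  apply: eq_bigr => k _; rewrite nactZr; have [->|wk] := eqVneq (w (secW k)) 0.
    by rewrite !scale0r.
  by rewrite okg //= wz.
have labT (M : nmod Lam) (f' : 'I_n' -> M) :
    labelled r (lb \o sec) f' -> labelled r lb (pull T f') by exact: pull_labelled kT _ _.
have G2 (M : nmod Lam) (g' : 'I_m -> S -> M) (f' : 'I_n' -> M) :
    @sol M Q' g' f' -> @sol M Q (ext M g') (pull T f').
  move=> [lf fg]; split; first exact: labT.
  have S1 k a : a \in hA (zt (secW k)) -> @del M Q (pull T f') (secW k) a = ext M g' (secW k) a.
    by move=> aA; rewrite -(@del_qpencil M Q n' sec T m secW) extS; apply: fg.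
  move=> j a /=; have [k ->|->] := unliftP j0 j; first exact: S1.
  rewrite zt0 => aA; apply: (scalerI w0); apply/eqP; rewrite -subr_eq0; apply/eqP.
  have : \sum_j (w j *: @del M Q (pull T f') j a - w j *: ext M g' j a) = 0.
    by rewrite sumrB ext_sum subr0 comb ?(pull_zero kT) //; apply: labT.
  rewrite (bigD1_ord j0) //= => e0; rewrite -[RHS]e0 -[LHS]addr0; congr (_ + _); apply/esym.
  rewrite big1 // => k _.
  have [->|wk] := eqVneq (w (fintype.lift j0 k)) 0; first by rewrite !scale0r subrr.
  by rewrite S1 ?subrr ?wz.
have G3 (M : nmod Lam) (g' : 'I_m -> S -> M) (f : 'I_n -> M) :
    @sol M Q (ext M g') f -> f = pull T (f \o sec) /\ @sol M Q' g' (f \o sec).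
  move=> [lf fg]; have fE : f = pull T (f \o sec).
    apply: (kill_all kT) => // a aA; rewrite -comb // -[RHS](ext_sum M g' a).
    apply: eq_bigr => j _; have [->|wj] := eqVneq (w j) 0; first by rewrite !scale0r.
    by rewrite fg //= wz.
  split=> //; split; first by move=> k; apply: lf.
  by move=> k a aA; rewrite (@del_qpencil M Q n' sec T m secW) -fE fg ?extS.
exists Q', sec, T; split=> //.
- by move=> M f f0; apply: G3; rewrite ext0.
- by move=> M f' f0; split; [rewrite /sol0 -ext0; apply: G2|rewrite (pull_sec kT)].
move=> M0 sp acQ; split.
  move=> M g' okg; have [f [sf fu]] := acQ M (ext M g') (G1 _ _ okg).
  have [fE sf'] := G3 _ _ _ sf; exists (f \o sec); split=> // f' /G2/fu <-.
  by rewrite (pull_sec kT).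
move=> D xi; rewrite /chi /= (sumT M0) ?hA_uniq //.
  rewrite [X in _ - X](bigD1_ord j0) //= zt0 opprD addrA; congr (_ - _).
  by rewrite addrK.
(* A right-hand side concentrated on [j0] prescribes the [w]-combinations at will, so acyclicity
   makes the killed relations independent. *)
move=> mu mul; pose g j a := if j == j0 then (w j0)^-1 *: mu a else 0.
have [|f [[lf fg] _]] := acQ M0 g.
  move=> j a /=; rewrite /g; case: eqP => [->|_ _]; last by rewrite nact0r.
  by rewrite zt0 => aA; rewrite nactZr mul.
exists f; split=> // a aA; rewrite -comb // (bigD1 j0) //= fg /= ?zt0 // /g eqxx.
rewrite scalerA divff // scale1r big1 ?addr0 // => j jj0.
have [->|wj] := eqVneq (w j) 0; first by rewrite scale0r.
by rewrite fg /= ?wz // /g (negbTE jj0) scaler0.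
Qed.

End PencilSolutions.

(** * Exchange of the two sides, and reduction to injective pencils *)

Section PencilReduction.
Variables (K : fieldType) (Lam : nuAlgType K).

Lemma big_pick (V : zmodType) (S : eqType) (s : seq S) b (F : S -> V) :
  uniq s -> b \in s -> \sum_(c <- s) (if b == c then F c else 0) = F b.
Proof.
move=> us bs; rewrite (bigD1_seq b) //= eqxx big1 ?addr0 // => c cb.
by rewrite eq_sym (negbTE cb).
Qed.

Definition balanced (H : hypergraph) (D : zmodType) (xi : hvtx H -> D) :=
  forall z : hyp H, \sum_(a <- hA z) xi (hlab a) = \sum_(b <- hB z) xi (hlab b).

(** Multiplication by the inverse matrix [rph] turns [alpha - psi beta = g] into
    [beta - phi alpha = - phi g], where [alpha] and [beta] are the components on the two sides. *)
Lemma sol_swap (H : hypergraph) (r : hrep H Lam) (M : nmod Lam) (Q : pencil K (hvtx H) (hslot H) (hyp H))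
    (g : 'I_(pm Q) -> hslot H -> M) (f : 'I_(pn Q) -> M) :
  sol r g f -> @sol K (hswap H) Lam (rswap r) M (pswap Q)
    (fun j b => - \sum_(a <- hA (pz Q j)) rph r (pz Q j) b a $* g j a) f.
Proof.
move=> [lf fg]; split=> // j b bB; rewrite /del /=; set z := pz Q j.
have aE a : a \in hA z -> rph r z b a $* ev f (pa Q j a) = rph r z b a $* g j a
    + \sum_(b' <- hB z) (rph r z b a ** rps r z a b') $* ev f (pb Q j b').
  move=> aA; rewrite -{1}(rphr r) nactM.
  have /eqP := fg j a aA; rewrite subr_eq => /eqP ->; rewrite nactDr nact_sumr.
  by congr (_ + _); apply: eq_bigr => b' _; rewrite nactM.
rewrite [X in _ - X]big_seq (eq_bigr _ aE) -big_seq big_split /= exchange_big /=.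
have E b' : b' \in hB z -> (\sum_(a <- hA z) rph r z b a ** rps r z a b') $* ev f (pb Q j b')
    = if b == b' then rX r (hlab b') $* ev f (pb Q j b') else 0.
  by move=> b'B; rewrite rphps //; case: eqP => [->//|_]; rewrite nact0l.
under [X in _ - (_ + X)]eq_bigr do rewrite -nact_suml.
rewrite [X in _ - (_ + X)](_ : _ = rX r (hlab b) $* ev f (pb Q j b)); last first.
  by rewrite big_seq (eq_bigr _ E) -big_seq big_pick ?hB_uniq.
by rewrite opprD addrC addrNK.
Qed.

Lemma sol_swapV (H : hypergraph) (r : hrep H Lam) (M : nmod Lam) (Q : pencil K (hvtx H) (hslot H) (hyp H))
    (g : 'I_(pm Q) -> hslot H -> M) (f : 'I_(pn Q) -> M) :
  @sol K (hswap H) Lam (rswap r) M (pswap Q) g f ->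
  sol r (fun j a => - \sum_(b <- hB (pz Q j)) rps r (pz Q j) a b $* g j b) f.
Proof.
move=> h; have := @sol_swap (hswap H) (rswap r) M (pswap Q) g f h.
(* The double swap is convertible to the original data only after the records are taken apart. *)
by clear h; case: H r Q g f => ? ? ? ? ? ? ? ? ? ? [] ? ? ? ? ? ? ? ? ? ? [].
Qed.

Lemma sol0_swap (H : hypergraph) (r : hrep H Lam) (M : nmod Lam) (Q : pencil K (hvtx H) (hslot H) (hyp H))
    (f : 'I_(pn Q) -> M) :
  @sol0 K H Lam r M Q f <-> @sol0 K (hswap H) Lam (rswap r) M (pswap Q) f.
Proof.
split=> [/sol_swap|/sol_swapV]; congr sol; apply/funext => j; apply/funext => b.
  by rewrite big1 ?oppr0 // => a _; rewrite nact0r.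
by rewrite big1 ?oppr0 // => a _; rewrite nact0r.
Qed.

Lemma chi_swap (H : hypergraph) (Q : pencil K (hvtx H) (hslot H) (hyp H)) (D : zmodType)
    (xi : hvtx H -> D) : balanced xi -> @chi K (hswap H) D xi (pswap Q) = chi xi Q.
Proof. by move=> bal; rewrite /chi /=; congr (_ - _); apply: eq_bigr => j _; rewrite bal. Qed.

Lemma sol_ext (H : hypergraph) (r : hrep H Lam) (M : nmod Lam) (Q : pencil K (hvtx H) (hslot H) (hyp H))
    (g g' : 'I_(pm Q) -> hslot H -> M) (f : 'I_(pn Q) -> M) :
  (forall j a, a \in hA (pz Q j) -> g j a = g' j a) -> sol r g f -> sol r g' f.
Proof. by move=> gg' [lf fg]; split=> // j a aA; rewrite fg ?gg'. Qed.

(** The side condition [C] lets one swapping lemma serve both acyclic pencils, where it is trivial,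
    and [free_over], where it prescribes some of the variables. *)
Definition uniquely_solvable (H : hypergraph) (r : hrep H Lam) (M : nmod Lam)
    (Q : pencil K (hvtx H) (hslot H) (hyp H)) (C : ('I_(pn Q) -> M) -> Prop) :=
  forall g, rhs r g -> exists f, [/\ sol r g f, C f & forall f', sol r g f' -> C f' -> f' = f].

Lemma uniquely_solvable_swap (H : hypergraph) (r : hrep H Lam) (M : nmod Lam)
    (Q : pencil K (hvtx H) (hslot H) (hyp H)) (C : ('I_(pn Q) -> M) -> Prop) :
  uniquely_solvable r C -> @uniquely_solvable (hswap H) (rswap r) M (pswap Q) C.
Proof.
move=> us g /= okg.
pose gA j a := - \sum_(b <- hB (pz Q j)) rps r (pz Q j) a b $* g j b.
have [|f [sf Cf fu]] := us gA.
  move=> j a aA; rewrite /gA nactNr nact_sumr; congr (- _); apply: eq_bigr => b _.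
  by rewrite -nactM rpsl.
exists f; split=> //; last by move=> f' /sol_swapV; apply: fu.
apply: sol_ext (sol_swap sf) => j b /= bB; rewrite -sumrN.
set z := pz Q j; under eq_bigr => a _ do rewrite /gA nactNr opprK nact_sumr.
rewrite exchange_big /=.
under eq_bigr => b' _ do (under eq_bigr => a _ do rewrite -nactM); rewrite big_seq.
have E b' : b' \in hB z -> \sum_(a <- hA z) (rph r z b a ** rps r z a b') $* g j b'
    = if b == b' then rX r (hlab b') $* g j b' else 0.
  by move=> b'B; rewrite -nact_suml rphps //; case: eqP => [->//|_]; rewrite nact0l.
rewrite (eq_bigr _ E) -big_seq big_pick ?hB_uniq //; exact: okg.
Qed.

Lemma uniquely_solvable_unswap (H : hypergraph) (r : hrep H Lam) (M : nmod Lam)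
    (Q : pencil K (hvtx H) (hslot H) (hyp H)) (C : ('I_(pn Q) -> M) -> Prop) :
  @uniquely_solvable (hswap H) (rswap r) M Q C -> @uniquely_solvable H r M (pswap Q) C.
Proof.
move/uniquely_solvable_swap.
by case: H r Q C => ? ? ? ? ? ? ? ? ? ? [] ? ? ? ? ? ? ? ? ? ? [].
Qed.

Lemma acyclic_swap (H : hypergraph) (r : hrep H Lam) (Q : pencil K (hvtx H) (hslot H) (hyp H)) :
  acyclic r Q -> @acyclic K (hswap H) Lam (rswap r) (pswap Q).
Proof.
move=> acQ M g gP; have us : uniquely_solvable r (fun _ : 'I_(pn Q) -> M => True).
  by move=> g' /acQ[f [sf fu]]; exists f; split=> // f' /fu.
have [f [sf _ fu]] := uniquely_solvable_swap us gP.
by exists f; split=> // f' /fu; apply.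
Qed.

Lemma sol0_unswap (H : hypergraph) (r : hrep H Lam) (M : nmod Lam)
    (Q : pencil K (hvtx H) (hslot H) (hyp H)) (f : 'I_(pn Q) -> M) :
  @sol0 K (hswap H) Lam (rswap r) M Q f <-> @sol0 K H Lam r M (pswap Q) f.
Proof. by case: Q f => n lb m zt al be f; rewrite (@sol0_swap H r M (Pencil lb zt be al)). Qed.

Lemma acyclic_unswap (H : hypergraph) (r : hrep H Lam) (Q : pencil K (hvtx H) (hslot H) (hyp H)) :
  @acyclic K (hswap H) Lam (rswap r) Q -> acyclic r (pswap Q).
Proof.
move/(@acyclic_swap (hswap H) (rswap r)).
by case: H r Q => ? ? ? ? ? ? ? ? ? ? [] ? ? ? ? ? ? ? ? ? ? [].
Qed.

Lemma chi_unswap (H : hypergraph) (Q : pencil K (hvtx H) (hslot H) (hyp H)) (D : zmodType)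
    (xi : hvtx H -> D) : balanced xi -> @chi K (hswap H) D xi Q = chi xi (pswap Q).
Proof. by move=> bal; rewrite /chi /=; congr (_ - _); apply: eq_bigr => j _; rewrite bal. Qed.

Section Reduces.
Variables (H : hypergraph) (r : hrep H Lam).
Local Notation X := (hvtx H).
Local Notation pencil := (pencil K X (hslot H) (hyp H)).

(** The homogeneous solutions correspond in every module, so both pencils present the same module.
    The Euler characteristic is compared for acyclic [Q] only, since acyclicity provides the
    independence required by the count in [kill_exists]. *)
Definition reduces (Q Q' : pencil) :=
  exists (sec : 'I_(pn Q') -> 'I_(pn Q)) (T : 'I_(pn Q) -> 'I_(pn Q') -> K),
  [/\ plab Q' = plab Q \o sec,
      forall (M : nmod Lam) (f : 'I_(pn Q) -> M), sol0 r f -> f = pull T (f \o sec) /\ sol0 r (f \o sec),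
      forall (M : nmod Lam) (f' : 'I_(pn Q') -> M), sol0 r f' -> sol0 r (pull T f') /\ pull T f' \o sec = f' &
      forall M0, spacious r M0 -> acyclic r Q ->
        acyclic r Q' /\ forall (D : zmodType) (xi : X -> D), balanced xi -> chi xi Q = chi xi Q'].

Lemma reduces_refl Q : reduces Q Q.
Proof.
have pullE (M : nmod Lam) (f : 'I_(pn Q) -> M) : pull (fun i k => (i == k)%:R) f = f.
  by apply/funext => i; rewrite /pull ev_delta.
by exists id, (fun i k => (i == k)%:R); split=> //; move=> M f; rewrite pullE.
Qed.

Lemma reduces_trans Q Q' Q'' : reduces Q Q' -> reduces Q' Q'' -> reduces Q Q''.
Proof.
move=> [s [T [lE fw bw ac]]] [s' [T' [lE' fw' bw' ac']]].
pose T2 i k := \sum_l T i l * T' l k.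
have pullE (M : nmod Lam) (f : 'I_(pn Q'') -> M) : pull T2 f = pull T (pull T' f).
  by apply/funext => i; rewrite [RHS]ev_pull.
exists (s \o s'), T2; split.
- by rewrite lE' lE.
- move=> M f f0; have [fE f1] := fw _ _ f0; have [fE1 f2] := fw' _ _ f1.
  by split; [rewrite pullE {1}fE {1}fE1|exact: f2].
- move=> M f f0; rewrite pullE; have [f1 fE] := bw' _ _ f0; have [f2 fE1] := bw _ _ f1.
  by split=> //; rewrite -[LHS]/((pull T (pull T' f) \o s) \o s') fE1.
- move=> M0 sp aQ; have [aQ' cQ] := ac _ sp aQ; have [aQ'' cQ'] := ac' _ sp aQ'.
  by split=> // D xi bal; rewrite cQ ?cQ'.
Qed.

(** Injectivity, for each [z], of the coefficient map from the equations labelled [z] to the sum of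
    the components over the slots in [hA z]. *)
Definition Ainj (Q : pencil) := forall z w, (forall j, w j != 0 -> pz Q j = z) ->
  (forall a, a \in hA z ->
     msk (plab Q) (hlab a) (fun i => \sum_j w j * pa Q j a i) = fun=> 0) -> forall j, w j = 0.

Definition Binj (Q : pencil) := forall z w, (forall j, w j != 0 -> pz Q j = z) ->
  (forall b, b \in hB z ->
     msk (plab Q) (hlab b) (fun i => \sum_j w j * pb Q j b i) = fun=> 0) -> forall j, w j = 0.

Lemma reduceB Q z w j0 : (forall j, w j != 0 -> pz Q j = z) -> w j0 != 0 ->
  (forall b, b \in hB z ->
     msk (plab Q) (hlab b) (fun i => \sum_j w j * pb Q j b i) = fun=> 0) ->
  exists2 Q', pm Q = (pm Q').+1 & reduces Q Q'.
Proof.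
move=> wz w0 kw; have [Q' [s [T [pmE lE fw bw ac]]]] := pencil_reduce r wz w0 kw.
exists Q' => //; exists s, T; split=> // M0 sp aQ.
by have [? cQ] := ac _ sp aQ.
Qed.

End Reduces.

Lemma reduceA (H : hypergraph) (r : hrep H Lam) (Q : pencil K (hvtx H) (hslot H) (hyp H)) z w j0 :
  (forall j, w j != 0 -> pz Q j = z) -> w j0 != 0 ->
  (forall a, a \in hA z ->
     msk (plab Q) (hlab a) (fun i => \sum_j w j * pa Q j a i) = fun=> 0) ->
  exists2 Q', pm Q = (pm Q').+1 & reduces r Q Q'.
Proof.
move=> wz w0 kw.
have [Q' pmE [s [T [lE fw bw ac]]]] := @reduceB (hswap H) (rswap r) (pswap Q) z w j0 wz w0 kw.
exists (pswap Q') => //; exists s, T; split=> //.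
- by move=> M f /sol0_swap/fw [fE /sol0_unswap f1].
- by move=> M f' /sol0_unswap/bw [/sol0_swap].
- move=> M0 sp /acyclic_swap aQ; have [aQ' cQ] := ac _ sp aQ; split.
    exact: acyclic_unswap.
  by move=> D xi bal; rewrite -(chi_swap _ bal) cQ ?chi_unswap //; move=> z'; rewrite bal.
Qed.

(** A nonzero vector in the kernel of a coefficient map allows one equation to be dropped; the
    number of equations bounds how often this can happen. *)
Lemma reduces_inj (H : hypergraph) (r : hrep H Lam) (Q : pencil K (hvtx H) (hslot H) (hyp H)) :
  exists Q', [/\ Ainj Q', Binj Q' & reduces r Q Q'].
Proof.
have [m] := ubnP (pm Q); elim: m Q => // m IH Q; rewrite ltnS => mQ.
have step Q1 : pm Q = (pm Q1).+1 -> reduces r Q Q1 ->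
    exists Q', [/\ Ainj Q', Binj Q' & reduces r Q Q'].
  move=> pmE red; have [|Q' [? ? red']] := IH Q1; first by rewrite -pmE.
  by exists Q'; split=> //; apply: reduces_trans red red'.
have [AQ|/existsNP[z /existsNP[w /not_implyP[wz /not_implyP[kw /existsNP[j0 /eqP w0]]]]]] :=
    pselect (Ainj Q); last first.
  by have [Q1] := reduceA r wz w0 kw; apply: step.
have [BQ|/existsNP[z /existsNP[w /not_implyP[wz /not_implyP[kw /existsNP[j0 /eqP w0]]]]]] :=
    pselect (Binj Q); last first.
  by have [Q1] := reduceB r wz w0 kw; apply: step.
by exists Q; split=> //; apply: reduces_refl.
Qed.

End PencilReduction.

(** * Solving systems in larger modules *)

Section ExtensionOfPartialIsos.
Variables (K : fieldType) (T : Type) (m : nat).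
Local Notation V := (T -> K).
Local Notation "a *.: h" := (fun t => a * h t) (at level 40).
Local Open Scope classical_set_scope.

Definition indep_on (P : pred 'I_m) (al : 'I_m -> V) :=
  forall w : 'I_m -> K, (forall j, w j != 0 -> P j) ->
    (forall t, \sum_j w j * al j t = 0) -> forall j, w j = 0.

(* Gaussian elimination: u reads off coordinates on the al j from the pivots. *)
Record pivoting (P : pred 'I_m) (al : 'I_m -> V) (D : set T) (u : V -> 'I_m -> K) : Prop := Pivoting {
  piv_fin : finite_set D;
  pivD : forall h h' j, u (h + h' : V) j = u h j + u h' j;
  pivZ : forall a h j, u (a *.: h) j = a * u h j;
  piv_supp : forall h j, ~~ P j -> u h j = 0;
  piv_dual : forall i j, P i -> u (al i) j = (j == i)%:R;
  piv0 : forall h, (forall t, D t -> h t = 0) -> forall j, u h j = 0;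
  piv_res : forall h t, D t -> h t = \sum_j u h j * al j t
}.

Lemma pivoting_exists P al : indep_on P al -> exists D u, pivoting P al D u.
Proof.
have [k] := ubnP #|P|; elim: k P => // k IH P; rewrite ltnS => cP ind.
case: (pickP P) => [j0 Pj0|P0]; last first.
  exists set0, (fun _ _ => 0); split=> //.
  - by move=> *; rewrite addr0.
  - by move=> *; rewrite mulr0.
  - by move=> i j; rewrite P0.
pose P' := [pred j | (j != j0) && P j].
have [||D [u [fD uD uZ us ud u0 ur]]] := IH P'.
- by apply: leq_trans cP; rewrite (cardD1 j0 P) [j0 \in P]Pj0 add1n ltnS; apply: eq_leq;
    apply: eq_card => j; rewrite !inE.
- move=> w wP; apply: ind => j /wP /andP[]//.
have ud0 j : P' j -> u (al j) j0 = 0.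
  by move=> Pj; rewrite us // inE /= eqxx.
pose res (h : V) : V := fun t => h t - \sum_j u h j * al j t.
(* By independence the residue of [al j0] modulo the earlier vectors is not the zero function; a
   point where it is nonzero becomes the new pivot. *)
have [t0 ht0] : exists t, res (al j0) t != 0.
  apply: contrapT => /forallNP h0.
  suff /(_ j0) : forall j, (j == j0)%:R - u (al j0) j = 0.
    by rewrite eqxx us ?inE ?eqxx // subr0; apply/eqP/oner_neq0.
  apply: ind.
    move=> j; have [->//|jj] := eqVneq j j0; rewrite sub0r oppr_eq0 => uj.
    by apply: contraNT uj => nP; rewrite us // inE /= negb_and nP orbT.
  move=> t; have /negP := h0 t; rewrite negbK => /eqP e; rewrite -[RHS]e /res.
  under eq_bigr do rewrite mulrBl; rewrite sumrB; congr (_ - _).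
  rewrite (bigD1 j0) //= eqxx mul1r big1 ?addr0 // => j /negbTE ->; by rewrite mul0r.
pose c (h : V) := res h t0 / res (al j0) t0.
pose u' (h : V) j := u h j + c h * ((j == j0)%:R - u (al j0) j).
have resD h h' t : res (h + h' : V) t = res h t + res h' t.
  rewrite /res; under eq_bigr do rewrite uD mulrDl.
  by rewrite big_split opprD addrACA.
have resZ a h t : res (a *.: h) t = a * res h t.
  rewrite /res; under eq_bigr do rewrite uZ -mulrA.
  by rewrite -mulr_sumr -mulrBr.
have res' h t : h t - \sum_j u' h j * al j t = res h t - c h * res (al j0) t.
  have e0 : \sum_j (j == j0)%:R * al j t = al j0 t.
    by rewrite (bigD1 j0) //= eqxx mul1r big1 ?addr0 // => j /negbTE ->; rewrite mul0r.
  rewrite /u' /res -e0 -sumrB mulr_sumr -addrA -opprD -big_split /=.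
  congr (_ - _); apply: eq_bigr => j _; by rewrite mulrDl -mulrBl mulrA.
exists (D `|` [set t0]), u'; split.
- by rewrite finite_setU; split.
- by move=> h h' j; rewrite /u' /c uD resD !mulrDl addrACA.
- by move=> a h j; rewrite /u' /c uZ resZ [RHS]mulrDr !mulrA.
- move=> h j nP; rewrite /u' !us ?inE /= ?(negbTE nP) ?andbF // add0r subr0.
  by case: eqP nP => [->|_]; rewrite ?Pj0 // mulr0.
- move=> i j Pi; rewrite /u' /c; have [->|ij] := eqVneq i j0.
    by rewrite divff // mul1r addrC subrK.
  have Pi' : P' i by rewrite inE /= ij.
  have -> : res (al i) t0 = 0.
    rewrite /res (bigD1 i) //= ud // eqxx mul1r big1 ?addr0 ?subrr // => j' jj.
    by rewrite ud // (negbTE jj) mul0r.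
  by rewrite !mul0r addr0 ud.
- move=> h h0 j; have uh i : u h i = 0 by apply: u0 => t Dt; apply: h0; left.
  rewrite /u' uh /c /res big1 => [|i _]; last by rewrite uh mul0r.
  by rewrite h0 ?subrr ?mul0r ?addr0 //; right.
- move=> h t Dt; apply/eqP; rewrite -subr_eq0 res'; apply/eqP.
  case: Dt => [Dt|->]; last by rewrite /c divfK // subrr.
  by rewrite /res -!ur // !subrr mulr0 subrr.
Qed.

Section Transport.
Variables (P : pred 'I_m) (A B : set T) (al be : 'I_m -> V) (DA DB : set T) (uA uB : V -> 'I_m -> K).
Variables (c c' : T -> T).
Hypothesis pA : pivoting P al DA uA.
Hypothesis pB : pivoting P be DB uB.
Hypothesis beB : forall j t, P j -> ~ B t -> be j t = 0.
Hypothesis c'P : forall t, (B `\` DB) t -> (A `\` DA) (c' t) /\ c (c' t) = t.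

(** Each side is the span of the given vectors plus the functions that vanish on the pivots. The
    spans are matched by sending [be j] to [al j], the complements by reindexing along the bijection
    [c] of the coordinates that are not pivots. *)
Definition transport : V -> V := fun h t =>
  \sum_j uB h j * al j t
  + (if `[< (A `\` DA) t >] then h (c t) - \sum_j uB h j * be j (c t) else 0).

Definition transportV : V -> V := fun h t =>
  \sum_j uA h j * be j t
  + (if `[< (B `\` DB) t >] then h (c' t) - \sum_j uA h j * al j (c' t) else 0).

Lemma uA_comb w : (forall j, ~~ P j -> w j = 0) -> uA (fun t => \sum_j w j * al j t) = w.
Proof.
move=> wP; apply/funext => i.
have E (r : seq 'I_m) : uA (fun t => \sum_(j <- r) w j * al j t) i = \sum_(j <- r) w j * uA (al j) i.
  elim: r => [|j r IH].
    by rewrite big_nil (piv0 pA) // => t _; rewrite big_nil.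
  rewrite big_cons -IH -(pivZ pA) -(pivD pA); congr uA.
  by apply/funext => t; rewrite big_cons.
rewrite E (bigD1 i) //= big1 => [|j ji].
  rewrite addr0; have [Pi|nPi] := boolP (P i); last by rewrite wP // mul0r.
  by rewrite (piv_dual pA) // eqxx mulr1.
have [Pi|nPi] := boolP (P j); last by rewrite wP // mul0r.
by rewrite (piv_dual pA) // eq_sym (negbTE ji) mulr0.
Qed.

Lemma uA_transport h : uA (transport h) = uB h.
Proof.
rewrite -[RHS]uA_comb; last by move=> j; apply: (piv_supp pB).
apply/funext => j; rewrite -[transport h]/((fun t => \sum_j uB h j * al j t) +
  (fun t => if `[< (A `\` DA) t >] then h (c t) - \sum_j uB h j * be j (c t) else 0) : V).
rewrite (pivD pA) [X in _ + X](piv0 pA) ?addr0 // => t Dt.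
by case: asboolP => // -[].
Qed.

Lemma transportK h : (forall t, ~ B t -> h t = 0) -> transportV (transport h) = h.
Proof.
move=> hB; apply/funext => t; rewrite /transportV uA_transport.
case: asboolP => [Bt|nBt].
  have [Ac cc] := c'P Bt; rewrite {1}/transport; case: asboolP => // _.
  by rewrite cc addrAC subrr add0r addrC subrK.
rewrite addr0; have [Dt|nDt] := pselect (DB t); first by rewrite -(piv_res pB).
have nB : ~ B t by move=> Bt; apply: nBt.
rewrite hB // big1 // => j _; have [Pj|nPj] := boolP (P j); last by rewrite (piv_supp pB) ?mul0r.
by rewrite beB // mulr0.
Qed.

Lemma transport_dual j : P j -> transport (be j) = al j.
Proof.
move=> Pj; have E (F : 'I_m -> K) : \sum_i uB (be j) i * F i = F j.
  rewrite (bigD1 j) //= big1 => [|i ij]; first by rewrite (piv_dual pB) // eqxx mul1r addr0.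
  by rewrite (piv_dual pB) // (negbTE ij) mul0r.
by apply/funext => t; rewrite /transport !E subrr; case: ifP => _; rewrite addr0.
Qed.

Lemma transportD h h' : transport (h + h' : V) = transport h + transport h'.
Proof.
have E (F : 'I_m -> K) : \sum_j uB (h + h' : V) j * F j = \sum_j uB h j * F j + \sum_j uB h' j * F j.
  by rewrite -big_split; apply: eq_bigr => j _; rewrite (pivD pB) mulrDl.
apply/funext => t; rewrite [RHS]addrACA /transport !E; congr (_ + _).
by case: ifP; rewrite ?addr0 // opprD addrACA.
Qed.

Lemma transportZ a h : transport (a *.: h) = a *.: transport h.
Proof.
have E (F : 'I_m -> K) : \sum_j uB (a *.: h) j * F j = a * \sum_j uB h j * F j.
  by rewrite mulr_sumr; apply: eq_bigr => j _; rewrite (pivZ pB) mulrA.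
apply/funext => t; rewrite {2}/transport mulrDr /transport !E; congr (_ + _).
by case: ifP; rewrite ?mulr0 // mulrBr.
Qed.

Lemma transport_out h t : (forall j t, P j -> ~ A t -> al j t = 0) -> ~ A t -> transport h t = 0.
Proof.
move=> alA At; rewrite /transport; case: asboolP => [[]//|_]; rewrite addr0 big1 // => j _.
have [Pj|nPj] := boolP (P j); first by rewrite alA // mulr0.
by rewrite (piv_supp pB) // mul0r.
Qed.

End Transport.

Lemma countably_infinite_bij (A B : set T) : countable A -> infinite_set A -> countable B -> infinite_set B ->
  exists c c' : T -> T, (forall t, A t -> B (c t) /\ c' (c t) = t) /\ (forall t, B t -> A (c' t) /\ c (c' t) = t).
Proof.
have nat_eq (C : set T) : countable C -> infinite_set C -> (C #= [set: nat])%card.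
  by move=> cC /infiniteP iC; rewrite card_eq_le; apply/andP; split.
move=> cA iA cB iB; have /card_bijP [f [g fg gf]] : (A #= B)%card.
  by rewrite (card_eq_trans (nat_eq A cA iA)) // card_eq_sym nat_eq.
pose c t := if pselect (A t) is left At then set_val (f (SigSub (mem_set At))) else t.
pose c' t := if pselect (B t) is left Bt then set_val (g (SigSub (mem_set Bt))) else t.
exists c, c'; split=> t Ct.
  rewrite /c; case: pselect => // At; have Bf := set_mem (valP (f (SigSub (mem_set At)))).
  split=> //; rewrite /c'; case: pselect => // Bt.
  have -> : SigSub (mem_set Bt) = f (SigSub (mem_set At)) by apply: val_inj.
  by rewrite fg.
rewrite /c'; case: pselect => // At; have Bf := set_mem (valP (g (SigSub (mem_set At)))).
split=> //; rewrite /c; case: pselect => // Bt.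
have -> : SigSub (mem_set Bt) = g (SigSub (mem_set At)) by apply: val_inj.
by rewrite gf.
Qed.

Record partial_iso_ext (P : pred 'I_m) (A B : set T) (al be : 'I_m -> V)
    (th th' : V -> V) (u : V -> 'I_m -> K) : Prop := PartialIsoExt {
  thD : forall h h', th (h + h' : V) = th h + th h';
  thZ : forall a h, th (a *.: h) = a *.: th h;
  th'D : forall h h', th' (h + h' : V) = th' h + th' h';
  th'Z : forall a h, th' (a *.: h) = a *.: th' h;
  uD : forall h h' j, u (h + h' : V) j = u h j + u h' j;
  uZ : forall a h j, u (a *.: h) j = a * u h j;
  u_supp : forall h j, ~~ P j -> u h j = 0;
  u_be : forall i j, P i -> u (be i) j = (j == i)%:R;
  th_be : forall j, P j -> th (be j) = al j;
  th_out : forall h t, ~ A t -> th h t = 0;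
  th'_out : forall h t, ~ B t -> th' h t = 0;
  thK : forall h, (forall t, ~ B t -> h t = 0) -> th' (th h) = h;
  th'K : forall h, (forall t, ~ A t -> h t = 0) -> th (th' h) = h
}.

(** Only finitely many coordinates are pivots. The remaining ones are countably infinite on both
    sides, hence in bijection, even if the numbers of pivots differ. *)
Lemma extend_partial_iso (P : pred 'I_m) (A B : set T) (al be : 'I_m -> V) :
  countable A -> infinite_set A -> countable B -> infinite_set B ->
  (forall j t, P j -> ~ A t -> al j t = 0) -> (forall j t, P j -> ~ B t -> be j t = 0) ->
  indep_on P al -> indep_on P be ->
  exists th th' u, partial_iso_ext P A B al be th th' u.
Proof.
move=> cA iA cB iB alA beB /pivoting_exists[DA [uA pA]] /pivoting_exists[DB [uB pB]].
have [||||c [c' [cP c'P]]] := @countably_infinite_bij (A `\` DA) (B `\` DB).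
- by apply: sub_countable cA; apply: subset_card_le => t [].
- exact: infinite_setD (piv_fin pA).
- by apply: sub_countable cB; apply: subset_card_le => t [].
- exact: infinite_setD (piv_fin pB).
exists (transport A al be DA uB c), (transport B be al DB uA c'), uB; split.
- exact: transportD pB.
- exact: transportZ pB.
- exact: transportD pA.
- exact: transportZ pA.
- exact: pivD pB.
- exact: pivZ pB.
- exact: piv_supp pB.
- exact: piv_dual pB.
- exact: transport_dual pB.
- by move=> h t; apply: transport_out pB _ _ alA.
- by move=> h t; apply: transport_out pA _ _ beB.
- by move=> h; apply: transportK pA pB beB c'P _.
- by move=> h; apply: transportK pB pA alA cP _.
Qed.

End ExtensionOfPartialIsos.

(** * The algebra of generic invertible matrices *)

Section HypergraphAlgebra.
Variables (K : fieldType) (H : hypergraph).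
Local Notation X := (hvtx H).
Local Notation S := (hslot H).
Local Notation Z := (hyp H).

Inductive hgen := HVtx of X | HPhi of Z & S & S | HPsi of Z & S & S.

Local Notation term := (nuterm K hgen).
Local Notation gen := (@NUGen K hgen).

(** The letters are indexed by all pairs of slots; [hrel_ph0] and [hrel_ps0] discard those with a
    slot that does not belong to [z]. *)
Inductive hrel : term -> term -> Prop :=
| hrel_vtx x y : hrel (NUMul (gen (HVtx x)) (gen (HVtx y))) (if x == y then gen (HVtx x) else NUZero)
| hrel_phl z b a : hrel (NUMul (gen (HVtx (hlab b))) (gen (HPhi z b a))) (gen (HPhi z b a))
| hrel_phr z b a : hrel (NUMul (gen (HPhi z b a)) (gen (HVtx (hlab a)))) (gen (HPhi z b a))
| hrel_psl z a b : hrel (NUMul (gen (HVtx (hlab a))) (gen (HPsi z a b))) (gen (HPsi z a b))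
| hrel_psr z a b : hrel (NUMul (gen (HPsi z a b)) (gen (HVtx (hlab b)))) (gen (HPsi z a b))
| hrel_ph0 z b a : ~~ ((b \in hB z) && (a \in hA z)) -> hrel (gen (HPhi z b a)) NUZero
| hrel_ps0 z a b : ~~ ((a \in hA z) && (b \in hB z)) -> hrel (gen (HPsi z a b)) NUZero
| hrel_phps z b b' : b \in hB z -> b' \in hB z ->
    hrel (NUSum [seq NUMul (gen (HPhi z b a)) (gen (HPsi z a b')) | a <- hA z])
      (if b == b' then gen (HVtx (hlab b)) else NUZero)
| hrel_psph z a a' : a \in hA z -> a' \in hA z ->
    hrel (NUSum [seq NUMul (gen (HPsi z a b)) (gen (HPhi z b a')) | b <- hB z])
      (if a == a' then gen (HVtx (hlab a)) else NUZero).

Definition hyper_alg : nuAlgType K := presented_alg hrel.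
Local Notation cls := (pres_class hrel).

Lemma cls_rel s t : hrel s t -> cls s = cls t.
Proof. by move=> st; apply/pres_classP/nucong_rel. Qed.

Lemma cls_if (c : bool) t : cls (if c then t else NUZero) = if c then cls t else 0.
Proof. by case: c; rewrite // pres_class0. Qed.

Definition hyper_rep : hrep H hyper_alg.
Proof.
refine (@HRep K H hyper_alg (fun x => cls (gen (HVtx x)))
  (fun z b a => cls (gen (HPhi z b a))) (fun z a b => cls (gen (HPsi z a b))) _ _ _ _ _ _ _).
- by move=> x y; rewrite -pres_classM (cls_rel (hrel_vtx x y)) cls_if.
- by move=> *; rewrite -pres_classM; apply/cls_rel/hrel_phl.
- by move=> *; rewrite -pres_classM; apply/cls_rel/hrel_phr.
- by move=> *; rewrite -pres_classM; apply/cls_rel/hrel_psl.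
- by move=> *; rewrite -pres_classM; apply/cls_rel/hrel_psr.
- move=> z b b' bB b'B; rewrite -cls_if -(cls_rel (hrel_phps bB b'B)) pres_classS big_map.
  by apply: eq_bigr => a _; rewrite pres_classM.
- move=> z a a' aA a'A; rewrite -cls_if -(cls_rel (hrel_psph aA a'A)) pres_classS big_map.
  by apply: eq_bigr => b _; rewrite pres_classM.
Defined.

Lemma cls_vtx x : cls (gen (HVtx x)) = rX hyper_rep x. Proof. by []. Qed.

Lemma cls_phi z b a : cls (gen (HPhi z b a)) = rph hyper_rep z b a. Proof. by []. Qed.

Lemma cls_psi z a b : cls (gen (HPsi z a b)) = rps hyper_rep z a b. Proof. by []. Qed.

Definition clsE := (cls_vtx, cls_phi, cls_psi).

Lemma rph_out z b a : ~~ ((b \in hB z) && (a \in hA z)) -> rph hyper_rep z b a = 0.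
Proof. by move=> h; rewrite /= (cls_rel (hrel_ph0 h)). Qed.

Lemma rps_out z a b : ~~ ((a \in hA z) && (b \in hB z)) -> rps hyper_rep z a b = 0.
Proof. by move=> h; rewrite /= (cls_rel (hrel_ps0 h)). Qed.

End HypergraphAlgebra.

Lemma sumfE (A : nmodType) (U I : Type) (s : seq I) (F : I -> U -> A) u :
  (\sum_(i <- s) F i) u = \sum_(i <- s) F i u.
Proof. by rewrite fct_sumE. Qed.

(** * An extension of a module in which a given pencil is solved *)

Section TwistedExtension.
Variables (K : fieldType) (H : hypergraph).
Local Notation X := (hvtx H).
Local Notation S := (hslot H).
Local Notation Z := (hyp H).
Local Notation Lam := (hyper_alg K H).
Local Notation r := (hyper_rep K H).
Variables (Q : pencil K X S Z) (M : nmod Lam) (g : 'I_(pm Q) -> S -> M).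
Local Notation W := (S * nat -> K).
Local Notation P := (X -> nat -> K^o).

Definition slots (s : seq S) : set (S * nat) := [set t | t.1 \in s]%classic.

Variables (th th' : Z -> W -> W) (u : Z -> W -> 'I_(pm Q) -> K).

Definition ins (s : S) (p : nat -> K) : W := fun t => if t.1 == s then p t.2 else 0.
Definition at_vtx (x : X) (p : nat -> K) : P := fun y k => if y == x then p k else 0.

Definition comb (v : 'I_(pm Q) -> K) a : M := \sum_j v j *: g j a.

Definition opP (x : hgen H) (p : P) : P :=
  match x with
  | HVtx x => at_vtx x (p x)
  | HPhi z b a => if (b \in hB z) && (a \in hA z) then
      at_vtx (hlab b) (fun k => th' z (ins a (p (hlab a))) (b, k)) else 0
  | HPsi z a b => if (a \in hA z) && (b \in hB z) then
      at_vtx (hlab a) (fun k => th z (ins b (p (hlab b))) (a, k)) else 0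
  end.

(* M * P is an extension of P by M.  On P the letters Psi z and Phi z act by  *)
(* the mutually inverse th z and th' z, which match the two sides of each     *)
(* equation of Q; the cocycle corr moves the defect of the equation into M,   *)
(* where it is prescribed to be g.                                            *)
Definition corr (x : hgen H) (p : P) : M :=
  match x with
  | HVtx x => 0
  | HPhi z b a => if (b \in hB z) && (a \in hA z) then
      \sum_(a' <- hA z) rph r z b a' $* comb (u z (th' z (ins a (p (hlab a))))) a' else 0
  | HPsi z a b => if (a \in hA z) && (b \in hB z) then - comb (u z (ins b (p (hlab b)))) a else 0
  end.

Definition opN (x : hgen H) (n : M * P) : M * P :=
  (pres_class _ (NUGen K x) $* n.1 + corr x n.2, opP x n.2).

(** The variable [i] is realized as the basis vector number [i] at the vertex [plab Q i], so that
    distinct variables occupy distinct coordinates. The vectors of the equation [j] on the two sides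
    are then [al_hat j] and [be_hat j]. *)
Definition al_hat j : W := fun t =>
  if t.1 \in hA (pz Q j) then \sum_i pa Q j t.1 i * ((hlab t.1 == plab Q i) && (t.2 == i))%:R else 0.
Definition be_hat j : W := fun t =>
  if t.1 \in hB (pz Q j) then \sum_i pb Q j t.1 i * ((hlab t.1 == plab Q i) && (t.2 == i))%:R else 0.

Hypothesis gP : rhs r g.
Hypothesis thP : forall z, partial_iso_ext (fun j => pz Q j == z)
  (slots (hA z)) (slots (hB z)) al_hat be_hat (th z) (th' z) (u z).

Lemma P_addE (p p' : P) x : (p + p') x = fun k => p x k + p' x k. Proof. by []. Qed.

Lemma P_scaleE c (p : P) x : (c *: p) x = fun k => c * p x k. Proof. by []. Qed.

Lemma pair_ext (n n' : M * P) : n.1 = n'.1 -> n.2 = n'.2 -> n = n'.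
Proof. by case: n n' => [? ?] [? ?] /= -> ->. Qed.

Lemma fstD (n n' : M * P) : (n + n').1 = n.1 + n'.1. Proof. by []. Qed.

Lemma fstZ c (n : M * P) : (c *: n).1 = c *: n.1. Proof. by []. Qed.

Lemma sndD (n n' : M * P) : (n + n').2 = n.2 + n'.2. Proof. by []. Qed.

Lemma sndN (n : M * P) : (- n).2 = - n.2. Proof. by []. Qed.

Lemma sndZ c (n : M * P) : (c *: n).2 = c *: n.2. Proof. by []. Qed.

Lemma ins_D s p p' : ins s (fun k => p k + p' k) = (ins s p + ins s p' : W).
Proof.
apply/funext => t; rewrite -[RHS]/(ins s p t + ins s p' t) /ins; case: ifP => //.
by rewrite addr0.
Qed.

Lemma ins_Z s a p : ins s (fun k => a * p k) = (fun t => a * ins s p t).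
Proof. by apply/funext => t; rewrite /ins; case: ifP; rewrite ?mulr0. Qed.

Lemma at_vtx_D x p p' : at_vtx x (fun k => p k + p' k) = at_vtx x p + at_vtx x p'.
Proof.
apply/funext => y; apply/funext => k; rewrite -[RHS]/(at_vtx x p y k + at_vtx x p' y k) /at_vtx.
by case: ifP; rewrite ?addr0.
Qed.

Lemma at_vtx_Z x a p : at_vtx x (fun k => a * p k) = a *: at_vtx x p.
Proof.
apply/funext => y; apply/funext => k; rewrite -[RHS]/(a * at_vtx x p y k) /at_vtx.
by case: ifP; rewrite ?mulr0.
Qed.

Lemma opPD x p p' : opP x (p + p') = opP x p + opP x p'.
Proof.
case: x => [x|z b a|z a b] /=.
- by rewrite -at_vtx_D.
- case: ifP => _; rewrite ?addr0 // -at_vtx_D; congr at_vtx; apply/funext => k.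
  by rewrite P_addE ins_D (th'D (thP z)).
- case: ifP => _; rewrite ?addr0 // -at_vtx_D; congr at_vtx; apply/funext => k.
  by rewrite P_addE ins_D (thD (thP z)).
Qed.

Lemma opPZ x c p : opP x (c *: p) = c *: opP x p.
Proof.
case: x => [x|z b a|z a b] /=.
- by rewrite -at_vtx_Z.
- case: ifP => _; rewrite ?scaler0 // -at_vtx_Z; congr at_vtx; apply/funext => k.
  by rewrite P_scaleE ins_Z (th'Z (thP z)).
- case: ifP => _; rewrite ?scaler0 // -at_vtx_Z; congr at_vtx; apply/funext => k.
  by rewrite P_scaleE ins_Z (thZ (thP z)).
Qed.

Lemma combD v v' a : comb (fun j => v j + v' j) a = comb v a + comb v' a.
Proof. by rewrite /comb -big_split; apply: eq_bigr => j _; rewrite scalerDl. Qed.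

Lemma combZ c v a : comb (fun j => c * v j) a = c *: comb v a.
Proof. by rewrite /comb scaler_sumr; apply: eq_bigr => j _; rewrite scalerA. Qed.

Lemma u_D z h h' : u z (h + h' : W) = fun j => u z h j + u z h' j.
Proof. by apply/funext => j; rewrite (uD (thP z)). Qed.

Lemma u_Z z c h : u z (fun t => c * h t) = fun j => c * u z h j.
Proof. by apply/funext => j; rewrite (uZ (thP z)). Qed.

Lemma corrD x p p' : corr x (p + p') = corr x p + corr x p'.
Proof.
case: x => [x|z b a|z a b] /=; first by rewrite addr0.
- case: ifP => _; rewrite ?addr0 // -big_split; apply: eq_bigr => a' _.
  rewrite P_addE ins_D (th'D (thP z)) u_D.
  by rewrite combD nactDr.
- case: ifP => _; rewrite ?addr0 // -opprD.
  by rewrite P_addE ins_D u_D combD.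
Qed.

Lemma corrZ x c p : corr x (c *: p) = c *: corr x p.
Proof.
case: x => [x|z b a|z a b] /=; first by rewrite scaler0.
- case: ifP => _; rewrite ?scaler0 // scaler_sumr; apply: eq_bigr => a' _.
  rewrite P_scaleE ins_Z (th'Z (thP z)) u_Z.
  by rewrite combZ nactZr.
- case: ifP => _; rewrite ?scaler0 // scalerN.
  by rewrite P_scaleE ins_Z u_Z combZ.
Qed.

Lemma opN1 x n : (opN x n).1 = pres_class _ (NUGen K x) $* n.1 + corr x n.2. Proof. by []. Qed.

Lemma opN2 x n : (opN x n).2 = opP x n.2. Proof. by []. Qed.

Lemma opND x n n' : opN x (n + n') = opN x n + opN x n'.
Proof.
apply: pair_ext; rewrite ?fstD ?sndD ?opN1 ?opN2 ?fstD ?sndD ?opPD //.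
by rewrite corrD nactDr addrACA.
Qed.

Lemma opNZ x c n : opN x (c *: n) = c *: opN x n.
Proof.
apply: pair_ext; rewrite ?fstZ ?sndZ ?opN1 ?opN2 ?fstZ ?sndZ ?opPZ //.
by rewrite corrZ nactZr scalerDr.
Qed.

Lemma at_vtxE x p : at_vtx x p x = p.
Proof. by apply/funext => k; rewrite /at_vtx eqxx. Qed.

Lemma sum_ins (s : seq S) (h : W) : uniq s -> (forall t, ~ slots s t -> h t = 0) ->
  \sum_(a <- s) ins a (fun k => h (a, k)) = h.
Proof.
move=> us hs; apply/funext => -[b k].
have E (s' : seq S) : (\sum_(a <- s') ins a (fun k => h (a, k))) (b, k)
    = \sum_(a <- s') if b == a then h (a, k) else 0.
  elim: s' => [|a s' IH]; first by rewrite !big_nil.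
  by rewrite !big_cons -IH.
rewrite E; have [bs|bs] := boolP (b \in s); first by rewrite big_pick.
rewrite hs; last by apply/negP.
by rewrite big_seq big1 // => a sa; case: eqP => // ba; rewrite ba sa in bs.
Qed.

Lemma sum_at (s : seq S) x (F : S -> nat -> K) :
  \sum_(a <- s) at_vtx x (F a) = at_vtx x (fun k => \sum_(a <- s) F a k).
Proof.
elim: s => [|a s IH].
  rewrite big_nil; apply/funext => y; apply/funext => k; rewrite /at_vtx big_nil.
  by case: ifP.
rewrite big_cons IH -at_vtx_D; congr at_vtx; apply/funext => k; by rewrite big_cons.
Qed.

Lemma sum_th (s : seq S) z (F : S -> W) : \sum_(a <- s) th z (F a) = th z (\sum_(a <- s) F a).
Proof.
elim: s => [|a s IH]; last by rewrite !big_cons (thD (thP z)) IH.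
rewrite !big_nil; apply/esym; have := thZ (thP z) 0 0.
have -> : (fun t => 0 * (0 : W) t) = 0 by apply/funext => t; rewrite mul0r.
by move=> ->; apply/funext => t; rewrite mul0r.
Qed.

Lemma sum_th' (s : seq S) z (F : S -> W) : \sum_(a <- s) th' z (F a) = th' z (\sum_(a <- s) F a).
Proof.
elim: s => [|a s IH]; last by rewrite !big_cons (th'D (thP z)) IH.
rewrite !big_nil; apply/esym; have := th'Z (thP z) 0 0.
have -> : (fun t => 0 * (0 : W) t) = 0 by apply/funext => t; rewrite mul0r.
by move=> ->; apply/funext => t; rewrite mul0r.
Qed.

Lemma sum_u (s : seq S) z (F : S -> W) :
  (fun j => \sum_(a <- s) u z (F a) j) = u z (\sum_(a <- s) F a).
Proof.
apply/funext => j; elim: s => [|a s IH]; last by rewrite !big_cons (uD (thP z)) IH.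
rewrite !big_nil; apply/esym; have := uZ (thP z) 0 0 j.
have -> : (fun t => 0 * (0 : W) t) = 0 by apply/funext => t; rewrite mul0r.
by move=> ->; rewrite mul0r.
Qed.

Lemma sum_comb (s : seq S) (F : S -> 'I_(pm Q) -> K) a :
  \sum_(b <- s) comb (F b) a = comb (fun j => \sum_(b <- s) F b j) a.
Proof. by rewrite /comb exchange_big; apply: eq_bigr => j _; rewrite scaler_suml. Qed.

Lemma ins_out s b p t : b \in s -> ~ slots s t -> ins b p t = 0.
Proof. by move=> bs nt; rewrite /ins; case: eqP => // tb; case: nt; rewrite /slots /= tb. Qed.

Lemma X_G z h a : a \in hA z -> rX r (hlab a) $* comb (u z h) a = comb (u z h) a.
Proof.
move=> aA; rewrite /comb nact_sumr; apply: eq_bigr => j _; rewrite nactZr.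
have [/eqP zj|nj] := boolP (pz Q j == z); first by rewrite gP // zj.
by rewrite (u_supp (thP z)) // !scale0r.
Qed.

Lemma opP_rel s t : hrel s t -> forall p, oeval opP s p = oeval opP t p.
Proof.
case=> [x y|z b a|z b a|z a b|z a b|z b a h|z a b h|z b b' bB b'B|z a a' aA a'A] p.
- rewrite /=; case: eqP => [->|/eqP xy] /=; first by rewrite at_vtxE.
  apply/funext => v; apply/funext => k; rewrite /at_vtx (negbTE xy).
  by case: ifP.
- rewrite /=; case: ifP => _ /=; first by rewrite at_vtxE.
  by apply/funext => v; apply/funext => k; rewrite /at_vtx; case: ifP.
- by rewrite /=; case: ifP => //; rewrite at_vtxE.
- rewrite /=; case: ifP => _ /=; first by rewrite at_vtxE.
  by apply/funext => v; apply/funext => k; rewrite /at_vtx; case: ifP.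
- by rewrite /=; case: ifP => //; rewrite at_vtxE.
- by rewrite /= (negbTE h).
- by rewrite /= (negbTE h).
- rewrite oeval_sum big_map /= big_seq.
  under eq_bigr => a aA do rewrite aA b'B bB /= at_vtxE.
  rewrite -big_seq sum_at; set h := ins b' _.
  have -> : (fun k => \sum_(a <- hA z) th' z (ins a (fun k => th z h (a, k))) (b, k))
      = fun k => h (b, k).
    apply/funext => k; rewrite -(sumfE _ (fun a => th' z (ins a (fun k => th z h (a, k))))).
    rewrite sum_th' sum_ins ?hA_uniq ?(thK (thP z)) //.
      by move=> w; apply: ins_out.
    by move=> w; apply: (th_out (thP z)).
  rewrite /h /ins /=; case: eqP => [->//|_].
  by apply/funext => v; apply/funext => k; rewrite /at_vtx; case: ifP.
- rewrite oeval_sum big_map /= big_seq.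
  under eq_bigr => b bB do rewrite bB a'A aA /= at_vtxE.
  rewrite -big_seq sum_at; set h := ins a' _.
  have -> : (fun k => \sum_(b <- hB z) th z (ins b (fun k => th' z h (b, k))) (a, k))
      = fun k => h (a, k).
    apply/funext => k; rewrite -(sumfE _ (fun b => th z (ins b (fun k => th' z h (b, k))))).
    rewrite sum_th sum_ins ?hB_uniq ?(th'K (thP z)) //.
      by move=> w; apply: ins_out.
    by move=> w; apply: (th'_out (thP z)).
  rewrite /h /ins /=; case: eqP => [->//|_].
  by apply/funext => v; apply/funext => k; rewrite /at_vtx; case: ifP.
Qed.

Definition quotP : nmod Lam := omod opPD opPZ opP_rel.

Lemma oevalN2 t n : (oeval opN t n).2 = oeval opP t n.2.
Proof.
elim: t n => [//|//|s IHs t IHt|s IHs|k s IHs|s IHs t IHt] n.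
- by rewrite !oeval_add sndD IHs IHt.
- by rewrite !oeval_opp sndN IHs.
- by rewrite !oeval_scale sndZ IHs.
- by rewrite !oeval_mul IHs IHt.
Qed.

(** In block form [HPsi] acts by [(psi, -c; 0, th)] and [HPhi] by [(phi, phi c th'; 0, th')], where
    [c] stands for [comb (u z _)]. These are mutually inverse because [psi], [phi] and [th], [th']
    are. *)
Lemma opN_rel s t : hrel s t -> forall n, oeval opN s n = oeval opN t n.
Proof.
move=> st n; apply/eqP; rewrite -pair_eqE; apply/andP; split; apply/eqP; last first.
  by rewrite !oevalN2; apply: opP_rel.
case: st => [x y|z b a|z b a|z a b|z a b|z b a h|z a b h|z b b' bB b'B|z a a' aA a'A].
- rewrite /= !clsE !addr0 rX_act; by case: eqP => [->|_] //=; rewrite addr0.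
- rewrite /= !clsE addr0 nactDr -nactM (rphl r); congr (_ + _); case: ifP => _; last by rewrite nact0r.
  by rewrite nact_sumr; apply: eq_bigr => a' _; rewrite -nactM (rphl r).
- by rewrite /= !clsE addr0 -nactM (rphr r); congr (_ + _); case: ifP => //; rewrite at_vtxE.
- rewrite /= !clsE addr0 nactDr -nactM (rpsl r); congr (_ + _); case: ifP => [/andP[aA _]|_]; last by rewrite nact0r.
  by rewrite nactNr X_G.
- by rewrite /= !clsE addr0 -nactM (rpsr r); congr (_ + _); case: ifP => //; rewrite at_vtxE.
- by rewrite /= !clsE (negbTE h) addr0 (rph_out K h) nact0l.
- by rewrite /= !clsE (negbTE h) addr0 (rps_out K h) nact0l.
- rewrite oeval_sum big_map (big_morph (fun n : M * P => n.1) (id1 := 0) (op1 := +%R)) //=.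
  set h := ins b' (n.2 (hlab b')).
  have E a : a \in hA z -> rph r z b a $*
      (rps r z a b' $* n.1
        + (if (a \in hA z) && (b' \in hB z) then - comb (u z h) a else 0))
      + (if (b \in hB z) && (a \in hA z) then
        \sum_(a' <- hA z) rph r z b a' $* comb (u z (th' z (ins a
         ((if (a \in hA z) && (b' \in hB z) then at_vtx (hlab a) (fun k => th z h (a, k)) else 0) (hlab a))))) a'
        else 0)
      = (rph r z b a ** rps r z a b') $* n.1 + (- (rph r z b a $* comb (u z h) a)
        + \sum_(a' <- hA z) rph r z b a' $* comb (u z (th' z (ins a (fun k => th z h (a, k))))) a').
    by move=> aA; rewrite aA b'B bB /= at_vtxE nactDr nactNr nactM addrA.
  have E2 a' : \sum_(a <- hA z) rph r z b a' $* comb (u z (th' z (ins a (fun k => th z h (a, k))))) a'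
      = rph r z b a' $* comb (u z h) a'.
    rewrite -nact_sumr sum_comb sum_u sum_th' sum_ins ?hA_uniq ?(thK (thP z)) //.
      by move=> w; apply: ins_out.
    by move=> w; apply: (th_out (thP z)).
  rewrite big_seq (eq_bigr _ E) -big_seq big_split -nact_suml (rphps r) // big_split /= sumrN.
  rewrite exchange_big /= (eq_bigr _ (fun a' _ => E2 a')).
  rewrite addNr addr0 /=; case: eqP => [->|_] /=; rewrite ?addr0 // nact0l.
  by [].
- rewrite oeval_sum big_map (big_morph (fun n : M * P => n.1) (id1 := 0) (op1 := +%R)) //=.
  set h := ins a' (n.2 (hlab a')).
  have E b : b \in hB z -> rps r z a b $*
      (rph r z b a' $* n.1
        + (if (b \in hB z) && (a' \in hA z) then \sum_(a0 <- hA z) rph r z b a0 $* comb (u z (th' z h)) a0 else 0))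
      + (if (a \in hA z) && (b \in hB z) then
        - comb (u z (ins b ((if (b \in hB z) && (a' \in hA z) then at_vtx (hlab b) (fun k => th' z h (b, k)) else 0) (hlab b)))) a
        else 0)
      = (rps r z a b ** rph r z b a') $* n.1 +
        (\sum_(a0 <- hA z) (rps r z a b ** rph r z b a0) $* comb (u z (th' z h)) a0
         - comb (u z (ins b (fun k => th' z h (b, k)))) a).
    move=> bB; rewrite bB aA a'A /= at_vtxE nactDr nactM nact_sumr -addrA.
    by congr (_ + (_ + _)); apply: eq_bigr => a0 _; rewrite nactM.
  rewrite big_seq (eq_bigr _ E) -big_seq big_split -nact_suml (rpsph r) // big_split /= sumrN.
  rewrite exchange_big /=.
  have E2 a0 : a0 \in hA z -> \sum_(b <- hB z) (rps r z a b ** rph r z b a0) $* comb (u z (th' z h)) a0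
      = if a == a0 then rX r (hlab a0) $* comb (u z (th' z h)) a0 else 0.
    by move=> a0A; rewrite -nact_suml (rpsph r) //; case: eqP => [->//|_]; rewrite nact0l.
  rewrite [X in _ + (X - _)]big_seq (eq_bigr _ E2) -big_seq big_pick ?hA_uniq // X_G //.
  rewrite sum_comb sum_u sum_ins ?hB_uniq ?subrr; last by move=> w; apply: (th'_out (thP z)).
  rewrite addr0 /=; case: eqP => [->|_] /=; rewrite ?addr0 // nact0l.
  all: by [].
Qed.

Definition twisted : nmod Lam := omod opND opNZ opN_rel.

Definition tw_inj (m : M) : twisted := (m, 0 : P).
Definition tw_proj (n : twisted) : quotP := n.2.

Lemma tw_injD m m' : tw_inj (m + m') = tw_inj m + tw_inj m'.
Proof. by congr pair; rewrite /= addr0. Qed.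

Lemma tw_injZ k m : tw_inj (k *: m) = k *: tw_inj m.
Proof. by congr pair; rewrite /= scaler0. Qed.

Lemma tw_proj_act a n : tw_proj (a $* n) = a $* tw_proj n.
Proof. exact: oevalN2. Qed.

Lemma tw_projD n n' : tw_proj (n + n') = tw_proj n + tw_proj n'.
Proof. exact: sndD. Qed.

Lemma tw_projZ k n : tw_proj (k *: n) = k *: tw_proj n.
Proof. exact: sndZ. Qed.

Lemma quotP_spacious : spacious r quotP.
Proof.
move=> x; exists (at_vtx x (fun=> 1)); split.
  by rewrite [LHS](omod_gen _ _ _ (HVtx x)) /= at_vtxE.
move/(congr1 (fun p : P => p x 0%N)); rewrite /at_vtx eqxx; apply/eqP/oner_neq0.
Qed.

Lemma opP0 x : opP x 0 = 0.
Proof. by have := opPZ x 0 0; rewrite !scale0r. Qed.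

Lemma corr0 x : corr x 0 = 0.
Proof. by have := corrZ x 0 0; rewrite !scale0r. Qed.

Lemma tw_inj_act a m : tw_inj (a $* m) = a $* tw_inj m.
Proof.
elim/presented_ind: a m => [x m||a b IHa IHb m|a IHa m|k a IHa m|a b IHa IHb m].
- by rewrite (omod_gen _ _ _ x) /= /opN /= corr0 opP0 addr0.
- by move=> m; rewrite !nact0l.
- by rewrite !nactDl tw_injD IHa IHb.
- by rewrite !nactNl -IHa; congr pair; rewrite /= oppr0.
- by rewrite !nactZl tw_injZ IHa.
- by rewrite !nactM IHa IHb.
Qed.

Definition std (i : 'I_(pn Q)) : P := fun y k => ((y == plab Q i) && (k == i))%:R.

Definition tw_std (i : 'I_(pn Q)) : twisted := (0, std i).

Lemma tw_std_neq0 i : tw_std i <> 0.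
Proof.
move/(congr1 snd)/(congr1 (fun p : P => p (plab Q i) i)); rewrite /= /std !eqxx /=.
exact/eqP/oner_neq0.
Qed.

Lemma ev_std y : ev tw_std y =
  (0, (fun v k => \sum_i y i * ((v == plab Q i) && (k == i))%:R) : P) :> twisted.
Proof.
rewrite /ev; apply/eqP; rewrite -pair_eqE; apply/andP; split; apply/eqP.
  rewrite (big_morph (fun n : M * P => n.1) (id1 := 0) (op1 := +%R)) //= big1 // => i _.
  by rewrite scaler0.
rewrite (big_morph (fun n : M * P => n.2) (id1 := 0) (op1 := +%R)) //=.
apply/funext => v; apply/funext => k.
elim/big_rec2: _ => // i x x' _ <-.
by [].
Qed.

(** The A-side of the equation [j] contributes [al_hat j]. The B-side contributes [th z (be_hat j)],
    which is the same vector, together with the cocycle value [- g j a], because [u z (be_hat j)] is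
    the unit vector [j]. The difference is [g j a], inside [M]. *)
Lemma tw_std_sol : sol r (fun j a => tw_inj (g j a)) tw_std.
Proof.
split.
  move=> i; rewrite (omod_gen _ _ _ (HVtx _)) /opN /= /tw_std nact0r addr0; congr pair.
  apply/funext => y; apply/funext => k; rewrite /at_vtx /std.
  by case: (eqVneq y (plab Q i)) => _ //=; rewrite eqxx.
move=> j a aA; rewrite /del; set z := pz Q j.
pose f (u : 'I_(pn Q) -> K) : P := fun v k => \sum_i u i * ((v == plab Q i) && (k == i))%:R.
have beE : be_hat j = \sum_(b <- hB z) ins b (f (pb Q j b) (hlab b)).
  rewrite -[LHS](@sum_ins (hB z)) ?hB_uniq //; last first.
    by move=> t nt; rewrite /be_hat; case: ifP.
  rewrite big_seq [RHS]big_seq; apply: eq_bigr => b bB; congr ins.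
  by apply/funext => k; rewrite /be_hat /= bB.
have E b : b \in hB z -> rps r z a b $* ev tw_std (pb Q j b) =
    (- comb (u z (ins b (f (pb Q j b) (hlab b)))) a,
     at_vtx (hlab a) (fun k => th z (ins b (f (pb Q j b) (hlab b))) (a, k))) :> twisted.
  move=> bB; rewrite ev_std (omod_gen _ _ _ (HPsi z a b)) /opN /= aA bB /= nact0r add0r.
  by [].
rewrite [X in _ - X]big_seq (eq_bigr _ E) -big_seq ev_std (omod_gen _ _ _ (HVtx _)) /opN /=.
rewrite nact0r addr0 -/(f _).
apply/eqP; rewrite -pair_eqE; apply/andP; split; apply/eqP.
  rewrite /= (big_morph (fun n : M * P => n.1) (id1 := 0) (op1 := +%R)) //= sumrN opprK add0r.
  rewrite sum_comb sum_u -beE /comb (bigD1 j) //= (u_be (thP z)) // eqxx scale1r big1 ?addr0 // => i ij.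
  by rewrite (u_be (thP z)) // (negbTE ij) scale0r.
rewrite /= (big_morph (fun n : M * P => n.2) (id1 := 0) (op1 := +%R)) //= sum_at.
have -> : (fun k => \sum_(b <- hB z) th z (ins b (f (pb Q j b) (hlab b))) (a, k)) = f (pa Q j a) (hlab a).
  apply/funext => k; rewrite -(sumfE _ (fun b => th z (ins b (f (pb Q j b) (hlab b))))).
  by rewrite sum_th -beE (th_be (thP z)) // /al_hat /= aA.
exact: subrr.
Qed.

End TwistedExtension.

Record nhom (K : fieldType) (A : nuAlgType K) (M N : nmod A) := NHom {
  nfun :> M -> N;
  nhomD : forall m m', nfun (m + m') = nfun m + nfun m';
  nhomZ : forall k m, nfun (k *: m) = k *: nfun m;
  nhomA : forall a m, nfun (a $* m) = a $* nfun m
}.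

Section NhomTheory.
Variables (K : fieldType) (A : nuAlgType K) (M N : nmod A) (h : nhom M N).

Lemma nhom0 : h 0 = 0.
Proof. by have := nhomZ h 0 0; rewrite !scale0r. Qed.

Lemma nhomN m : h (- m) = - h m.
Proof. by have := nhomZ h (-1) m; rewrite !scaleN1r. Qed.

Lemma nhomB m m' : h (m - m') = h m - h m'.
Proof. by rewrite nhomD nhomN. Qed.

Lemma nhom_sum I (s : seq I) (P : pred I) F : h (\sum_(i <- s | P i) F i) = \sum_(i <- s | P i) h (F i).
Proof. by apply: (big_morph h); [exact: nhomD|exact: nhom0]. Qed.

Lemma nhom_ev n (f : 'I_n -> M) y : h (ev f y) = ev (h \o f) y.
Proof. by rewrite nhom_sum; apply: eq_bigr => i _; rewrite nhomZ. Qed.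

End NhomTheory.

Definition regular (K : fieldType) (A : nuAlgType K) : nmod A :=
  @NMod K A A (fun a m => a ** m) (fun a b m => numulDl a b m) (fun a b m => numulDr a b m)
    (fun k a m => esym (nuscaleAl k a m)) (fun k a m => esym (nuscaleAr k a m))
    (fun a b m => esym (numulA a b m)).

Lemma nhom_sol (K : fieldType) (H : hypergraph) (Lam : nuAlgType K) (r : hrep H Lam)
    (M N : nmod Lam) (h : nhom M N) (Q : pencil K (hvtx H) (hslot H) (hyp H)) g f :
  @sol K H Lam r M Q g f -> @sol K H Lam r N Q (fun j a => h (g j a)) (h \o f).
Proof.
move=> [lf fg]; split=> [i|j a aA]; first by rewrite /= -nhomA lf.
rewrite -fg // /del nhomB nhomA nhom_ev nhom_sum; congr (_ - _).
by apply: eq_bigr => b _; rewrite nhomA nhom_ev.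
Qed.

(** * Acyclic pencils and presentations of idempotents *)

Section Embedding.
Variables (K : fieldType) (H : hypergraph).
Local Notation X := (hvtx H).
Local Notation S := (hslot H).
Local Notation Z := (hyp H).
Local Notation Lam := (hyper_alg K H).
Local Notation r := (hyper_rep K H).
Local Notation pencil := (pencil K X S Z).

Lemma slots_countable (s : seq S) : countable (slots s).
Proof.
have -> : slots s = ([set` s] `*` [set: nat])%classic.
  by apply/seteqP; split=> t /=; [|case].
by apply: countableX => //; apply: finite_set_countable; apply: finite_seq.
Qed.

Lemma slots_infinite (s : seq S) a : a \in s -> infinite_set (slots s).
Proof.
move=> sa fs; apply: infinite_nat; apply: sub_finite_set (finite_image snd fs).
by move=> n _; exists (a, n).
Qed.

Lemma hat_indep (lb : seq S) (m n : nat) (plb : 'I_n -> X) (P : pred 'I_m) (c : 'I_m -> S -> 'I_n -> K)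
    (hat : 'I_m -> S * nat -> K) :
  (forall j t, P j -> t.1 \in lb -> hat j t = \sum_i c j t.1 i * ((hlab t.1 == plb i) && (t.2 == i))%:R) ->
  (forall w, (forall j, w j != 0 -> P j) ->
    (forall a, a \in lb -> msk plb (hlab a) (fun i => \sum_j w j * c j a i) = fun=> 0) ->
    forall j, w j = 0) ->
  indep_on P hat.
Proof.
move=> hatE inj w wP w0; apply: inj => // a aA; apply/funext => i; rewrite /msk.
case: eqP => // ia; rewrite -[RHS](w0 (a, val i)); apply: eq_bigr => j _.
have [->|/wP Pj] := eqVneq (w j) 0; first by rewrite !mul0r.
rewrite hatE //= (bigD1 i) //= ia !eqxx mulr1 big1 ?addr0 // => i' ii.
have -> : (val i == i' :> nat) = false by rewrite eq_sym; apply/negbTE.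
by rewrite andbF mulr0.
Qed.

(** Injectivity on both sides makes [be_hat j] to [al_hat j] an isomorphism of finite-dimensional
    spaces for each [z]. It extends to the infinite-dimensional spaces of the slots, which is all
    that the twisted module requires. *)
Lemma embedding (Q : pencil) (M : nmod Lam) (g : 'I_(pm Q) -> S -> M) :
  Ainj Q -> Binj Q -> rhs r g ->
  exists (N P : nmod Lam) (i : nhom M N) (p : nhom N P) (f : 'I_(pn Q) -> N),
  [/\ injective i, forall m, p (i m) = 0, forall n, p n = 0 -> exists m, n = i m,
      sol r (fun j a => i (g j a)) f & (forall k, f k <> 0) /\ spacious r P].
Proof.
move=> AQ BQ gP.
have exth z : exists t, partial_iso_ext (fun j => pz Q j == z)
    (slots (hA z)) (slots (hB z)) (@al_hat K H Q) (@be_hat K H Q) t.1.1 t.1.2 t.2.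
  have [a aA] := hA_neq0 z; have [b bB] := hB_neq0 z.
  have [||||||||th [th' [u h]]] := @extend_partial_iso K _ _ (fun j => pz Q j == z) (slots (hA z))
     (slots (hB z)) (@al_hat K H Q) (@be_hat K H Q); last by exists (th, th', u).
  - exact: slots_countable.
  - exact: slots_infinite aA.
  - exact: slots_countable.
  - exact: slots_infinite bB.
  - by move=> j t /eqP zj; rewrite /al_hat zj /slots /=; case: ifP.
  - by move=> j t /eqP zj; rewrite /be_hat zj /slots /=; case: ifP.
  - apply: (@hat_indep (hA z) _ _ (plab Q) _ (pa Q)).
      by move=> j t /eqP zj tA; rewrite /al_hat zj tA.
    by move=> w wz; apply: AQ => j /wz/eqP.
  - apply: (@hat_indep (hB z) _ _ (plab Q) _ (pb Q)).
      by move=> j t /eqP zj tA; rewrite /be_hat zj tA.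
    by move=> w wz; apply: BQ => j /wz/eqP.
have [t tP] := choice exth.
pose N := twisted gP tP; pose P := quotP tP.
pose i : nhom M N := NHom (tw_injD gP tP) (tw_injZ gP tP) (tw_inj_act gP tP).
pose p : nhom N P := NHom (@tw_projD _ _ _ _ _ _ _ _ gP tP)
  (@tw_projZ _ _ _ _ _ _ _ _ gP tP) (@tw_proj_act _ _ _ _ _ _ _ _ gP tP).
exists N, P, i, p, (tw_std gP tP); split.
- by move=> m m' [].
- by [].
- by case=> m q /= q0; exists m; rewrite /tw_inj; congr pair.
- exact: tw_std_sol.
- by split; [exact: tw_std_neq0|exact: quotP_spacious].
Qed.

(** The quotient [P] of the extension is spacious for every pencil, and the empty pencil satisfies
    the hypotheses of [embedding]. *)
Lemma spacious_exists : exists M : nmod Lam, spacious r M.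
Proof.
pose Q : pencil := @Pencil K X S Z 0 (ffun0 (card_ord 0)) 0 (ffun0 (card_ord 0)) (fun _ _ _ => 0) (fun _ _ _ => 0).
have [|||N [P [_ [_ [_ [_ _ _ _ [_ sp]]]]]]] := @embedding Q (regular Lam) (fun _ _ => 0).
- by move=> z w _ _ [].
- by move=> z w _ _ [].
- by case.
by exists P.
Qed.

(** Once the pencil is injective, the zero right-hand side has in some module a solution without
    zero entries. Uniqueness makes this solution 0, so no variable is left; then injectivity leaves
    no equation either. *)
Lemma acyclic_chi (Q : pencil) (D : zmodType) (xi : X -> D) :
  balanced xi -> acyclic r Q -> chi xi Q = 0.
Proof.
move=> bal aQ; have [Q' [AQ BQ [s [T [_ _ _ ac]]]]] := reduces_inj r Q.
have [M0 sp] := spacious_exists; have [aQ' -> //] := ac _ sp aQ.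
have [|N [_ [i [_ [f [_ _ _ sf [fk _]]]]]]] := @embedding Q' (regular Lam) (fun _ _ => 0) AQ BQ.
  by move=> j a _; rewrite nact0r.
have n0 (k : 'I_(pn Q')) : False.
  have [|f0 [_ fu]] := aQ' N (fun _ _ => 0); first by move=> j a _; rewrite nact0r.
  have fE : f = f0 by apply: fu; move: sf; congr sol; do 2 apply/funext => ?; rewrite nhom0.
  by apply: (fk k); rewrite fE -(fu _ (sol0_0 r N Q')).
have m0 (j : 'I_(pm Q')) : False.
  suff : (j == j)%:R = 0 :> K by rewrite eqxx; apply/eqP/oner_neq0.
  apply: (AQ (pz Q' j) (fun i => (i == j)%:R)); last by move=> a _; apply/funext => k; case: (n0 k).
  by move=> k; case: (eqVneq k j) => [->//|_]; rewrite eqxx.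
by rewrite /chi !big1 ?subr0.
Qed.

Section Presentation.
Variables (n0 : nat) (lb0 : 'I_n0 -> X) (e : 'I_n0 -> 'I_n0 -> Lam).
Hypothesis e_idem : forall i j, \sum_k e i k ** e k j = e i j.
Hypothesis e_lab : forall i j, rX r (lb0 i) ** e i j = e i j.

Definition eact (M : nmod Lam) (p : 'I_n0 -> M) i := \sum_j e i j $* p j.

Lemma eactK (M : nmod Lam) (p : 'I_n0 -> M) : eact (eact p) = eact p.
Proof.
apply/funext => i; rewrite /eact; under eq_bigr do rewrite nact_sumr.
rewrite exchange_big; apply: eq_bigr => j _ /=.
by under eq_bigr do rewrite -nactM; rewrite -nact_suml e_idem.
Qed.

Lemma eactB (M : nmod Lam) (p p' : 'I_n0 -> M) :
  eact (fun i => p i - p' i) = fun i => eact p i - eact p' i.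
Proof. by apply/funext => i; rewrite /eact -sumrB; apply: eq_bigr => j _; rewrite nactBr. Qed.

Lemma eactD (M : nmod Lam) (p p' : 'I_n0 -> M) :
  eact (fun i => p i + p' i) = fun i => eact p i + eact p' i.
Proof. by apply/funext => i; rewrite /eact -big_split; apply: eq_bigr => j _; rewrite nactDr. Qed.

Lemma nhom_eact (M N : nmod Lam) (h : nhom M N) p i : h (eact p i) = eact (h \o p) i.
Proof. by rewrite nhom_sum; apply: eq_bigr => j _; rewrite nhomA. Qed.

Definition val_at n (eta : 'I_n0 -> 'I_n -> K) (M : nmod Lam) (f : 'I_n -> M) : 'I_n0 -> M :=
  fun i => rX r (lb0 i) $* ev f (eta i).

Lemma val_atB n (eta : 'I_n0 -> 'I_n -> K) (M : nmod Lam) (f f' : 'I_n -> M) :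
  val_at eta (fun i => f i - f' i) = fun i => val_at eta f i - val_at eta f' i.
Proof. by apply/funext => i; rewrite /val_at evfB nactBr. Qed.

Lemma val_atD n (eta : 'I_n0 -> 'I_n -> K) (M : nmod Lam) (f f' : 'I_n -> M) :
  val_at eta (fun i => f i + f' i) = fun i => val_at eta f i + val_at eta f' i.
Proof. by apply/funext => i; rewrite /val_at evfD nactDr. Qed.

(* Q represents the functor M |-> e M^n0. *)
Definition presents (Q : pencil) (eta : 'I_n0 -> 'I_(pn Q) -> K) :=
  (forall (M : nmod Lam) (f : 'I_(pn Q) -> M), sol0 r f -> eact (val_at eta f) = val_at eta f) /\
  (forall (M : nmod Lam) (p : 'I_n0 -> M), eact p = p ->
     exists f : 'I_(pn Q) -> M, [/\ sol0 r f, val_at eta f = p &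
       forall f', sol0 r f' -> val_at eta f' = p -> f' = f]).

Lemma presents_reduces Q Q' (eta : 'I_n0 -> 'I_(pn Q) -> K) : reduces r Q Q' -> presents eta ->
  exists eta' : 'I_n0 -> 'I_(pn Q') -> K, presents eta'.
Proof.
move=> [s [T [lE fw bw _]]] [pr1 pr2]; exists (fun i => push T (eta i)).
have valE (M : nmod Lam) (f : 'I_(pn Q') -> M) :
    val_at (fun i => push T (eta i)) f = val_at eta (pull T f).
  by apply/funext => i; rewrite /val_at ev_pull.
split=> [M f /bw[f0 _]|M p ep]; first by rewrite valE pr1.
have [f [f0 fp fu]] := pr2 M p ep; have [fE f1] := fw _ _ f0.
exists (f \o s); split=> //; first by rewrite valE -fE.
move=> f' f'0; rewrite valE => f'p; have [f2 <-] := bw _ _ f'0.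
by rewrite (fu _ f2 f'p).
Qed.

(** Injectivity splits the presentation: a family of variables amounts to arbitrary values of the
    equations plus an element of [e M^n0]. To solve for [g], pass to an extension [N], and subtract
    from a solution there the homogeneous solution with the same value under [e]. In the quotient
    [P] the difference is a homogeneous solution with value 0, hence 0; so it lies in [M]. *)
Lemma presents_unique_solution Q (eta : 'I_n0 -> 'I_(pn Q) -> K) :
  Ainj Q -> Binj Q -> presents eta ->
  forall (M : nmod Lam) (g : 'I_(pm Q) -> S -> M) p, rhs r g -> eact p = p ->
  exists f, [/\ sol r g f, eact (val_at eta f) = p &
    forall f', sol r g f' -> eact (val_at eta f') = p -> f' = f].
Proof.
move=> AQ BQ [pr1 pr2] M g p gP ep.
have [N [P [i [q [fN [inj_i qi ker_q sfN _]]]]]] := embedding AQ BQ gP.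
have [f0 [sf0 f0E _]] := pr2 N _ (eactK (val_at eta fN)).
have sd := sol_sub0 sfN sf0; pose d k := fN k - f0 k.
have valq (f : 'I_(pn Q) -> N) : q \o val_at eta f = val_at eta (q \o f).
  by apply/funext => k; rewrite /val_at /= nhomA nhom_ev.
have qd0 : q \o d = fun=> 0.
  have sq : sol0 r (q \o d).
    by have := nhom_sol q sd; congr sol; do 2 apply/funext => ?; rewrite qi.
  have [|f1 [_ _ fu]] := pr2 P (fun=> 0).
    by apply/funext => k; rewrite /eact big1 // => l _; rewrite nact0r.
  have z0 : val_at eta (fun=> 0 : P) = fun=> 0.
    by apply/funext => k; rewrite /val_at evf0 nact0r.
  suff /(fu _ sq) -> : val_at eta (q \o d) = fun=> 0 by rewrite -(fu _ (sol0_0 r P Q) z0).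
  have sqf : sol0 r (q \o fN).
    by have := nhom_sol q sfN; congr sol; do 2 apply/funext => ?; rewrite qi.
  rewrite -valq /d val_atB f0E; apply/funext => k; rewrite /= nhomB nhom_eact valq pr1 //.
  by rewrite -valq subrr.
have [f fE] := choice (fun k => ker_q (d k) (congr1 (fun F => F k) qd0)).
have fdE : i \o f = d by apply/funext => k; rewrite fE.
have sf : sol r g f.
  split=> [k|j a aA]; apply: inj_i.
    by rewrite nhomA -fE; case: sd.
  have [_ /(_ j a aA) <-] := sd; rewrite /del nhomB nhomA nhom_ev fdE nhom_sum; congr (_ - _).
  by apply: eq_bigr => b _; rewrite nhomA nhom_ev fdE.
have ef : eact (val_at eta f) = fun=> 0.
  apply/funext => k; apply: inj_i; rewrite nhom_eact nhom0.
  have -> : i \o val_at eta f = val_at eta d.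
    by apply/funext => l; rewrite /val_at /= nhomA nhom_ev fdE.
  by rewrite /d val_atB f0E eactB eactK subrr.
have [fp [sfp fpE fpu]] := pr2 M p ep.
exists (fun k => f k + fp k); split.
- exact: sol_add0.
- by rewrite val_atD eactD ef fpE ep; apply/funext => k; rewrite add0r.
move=> f' sf' ef'.
have s0 := sol0_diff sf' sf; apply/funext => k.
have -> : fp = fun k => f' k - f k.
  apply/esym/fpu => //; rewrite -(pr1 _ _ s0) val_atB eactB ef ef'.
  by apply/funext => l; rewrite subr0.
by rewrite addrC subrK.
Qed.

End Presentation.

End Embedding.

(** * Linearization of matrices *)

Section FreePencils.
Variables (K : fieldType) (Lam : nuAlgType K).

Section Free.
Variables (H : hypergraph) (r : hrep H Lam) (n0 : nat) (lb0 : 'I_n0 -> hvtx H).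
Local Notation pencil := (pencil K (hvtx H) (hslot H) (hyp H)).

(** The pencil presents the sum of the projectives with labels [lb0]: all other variables are
    auxiliary and determined by those in the image of [emb]. *)
Record free_over (Q : pencil) (emb : 'I_n0 -> 'I_(pn Q)) : Prop := FreeOver {
  fo_lab : forall i, plab Q (emb i) = lb0 i;
  fo_sol : forall (M : nmod Lam) (f0 : 'I_n0 -> M), labelled r lb0 f0 ->
    uniquely_solvable r (fun f : 'I_(pn Q) -> M => f \o emb = f0);
  fo_chi : forall (D : zmodType) (xi : hvtx H -> D), balanced xi ->
    chi xi Q = \sum_i xi (lb0 i)
}.

Definition extends (Q Q' : pencil) (k : 'I_(pn Q) -> 'I_(pn Q')) :=
  forall (M : nmod Lam) (f : 'I_(pn Q') -> M), sol0 r f -> sol0 r (f \o k).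

End Free.

Lemma free_over_swap (H : hypergraph) (r : hrep H Lam) (Q : pencil K (hvtx H) (hslot H) (hyp H)) n0
    (lb0 : 'I_n0 -> hvtx H) (emb : 'I_n0 -> 'I_(pn Q)) :
  free_over r lb0 emb -> @free_over (hswap H) (rswap r) n0 lb0 (pswap Q) emb.
Proof.
move=> [fl fs fc]; split=> // [M f0 lf0|D xi bal]; first exact/uniquely_solvable_swap/fs.
by rewrite chi_swap ?fc //; move=> z; rewrite bal.
Qed.

Lemma free_over_unswap (H : hypergraph) (r : hrep H Lam) (Q : pencil K (hvtx H) (hslot H) (hyp H)) n0
    (lb0 : 'I_n0 -> hvtx H) (emb : 'I_n0 -> 'I_(pn Q)) :
  @free_over (hswap H) (rswap r) n0 lb0 Q emb -> @free_over H r n0 lb0 (pswap Q) emb.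
Proof.
move=> [fl fs fc]; split=> // [M f0 lf0|D xi bal]; first exact/uniquely_solvable_unswap/fs.
by rewrite -chi_unswap ?fc //; move=> z; rewrite bal.
Qed.

Section Step.
Variables (H : hypergraph) (r : hrep H Lam).
Local Notation S := (hslot H).
Local Notation pencil := (pencil K (hvtx H) S (hyp H)).
Variables (Q : pencil) (z : hyp H) (c : S -> 'I_(pn Q) -> K).

Definition widen n k (u : 'I_n -> K) : 'I_(n + k) -> K := fun i =>
  if fintype.split i is inl i' then u i' else 0.

Arguments widen {n} k u _.

Lemma ev_widen (M : nmod Lam) n k (f : 'I_(n + k) -> M) u :
  ev f (widen k u) = ev (f \o lshift k) u.
Proof.
rewrite /ev big_split_ord /= [X in _ + X]big1 ?addr0 => [|i _].
  apply: eq_bigr => i _; rewrite /widen.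
  by case: splitP => [j /= /val_inj ->|j /= E] //; have := ltn_ord i; rewrite E ltnNge leq_addr.
rewrite /widen; case: splitP => [j /= E|j _]; last by rewrite scale0r.
by have := ltn_ord j; rewrite -E ltnNge leq_addr.
Qed.

(* One new w in W_z with prescribed components in the slots of A z and fresh  *)
(* basis vectors as components in the slots of B z.                           *)
Definition step_pencil : pencil :=
  @Pencil K (hvtx H) S (hyp H) (pn Q + size (hB z))
    (fun i => match fintype.split i with inl i' => plab Q i' | inr b => hlab (tnth (in_tuple (hB z)) b) end)
    (pm Q).+1 (fun j => if unlift ord0 j is Some j' then pz Q j' else z)
    (fun j s => if unlift ord0 j is Some j' then widen _ (pa Q j' s) else widen _ (c s))
    (fun j s => if unlift ord0 j is Some j' then widen _ (pb Q j' s)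
       else fun i => match fintype.split i with inl _ => 0 | inr b => (tnth (in_tuple (hB z)) b == s)%:R end).

Definition old : 'I_(pn Q) -> 'I_(pn step_pencil) := @lshift (pn Q) (size (hB z)).
Definition new : 'I_(size (hB z)) -> 'I_(pn step_pencil) := @rshift (pn Q) (size (hB z)).

Lemma step_lab_old i : plab step_pencil (old i) = plab Q i.
Proof.
rewrite /=; case: splitP => [j /= /val_inj ->//|j /= E].
by have := ltn_ord i; rewrite E ltnNge leq_addr.
Qed.

Lemma step_lab_new b : plab step_pencil (new b) = hlab (tnth (in_tuple (hB z)) b).
Proof.
rewrite /=; case: splitP => [j /= E|j /= /addnI/val_inj ->//].
by have := ltn_ord j; rewrite -E ltnNge leq_addr.
Qed.

Lemma step_del_old (M : nmod Lam) (f : 'I_(pn step_pencil) -> M) j s :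
  del r f (fintype.lift ord0 j) s = del r (f \o old) j s.
Proof.
rewrite /del /= liftK ev_widen; congr (_ - _).
by apply: eq_bigr => b _; rewrite ev_widen.
Qed.

Definition newval (M : nmod Lam) (f : 'I_(pn step_pencil) -> M) (s : S) : M :=
  \sum_(b < size (hB z)) (tnth (in_tuple (hB z)) b == s)%:R *: f (new b).

Lemma newvalE (M : nmod Lam) (f : 'I_(pn step_pencil) -> M) b :
  newval f (tnth (in_tuple (hB z)) b) = f (new b).
Proof.
rewrite /newval (bigD1 b) //= eqxx scale1r big1 ?addr0 // => b' bb.
have -> : (tnth (in_tuple (hB z)) b' == tnth (in_tuple (hB z)) b) = false; last by rewrite scale0r.
have [x0 _] := hB_neq0 z; apply/negbTE; apply: contra bb; rewrite !(tnth_nth x0) /=.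
by rewrite nth_uniq ?hB_uniq.
Qed.

Lemma ev_new (M : nmod Lam) (f : 'I_(pn step_pencil) -> M) s :
  ev f (pb step_pencil ord0 s) = newval f s.
Proof.
rewrite /ev /= unlift_none big_split_ord /= big1 ?add0r => [|i _].
  apply: eq_bigr => b _; case: splitP => [j /= E|j /= /addnI/val_inj ->//].
  by have := ltn_ord j; rewrite -E ltnNge leq_addr.
case: splitP => [j _|j /= E]; first by rewrite scale0r.
by have := ltn_ord i; rewrite E ltnNge leq_addr.
Qed.

Lemma step_del_new (M : nmod Lam) (f : 'I_(pn step_pencil) -> M) s :
  del r f ord0 s = rX r (hlab s) $* ev (f \o old) (c s) - \sum_(b <- hB z) rps r z s b $* newval f b.
Proof.
have zE : pz step_pencil ord0 = z by rewrite /= unlift_none.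
have cE : pa step_pencil ord0 s = widen _ (c s) by rewrite /= unlift_none.
rewrite /del zE cE ev_widen; congr (_ - _).
by apply: eq_bigr => b _; rewrite ev_new.
Qed.

(** Applying [rph] to the new equation solves it for the fresh variables. *)
Lemma newval_solved (M : nmod Lam) (g : 'I_(pm step_pencil) -> S -> M) f b :
  sol r g f -> b \in hB z ->
  newval f b = \sum_(a <- hA z) rph r z b a $* (ev (f \o old) (c a) - g ord0 a).
Proof.
move=> [lf fg] bB.
have zE : pz step_pencil ord0 = z by rewrite /= unlift_none.
have E a : a \in hA z -> rph r z b a $* (ev (f \o old) (c a) - g ord0 a)
    = \sum_(b' <- hB z) (rph r z b a ** rps r z a b') $* newval f b'.
  move=> aA; have := fg ord0 a; rewrite zE => /(_ aA); rewrite step_del_new => <-.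
  rewrite !nactBr -[in X in _ - (X - _)]nactM rphr opprB addrC subrK nact_sumr.
  by apply: eq_bigr => b' _; rewrite nactM.
rewrite big_seq (eq_bigr _ E) -big_seq exchange_big big_seq.
have E2 b' : b' \in hB z -> \sum_(a <- hA z) (rph r z b a ** rps r z a b') $* newval f b'
    = if b == b' then newval f b' else 0.
  move=> b'B; rewrite -nact_suml rphps //; case: eqP => [->|_]; last by rewrite nact0l.
  have /(nthP b) [i iB <-] := b'B; pose i' := Ordinal iB.
  have -> : nth b (hB z) i = tnth (in_tuple (hB z)) i' by rewrite (tnth_nth b).
  by rewrite newvalE -step_lab_new lf.
by rewrite (eq_bigr _ E2) -big_seq big_pick ?hB_uniq.
Qed.

Lemma step_solvable (M : nmod Lam) (g : 'I_(pm step_pencil) -> S -> M) (f0 : 'I_(pn Q) -> M) :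
  rhs r g -> sol r (fun j => g (fintype.lift ord0 j)) f0 ->
  exists f, [/\ sol r g f, f \o old = f0 & forall f', sol r g f' -> f' \o old = f0 -> f' = f].
Proof.
move=> gP [lf0 f0g].
pose nw b := \sum_(a <- hA z) rph r z (tnth (in_tuple (hB z)) b) a $* (ev f0 (c a) - g ord0 a).
pose f : 'I_(pn step_pencil) -> M := fun i => match fintype.split i with inl i' => f0 i' | inr b => nw b end.
have f_old : f \o old = f0.
  apply/funext => i; rewrite /f /=; case: splitP => [j /= /val_inj ->//|j /= E].
  by have := ltn_ord i; rewrite E ltnNge leq_addr.
have f_new b : f (new b) = nw b.
  rewrite /f /=; case: splitP => [j /= E|j /= /addnI/val_inj ->//].
  by have := ltn_ord j; rewrite -E ltnNge leq_addr.
have splitE (i : 'I_(pn step_pencil)) : (exists i', i = old i') \/ exists b, i = new b.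
  case: (split_ordP i) => j ->; [by left; exists j|by right; exists j].
have zE : pz step_pencil ord0 = z by rewrite /= unlift_none.
have nwE b : b \in hB z -> newval f b = \sum_(a <- hA z) rph r z b a $* (ev f0 (c a) - g ord0 a).
  move=> /[dup] bB /(nthP b) [i iB <-]; pose i' := Ordinal iB.
  have -> : nth b (hB z) i = tnth (in_tuple (hB z)) i' by rewrite (tnth_nth b).
  by rewrite newvalE f_new.
have sf : sol r g f.
  split.
    move=> i; have [[i' ->]|[b ->]] := splitE i.
      by rewrite step_lab_old -[f (old i')]/((f \o old) i') f_old lf0.
    rewrite step_lab_new f_new /nw nact_sumr; apply: eq_bigr => a _.
    by rewrite -nactM rphl.
  move=> j; case: (unliftP ord0 j) => [j' ->|->] a aA.
    by rewrite step_del_old f_old f0g //; move: aA; rewrite /= liftK.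
  have {}aA : a \in hA z by rewrite -zE.
  rewrite step_del_new f_old.
  have E : \sum_(b <- hB z) rps r z a b $* newval f b = rX r (hlab a) $* (ev f0 (c a) - g ord0 a).
    rewrite big_seq (eq_bigr (fun b => \sum_(a' <- hA z)
      (rps r z a b ** rph r z b a') $* (ev f0 (c a') - g ord0 a'))); last first.
      by move=> b bB; rewrite nwE // nact_sumr; apply: eq_bigr => a' _; rewrite nactM.
    rewrite -big_seq exchange_big big_seq /=.
    rewrite (eq_bigr (fun a' => if a == a' then rX r (hlab a') $* (ev f0 (c a') - g ord0 a') else 0)).
      by rewrite -big_seq big_pick ?hA_uniq.
    move=> a' a'A; rewrite -nact_suml rpsph //; case: eqP => [->//|_]; by rewrite nact0l.
  by rewrite E nactBr opprB addrC subrK gP ?zE.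
exists f; split=> // f' sf' f'_old; apply/funext => i.
have [[i' ->]|[b ->]] := splitE i.
  by rewrite -[LHS]/((f' \o old) i') f'_old -f_old.
rewrite -(newvalE f') -(newvalE f) (newval_solved sf') ?(newval_solved sf) ?mem_tnth //.
by rewrite f'_old f_old.
Qed.

Lemma step_sol_old (M : nmod Lam) (g : 'I_(pm step_pencil) -> S -> M) f :
  sol r g f -> sol r (fun j => g (fintype.lift ord0 j)) (f \o old).
Proof.
move=> [lf fg]; split=> [i|j a aA]; first by rewrite /= -step_lab_old lf.
by rewrite -step_del_old fg //= liftK.
Qed.

(** The fresh variables carry the labels of [hB z] and the new equation costs the labels of [hA z];
    for balanced [xi] they cancel. *)
Lemma step_chi (D : zmodType) (xi : hvtx H -> D) : balanced xi -> chi xi step_pencil = chi xi Q.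
Proof.
move=> bal; rewrite /chi big_split_ord [X in _ - X]big_ord_recl /= unlift_none bal.
have -> : \sum_i xi (plab step_pencil (old i)) = \sum_i xi (plab Q i).
  by apply: eq_bigr => i _; rewrite step_lab_old.
have -> : \sum_i xi (plab step_pencil (new i)) = \sum_(b <- hB z) xi (hlab b).
  by rewrite [RHS]big_tnth; apply: eq_bigr => i _; rewrite step_lab_new.
rewrite opprD addrA addrK; congr (_ - _); apply: eq_bigr => j _; by rewrite liftK.
Qed.

Lemma step_free n0 (lb0 : 'I_n0 -> hvtx H) emb : free_over r lb0 emb ->
  free_over r lb0 (old \o emb).
Proof.
move=> [fl fs fc]; split=> [i|M f0 lf0 g gP|D xi bal]; first by rewrite step_lab_old.
  have [|f1 [sf1 f1e f1u]] := fs M f0 lf0 (fun j => g (fintype.lift ord0 j)).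
    by move=> j a aA; apply: gP; rewrite /= liftK.
  have [f [sf fo fu]] := step_solvable gP sf1.
  exists f; split=> //; first by rewrite -f1e -fo.
  move=> f' sf' f'e; apply: fu => //; apply: f1u => //; exact: step_sol_old.
by rewrite step_chi ?fc.
Qed.

Lemma step_extends : extends r old.
Proof. by move=> M f; apply: step_sol_old. Qed.

Lemma step_value (M : nmod Lam) (f : 'I_(pn step_pencil) -> M) b : sol0 r f -> b \in hB z ->
  newval f b = \sum_(a <- hA z) rph r z b a $* ev (f \o old) (c a).
Proof.
by move=> sf bB; rewrite (newval_solved sf bB); apply: eq_bigr => a _; rewrite subr0.
Qed.

End Step.

End FreePencils.

Section Linearization.
Variables (K : fieldType) (H : hypergraph).
Local Notation X := (hvtx H).
Local Notation S := (hslot H).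
Local Notation Lam := (hyper_alg K H).
Local Notation r := (hyper_rep K H).
Local Notation pencil := (pencil K X S (hyp H)).
Variables (n0 : nat) (lb0 : 'I_n0 -> X).

Lemma extends_comp (Q Q' Q'' : pencil) (k : 'I_(pn Q) -> 'I_(pn Q')) (k' : 'I_(pn Q') -> 'I_(pn Q'')) :
  extends r k -> extends r k' -> extends r (k' \o k).
Proof. by move=> e e' M f /e'/e. Qed.

(** Induction on [lam]. A letter [HPhi] takes one step, a letter [HPsi] the same step over the
    swapped hypergraph. In a product the right factor is treated first, and the left one is applied
    to the combination that represents its result. *)
Lemma term_step (lam : Lam) (Q : pencil) (emb : 'I_n0 -> 'I_(pn Q)) (y : 'I_(pn Q) -> K) :
  free_over r lb0 emb ->
  exists (Q' : pencil) (k : 'I_(pn Q) -> 'I_(pn Q')) y',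
    [/\ free_over r lb0 (k \o emb), extends r k &
        forall (M : nmod Lam) (f : 'I_(pn Q') -> M), sol0 r f -> ev f y' = lam $* ev (f \o k) y].
Proof.
have ev_emb (M : nmod Lam) n n' (k : 'I_n -> 'I_n') (f : 'I_n' -> M) y1 :
    ev f (push (fun i i' => (k i == i')%:R) y1) = ev (f \o k) y1.
  by rewrite -ev_pull; apply: eq_bigr => i _; rewrite /pull ev_delta.
elim/presented_ind: lam Q emb y => [x||a b IHa IHb|a IHa|c a IHa|a b IHa IHb] Q emb y fo.
- case: x => [x|z b a|z a b].
  + exists Q, id, (msk (plab Q) x y); split=> // M f [lf _].
    by rewrite -(rX_ev _ _ lf).
  + have [/andP[bB aA]|out] := boolP ((b \in hB z) && (a \in hA z)); last first.
      exists Q, id, (fun=> 0); split=> // M f _; rewrite ev0 [pres_class _ _](rph_out K out).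
      by rewrite nact0l.
    (* The new vector has [y] in the slot [a] and 0 in the other A-slots, so its B-component at [b]
       is [rph z b a] applied to [y]. *)
    pose c s : 'I_(pn Q) -> K := if a == s then y else fun=> 0.
    exists (step_pencil z c), (old z c), (pb (step_pencil z c) ord0 b); split.
    * exact: step_free.
    * exact: step_extends.
    * move=> M f sf; rewrite ev_new (step_value sf bB).
      rewrite -[RHS](@big_pick _ _ (hA z) a (fun a' => rph r z b a' $* ev (f \o old z c) y)) ?hA_uniq //.
      apply: eq_bigr => a' _; rewrite /c; case: eqP => // _; by rewrite ev0 nact0r.
  + have [/andP[aA bB]|out] := boolP ((a \in hA z) && (b \in hB z)); last first.
      exists Q, id, (fun=> 0); split=> // M f _; rewrite ev0 [pres_class _ _](rps_out K out).
      by rewrite nact0l.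
    pose c s : 'I_(pn (pswap Q)) -> K := if b == s then y else fun=> 0.
    pose Q1 := @step_pencil K (hswap H) (pswap Q) z c.
    exists (pswap Q1), (@old K (hswap H) (pswap Q) z c), (pb Q1 ord0 a); split.
    * apply: free_over_unswap; apply: (@step_free K Lam (hswap H) (rswap r)).
      exact: free_over_swap.
    * move=> M f /sol0_unswap sf; apply/sol0_swap.
      exact: (@step_extends K Lam (hswap H) (rswap r) (pswap Q) z c).
    * move=> M f /sol0_unswap sf.
      rewrite [LHS](@ev_new K Lam (hswap H) (pswap Q) z c).
      rewrite (@step_value K Lam (hswap H) (rswap r) (pswap Q) z c M f a sf aA).
      rewrite -[RHS](@big_pick _ _ (hB z) b (fun b' => rps r z a b' $* ev (f \o @old K (hswap H) (pswap Q) z c) y)) ?hB_uniq //.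
      apply: eq_bigr => b' _; rewrite /c; case: eqP => // _; by rewrite ev0 nact0r.
- exists Q, id, (fun=> 0); split=> // M f _; by rewrite ev0 nact0l.
- have [Q1 [k1 [y1 [fo1 e1 y1E]]]] := IHa Q emb y fo.
  have [Q2 [k2 [y2 [fo2 e2 y2E]]]] := IHb Q1 (k1 \o emb) (push (fun i i' => (k1 i == i')%:R) y) fo1.
  exists Q2, (k2 \o k1), (fun i => push (fun i i' => (k2 i == i')%:R) y1 i + y2 i); split=> //.
    exact: extends_comp e1 e2.
  move=> M f sf; rewrite evD ev_emb nactDl y2E // ev_emb y1E //.
  exact: e2.
- have [Q1 [k1 [y1 [fo1 e1 y1E]]]] := IHa Q emb y fo.
  exists Q1, k1, (fun i => - y1 i); split=> // M f sf; by rewrite evN y1E // nactNl.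
- have [Q1 [k1 [y1 [fo1 e1 y1E]]]] := IHa Q emb y fo.
  exists Q1, k1, (fun i => c * y1 i); split=> // M f sf; by rewrite evZ y1E // nactZl.
- have [Q1 [k1 [y1 [fo1 e1 y1E]]]] := IHb Q emb y fo.
  have [Q2 [k2 [y2 [fo2 e2 y2E]]]] := IHa Q1 (k1 \o emb) y1 fo1.
  exists Q2, (k2 \o k1), y2; split=> //; first exact: extends_comp e1 e2.
  by move=> M f sf; rewrite y2E // y1E ?nactM //; apply: e2.
Qed.

Lemma free_pencil : exists Q (emb : 'I_n0 -> 'I_(pn Q)), free_over r lb0 emb.
Proof.
have no (T : Type) (j : 'I_0) : T by case: j.
exists (@Pencil K X S (hyp H) n0 lb0 0 (@no _) (fun _ _ _ => 0) (fun _ _ _ => 0)), id.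
split=> // [M f0 lf0 g _|D xi _]; last by rewrite /chi [X in _ - X]big_ord0 subr0.
by exists f0; split=> //; split=> // -[].
Qed.

Lemma linearize_row (s : seq 'I_n0) (F : 'I_n0 -> Lam) (Q : pencil) (emb : 'I_n0 -> 'I_(pn Q)) :
  free_over r lb0 emb ->
  exists (Q' : pencil) (k : 'I_(pn Q) -> 'I_(pn Q')) y,
    [/\ free_over r lb0 (k \o emb), extends r k &
        forall (M : nmod Lam) (f : 'I_(pn Q') -> M), sol0 r f ->
          ev f y = \sum_(j <- s) F j $* f (k (emb j))].
Proof.
have ev_emb (M : nmod Lam) n n' (k : 'I_n -> 'I_n') (f : 'I_n' -> M) y1 :
    ev f (push (fun i i' => (k i == i')%:R) y1) = ev (f \o k) y1.
  by rewrite -ev_pull; apply: eq_bigr => i _; rewrite /pull ev_delta.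
elim: s Q emb => [|j s IH] Q emb fo.
  by exists Q, id, (fun=> 0); split=> // M f _; rewrite big_nil ev0.
have [Q1 [k1 [y1 [fo1 e1 y1E]]]] := term_step (F j) (fun i => (emb j == i)%:R) fo.
have [Q2 [k2 [y2 [fo2 e2 y2E]]]] := IH Q1 _ fo1.
exists Q2, (k2 \o k1), (fun i => push (fun i i' => (k2 i == i')%:R) y1 i + y2 i); split=> //.
  exact: extends_comp e1 e2.
move=> M f sf; rewrite evD ev_emb big_cons y2E // y1E ?ev_delta //.
exact: e2.
Qed.

Lemma linearize p (U : 'I_p -> 'I_n0 -> Lam) : exists (Q : pencil) (emb : 'I_n0 -> 'I_(pn Q)) y,
  free_over r lb0 emb /\ forall (M : nmod Lam) (f : 'I_(pn Q) -> M), sol0 r f ->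
    forall i, ev f (y i) = \sum_j U i j $* f (emb j).
Proof.
elim: p U => [|p IH] U.
  have [Q [emb fo]] := free_pencil; exists Q, emb, (fun _ _ => 0).
  by split=> // M f _ -[].
have [Q [emb [y [fo yE]]]] := IH (fun i => U (fintype.lift ord0 i)).
have [Q' [k [y0 [fo' e' y0E]]]] := linearize_row (index_enum 'I_n0) (U ord0) fo.
exists Q', (k \o emb), (fun i => if unlift ord0 i is Some i'
  then push (fun i i' => (k i == i')%:R) (y i') else y0); split=> // M f sf i.
case: unliftP => [i' ->|->]; last exact: y0E.
rewrite -ev_pull -[RHS](yE _ _ (e' _ _ sf)); apply: eq_bigr => l _; by rewrite /pull ev_delta.
Qed.

(* Linearizing U and killing the rows of U gives an acyclic pencil, whose     *)
(* Euler characteristic is the difference of the two sides.                   *)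
Lemma invertible_balanced p (la : 'I_p -> X) (U : 'I_p -> 'I_n0 -> Lam) (V : 'I_n0 -> 'I_p -> Lam)
    (D : zmodType) (xi : X -> D) :
  balanced xi ->
  (forall i i', \sum_j U i j ** V j i' = if i == i' then rX r (la i) else 0) ->
  (forall j j', \sum_i V j i ** U i j' = if j == j' then rX r (lb0 j) else 0) ->
  (forall i j, rX r (la i) ** U i j = U i j) -> (forall j i, rX r (lb0 j) ** V j i = V j i) ->
  \sum_i xi (la i) = \sum_j xi (lb0 j).
Proof.
move=> bal UV VU lU lV; have [Q [emb [y [fo yE]]]] := linearize U.
have [n' [sec [T [kT sumT]]]] := kill_exists r (enum 'I_p) la y (plab Q).
have rhs0 (M : nmod Lam) : @rhs K H Lam r M Q (fun _ _ => 0) by move=> j a _; rewrite nact0r.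
(* Giving the free variables the value [V mu] makes the rows of [U] take the value [mu]. *)
have solve (M : nmod Lam) (mu : 'I_p -> M) : (forall i, rX r (la i) $* mu i = mu i) ->
    exists f : 'I_(pn Q) -> M, sol0 r f /\ forall i, ev f (y i) = mu i.
  move=> lmu; have [|f [sf fe _]] := fo_sol fo (f0 := fun j => \sum_i V j i $* mu i) _ (rhs0 M).
    by move=> j; rewrite nact_sumr; apply: eq_bigr => i _; rewrite -nactM lV.
  exists f; split=> // i; rewrite yE //.
  under eq_bigr => j _ do rewrite -[f (emb j)]/((f \o emb) j) fe nact_sumr.
  rewrite exchange_big /= (bigD1 i) //= [X in _ + X]big1 => [|i' ii].
    rewrite addr0; under eq_bigr do rewrite -nactM.
    by rewrite -nact_suml UV eqxx lmu.
  under eq_bigr do rewrite -nactM.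
  by rewrite -nact_suml UV eq_sym (negbTE ii) nact0l.
pose Q' := @qpencil K H Q n' sec T (pm Q) id.
have labE (M : nmod Lam) (f : 'I_(pn Q) -> M) i : sol0 r f -> rX r (la i) $* ev f (y i) = ev f (y i).
  by move=> sf; rewrite yE // nact_sumr; apply: eq_bigr => j _; rewrite -nactM lU.
have solT (M : nmod Lam) (g : 'I_(pm Q) -> S -> M) (f' : 'I_n' -> M) :
    @sol K H Lam r M Q' g f' -> @sol K H Lam r M Q g (pull T f').
  move=> [lf fg]; split; first by apply: (pull_labelled kT); exact: lf.
  by move=> j a aA; rewrite -(@del_qpencil K H Lam r M Q n' sec T _ id) fg.
(* If all rows of [U] vanish on a homogeneous solution, then so do its free variables, because [V U]
   is the identity. *)
have inj0 (M : nmod Lam) (f : 'I_(pn Q) -> M) : sol0 r f -> (forall i, ev f (y i) = 0) -> f = fun=> 0.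
  move=> sf f0; have fe0 : f \o emb = fun=> 0.
    apply/funext => j /=; have <- : rX r (lb0 j) $* f (emb j) = f (emb j).
      by rewrite -(fo_lab fo); case: sf => lf _; apply: lf.
    transitivity (\sum_i V j i $* ev f (y i)); last by rewrite big1 // => i _; rewrite f0 nact0r.
    under eq_bigr do rewrite (yE _ _ sf) nact_sumr.
    rewrite exchange_big /= (bigD1 j) //= [X in _ + X]big1 => [|j' jj].
      by rewrite addr0; under eq_bigr do rewrite -nactM; rewrite -nact_suml VU eqxx.
    by under eq_bigr do rewrite -nactM; rewrite -nact_suml VU eq_sym (negbTE jj) nact0l.
  have [f1 [_ _ fu]] := fo_sol fo (@labelled0 K H Lam r M n0 lb0) (rhs0 M).
  rewrite (fu f) //; apply/esym/fu; [exact: sol0_0|by []].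
(* A solution over the free pencil is corrected by a homogeneous one with the same rows of [U]; the
   difference satisfies the killed relations and descends to [Q']. *)
have aQ' : acyclic r Q'.
  move=> M g gP.
  have [f1 [sf1 _ _]] := fo_sol fo (@labelled0 K H Lam r M n0 lb0) gP.
  have [|f2 [sf2 f2E]] := solve M (fun i => rX r (la i) $* ev f1 (y i)).
    by move=> i; rewrite rX_act eqxx.
  have sf := sol_sub0 sf1 sf2; set f := (fun k => f1 k - f2 k) in sf.
  have f0 i : i \in enum 'I_p -> rX r (la i) $* ev f (y i) = 0.
    by move=> _; rewrite /f evfB nactBr f2E rX_act eqxx subrr.
  have fE : f = pull T (f \o sec) by apply: (kill_all kT) => //; case: sf.
  exists (f \o sec); split.
    split=> [k|j a aA]; first by case: sf => lf _; apply: lf.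
    by rewrite (@del_qpencil K H Lam r M Q n' sec T _ id) -fE; case: sf => _; apply.
  move=> f' sf'; have d0 := sol0_diff (solT _ _ _ sf') sf.
  have pE : pull T f' = f.
    have dE : (fun k => pull T f' k - f k) = fun=> 0.
      apply: inj0 => // i; rewrite -labE // evfB nactBr f0 ?mem_enum //.
      by rewrite (pull_zero kT) ?mem_enum ?subrr //; case: sf'.
    by apply/funext => k; apply/eqP; rewrite -subr_eq0; apply/eqP/(congr1 (fun F => F k) dE).
  by rewrite -pE (pull_sec kT).
have [M0 sp] := spacious_exists K H.
(* The Euler characteristic of [Q] is the sum over [lb0]; killing the rows subtracts the sum over
   [la], and what remains is 0. *)
have := acyclic_chi bal aQ'; have := fo_chi fo bal.
rewrite /chi /= (sumT M0) ?enum_uniq //; last first.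
  move=> mu lmu; have [|f [[lf _] fE]] := solve M0 mu.
    by move=> i; apply: lmu; rewrite mem_enum.
  by exists f; split=> // i _; rewrite fE lmu ?mem_enum.
rewrite big_enum /= => <- /eqP; rewrite subr_eq0 => /eqP ->.
by rewrite addrAC subrr add0r.
Qed.

End Linearization.

(** * Resolutions of idempotents *)

Section RowModules.
Variables (K : fieldType) (A : nuAlgType K) (U : finType).

(** Right multiplication by a matrix is a homomorphism between these modules of rows ([rmul]), so
    unique solvability in them yields identities between matrices. *)
Definition rowmod : nmod A.
Proof.
refine (@NMod K A (U -> A) (fun a m u => a ** m u) _ _ _ _ _).
- by move=> a b m; apply/funext => u; apply: numulDl.
- by move=> a m m'; apply/funext => u; apply: numulDr.
- by move=> k a m; apply/funext => u; apply/esym/nuscaleAl.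
- by move=> k a m; apply/funext => u; apply/esym/nuscaleAr.
- by move=> a b m; apply/funext => u; apply/esym/numulA.
Defined.

End RowModules.

Section RightMultiplication.
Variables (K : fieldType) (A : nuAlgType K) (U V : finType) (C : U -> V -> A).

Definition rmul : nhom (rowmod A U) (rowmod A V).
Proof.
refine (@NHom K A (rowmod A U) (rowmod A V) (fun m v => \sum_u m u ** C u v) _ _ _).
- move=> m m'; apply/funext => v; rewrite -[RHS]/(\sum_u m u ** C u v + \sum_u m' u ** C u v).
  by rewrite -big_split; apply: eq_bigr => u _; apply: numulDl.
- move=> k m; apply/funext => v; rewrite -[RHS]/(k *: \sum_u m u ** C u v).
  by rewrite scaler_sumr; apply: eq_bigr => u _; rewrite nuscaleAl.
- move=> a m; apply/funext => v; rewrite -[RHS]/(a ** \sum_u m u ** C u v).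
  by rewrite numul_sumr; apply: eq_bigr => u _; rewrite numulA.
Defined.

Lemma rmulE m v : rmul m v = \sum_u m u ** C u v. Proof. by []. Qed.

End RightMultiplication.

Lemma tagged_seq_sub_inj (I : Type) (T : choiceType) (F : I -> seq T) (x y : {i & seq_sub (F i)}) :
  tag x = tag y -> ssval (tagged x) = ssval (tagged y) -> x = y.
Proof.
by case: x y => i x [j y] /= ij; case: _ / ij in y * => /val_inj ->.
Qed.

Section Resolution.
Variables (K : fieldType) (H : hypergraph).
Local Notation X := (hvtx H).
Local Notation S := (hslot H).
Local Notation Lam := (hyper_alg K H).
Local Notation r := (hyper_rep K H).
Local Notation pencil := (pencil K X S (hyp H)).
Variables (n0 : nat) (lb0 : 'I_n0 -> X) (e : 'I_n0 -> 'I_n0 -> Lam).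
Hypothesis e_idem : forall i j, \sum_k e i k ** e k j = e i j.
Hypothesis e_lab : forall i j, rX r (lb0 i) ** e i j = e i j.

(** Linearize [e] on free variables, impose [e p = p] by killing the relations [y i - emb i], and
    reduce to an injective pencil. *)
Lemma presentation_exists : exists (Q : pencil) (eta : 'I_n0 -> 'I_(pn Q) -> K),
  [/\ Ainj Q, Binj Q & presents lb0 e eta].
Proof.
have [Q1 [emb [y [fo yE]]]] := linearize lb0 e.
pose y' i : 'I_(pn Q1) -> K := fun k => y i k - (emb i == k)%:R.
have [n' [sec [T [kT _]]]] := kill_exists r (enum 'I_n0) lb0 y' (plab Q1).
pose Q2 := @qpencil K H Q1 n' sec T (pm Q1) id.
suff [eta pr] : exists eta : 'I_n0 -> 'I_(pn Q2) -> K, presents lb0 e eta.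
  have [Q [AQ BQ red]] := reduces_inj r Q2.
  by have [eta' pr'] := presents_reduces red pr; exists Q, eta'.
have evy' (M : nmod Lam) (f : 'I_(pn Q1) -> M) i : ev f (y' i) = ev f (y i) - f (emb i).
  by rewrite -ev_delta -evN -evD.
have lab_emb (M : nmod Lam) (f : 'I_(pn Q1) -> M) i : sol0 r f -> rX r (lb0 i) $* f (emb i) = f (emb i).
  by move=> [lf _]; rewrite -(fo_lab fo).
have solT (M : nmod Lam) (f' : 'I_n' -> M) : @sol0 K H Lam r M Q2 f' -> @sol0 K H Lam r M Q1 (pull T f').
  move=> [lf fg]; split; first by apply: (pull_labelled kT); exact: lf.
  by move=> j a aA; rewrite -(@del_qpencil K H Lam r M Q1 n' sec T _ id) fg.
exists (fun i => push T (fun k => (emb i == k)%:R)).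
have valE (M : nmod Lam) (f' : 'I_n' -> M) : @sol0 K H Lam r M Q2 f' ->
    val_at lb0 (fun i => push T (fun k => (emb i == k)%:R)) f' = pull T f' \o emb.
  move=> sf'; apply/funext => i; rewrite /val_at -ev_pull ev_delta lab_emb //; exact: solT.
split=> [M f' sf'|M p ep].
  rewrite valE //; apply/funext => i; have sF := solT _ _ sf'.
  have := @pull_zero _ _ _ _ _ _ _ _ _ _ _ _ _ kT M f' i (proj1 sf') (mem_enum _ _).
  rewrite evy' nactBr lab_emb // yE // nact_sumr => /eqP; rewrite subr_eq0 => /eqP E.
  rewrite -[RHS]/(pull T f' (emb i)) -E.
  by apply: eq_bigr => j _; rewrite -nactM e_lab.
have lp : labelled r lb0 p.
  move=> i; rewrite -ep /eact nact_sumr; apply: eq_bigr => j _; by rewrite -nactM e_lab.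
have [|f1 [sf1 f1e f1u]] := fo_sol fo lp (g := fun _ _ => 0).
  by move=> j a _; rewrite nact0r.
have f1E : f1 = pull T (f1 \o sec).
  apply: (kill_all kT); first by case: sf1.
  move=> i _; rewrite evy' yE // -[f1 (emb i)]/((f1 \o emb) i).
  under eq_bigr => j _ do rewrite -[f1 (emb j)]/((f1 \o emb) j).
  by rewrite f1e -[X in X - _]/(eact e p i) ep subrr nact0r.
have sf2 : @sol0 K H Lam r M Q2 (f1 \o sec).
  split=> [k|j a aA]; first by case: sf1 => lf _; apply: lf.
  by rewrite (@del_qpencil K H Lam r M Q1 n' sec T _ id) -f1E; case: sf1 => _; apply.
exists (f1 \o sec); split=> //; first by rewrite valE // -f1E.
move=> f' sf' f'p; rewrite -(f1u (pull T f')) ?(pull_sec kT) //; first exact: solT.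
by rewrite -valE.
Qed.

Definition diag (I : finType) (l : I -> X) : I -> I -> Lam :=
  fun i j => if i == j then rX r (l i) else 0.

(** A Yoneda argument: [presents_unique_solution] is a natural bijection between labelled families
    [f] and pairs [(g, p)]. The matrix [R] is the family that belongs to the universal pair, [C] the
    pair that belongs to the universal family [fa], and uniqueness makes them mutually inverse. Thus
    [e] plus the labels of the equations equals the labels of the variables. *)
Lemma idempotent_resolution :
  exists (n : nat) (l : 'I_n -> X) (J : finType) (lj : J -> X)
    (R : 'I_n -> 'I_n0 + J -> Lam) (C : 'I_n0 + J -> 'I_n -> Lam),
  [/\ forall k u, rX r (l k) ** R k u = R k u,
      forall u k, rX r (match u with inl i => lb0 i | inr j => lj j end) ** C u k = C u k,
      fmul R C = diag l & fmul C R = fblock e (diag lj)].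
Proof.
have [Q [eta [AQ BQ pr]]] := presentation_exists.
have us := presents_unique_solution e_idem AQ BQ pr.
pose J : finType := {j : 'I_(pm Q) & seq_sub (hA (pz Q j))}.
pose lj (x : J) := hlab (ssval (tagged x)).
pose U : finType := ('I_n0 + J)%type; pose n := pn Q.
(* The universal pair: together, [p] and [g] are the rows of the idempotent [fblock e (diag lj)]. *)
pose g j a : rowmod Lam U := fun u => match u with
  | inl _ => 0
  | inr x => if (tag x == j) && (ssval (tagged x) == a) then rX r (hlab a) else 0 end.
pose p i : rowmod Lam U := fun u => match u with inl j => e i j | inr _ => 0 end.
have gP : rhs r g.
  move=> j a aA; apply/funext => -[i|x]; rewrite /= ?numulr0 //.
  by case: ifP; rewrite ?numulr0 // (rXX r) eqxx.
have pP : eact e p = p.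
  apply/funext => i; rewrite /eact; apply/funext => u; rewrite sumfE.
  by case: u => [j|x] /=; rewrite ?e_idem // big1 // => j _; rewrite numulr0.
have [R [[lR sR] eR _]] := us _ g p gP pP.
pose fa k : rowmod Lam 'I_n := fun k' => if k == k' then rX r (plab Q k) else 0.
have lfa : labelled r (plab Q) fa.
  move=> k; apply/funext => k'; rewrite /fa /=; case: eqP => _; last by rewrite numulr0.
  by rewrite (rXX r) eqxx.
pose s := eact e (val_at lb0 eta fa).
pose ga j a := del r fa j a.
have gaP : rhs r ga.
  move=> j a aA; rewrite /ga /del nactBr rX_act eqxx nact_sumr; congr (_ - _).
  by apply: eq_bigr => b _; rewrite -nactM (rpsl r).
pose C (u : U) : 'I_n -> Lam := match u with inl i => s i | inr x => ga (tag x) (ssval (tagged x)) end.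
have rfa : rmul R \o fa = R.
  apply/funext => k; apply/funext => u; rewrite -[LHS]/(\sum_k' fa k k' ** R k' u) /fa (bigD1 k) //= eqxx big1 ?addr0.
    exact: (congr1 (fun F => F u) (lR k)).
  by move=> k' kk; rewrite eq_sym (negbTE kk) numul0r.
have val_nhom (M N : nmod Lam) (h : nhom M N) (f : 'I_n -> M) i :
    h (val_at lb0 eta f i) = val_at lb0 eta (h \o f) i.
  by rewrite /val_at nhomA nhom_ev.
have rs i : rmul R (s i) = p i.
  rewrite /s nhom_eact -eR; congr (eact e _ i); apply/funext => k.
  by rewrite -[LHS]/(rmul R (val_at lb0 eta fa k)) val_nhom rfa.
have del_nhom (M N : nmod Lam) (h : nhom M N) (f : 'I_n -> M) j a :
    h (del r f j a) = @del K H Lam r N Q (h \o f) j a.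
  rewrite /del nhomB nhomA nhom_ev nhom_sum; congr (_ - _).
  by apply: eq_bigr => b _; rewrite nhomA nhom_ev.
have rg j a : a \in hA (pz Q j) -> rmul R (ga j a) = g j a.
  by move=> aA; rewrite /ga del_nhom rfa sR.
have sE : eact e s = s by rewrite /s eactK.
have [fb [_ _ fbu]] := us _ ga s gaP sE.
have faE : fa = fb by apply: fbu.
have cg j a : a \in hA (pz Q j) -> rmul C (g j a) = ga j a.
  move=> aA; apply/funext => k; rewrite rmulE big_sumType /= big1 ?add0r => [|i _]; last by rewrite numul0r.
  pose x0 : J := Tagged (fun j => seq_sub (hA (pz Q j))) (SeqSub aA).
  rewrite (bigD1 x0) //= !eqxx /= big1 ?addr0.
    exact: (congr1 (fun F => F k) (gaP j a aA)).
  move=> x xx0; case: ifP => [/andP[/eqP xj /eqP xa]|_]; last by rewrite numul0r.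
  by case/eqP: xx0; apply: tagged_seq_sub_inj.
have cp i : rmul C (p i) = s i.
  apply/funext => k; rewrite rmulE big_sumType /= [X in _ + X]big1 ?addr0 => [|x _]; last by rewrite numul0r.
  by rewrite -[in RHS]sE /eact sumfE.
have rcE : rmul C \o R = fa.
  rewrite faE; apply: fbu.
    split=> [k|j a aA]; first by rewrite -[X in _ $* X]/(rmul C (R k)) -nhomA lR.
    by rewrite -del_nhom sR // cg.
  apply/funext => i; have -> : val_at lb0 eta (rmul C \o R) = rmul C \o val_at lb0 eta R.
    by apply/funext => k; rewrite -[RHS]/(rmul C (val_at lb0 eta R k)) val_nhom.
  by rewrite -nhom_eact eR cp.
exists n, (plab Q), J, lj, R, C; split.
- by move=> k u; exact: (congr1 (fun F => F u) (lR k)).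
- move=> [i|x] k /=.
    rewrite /s /eact sumfE numul_sumr; apply: eq_bigr => j _.
    by rewrite /= numulA e_lab.
  exact: (congr1 (fun F => F k) (gaP _ _ (ssvalP (tagged x)))).
- by apply/funext => k; apply/funext => k'; exact: (congr1 (fun F => F k k') rcE).
- apply/funext => u; apply/funext => v; rewrite /fmul; case: u => [i|x].
    rewrite -[LHS]/(rmul R (s i) v) rs; by case: v.
  rewrite -[LHS]/(rmul R (ga (tag x) (ssval (tagged x))) v) rg ?ssvalP //.
  case: v => [//|y]; rewrite /= /diag /lj; case: (eqVneq x y) => [->|xy]; first by rewrite !eqxx.
  case: ifP => // /andP[/eqP yx /eqP ya]; case/eqP: xy.
  exact: tagged_seq_sub_inj.
Qed.

End Resolution.

Lemma bigmax_seq_attained (T : eqType) (s : seq T) (F : T -> nat) :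
  (0 < \max_(x <- s) F x)%N -> exists2 x, x \in s & F x = \max_(x <- s) F x.
Proof.
elim: s => [|x s IH]; first by rewrite big_nil.
rewrite big_cons; case: (leqP (F x) (\max_(y <- s) F y)) => h.
  by move=> /IH[y ys <-]; exists y; rewrite // inE ys orbT.
by move=> _; exists x; rewrite // inE eqxx.
Qed.

(** * The hypergraph of a weighted graph *)

Section GraphHypergraph.
Variables (K : fieldType) (E : weighted_graph).
Hypothesis hE : row_finite E.
Local Notation w v := (@vertex_weight E v).
Local Notation vert := (vertex E).

Lemma mem_out v (e : edge E) : (e \in out_edges v) = (esource e == v).
Proof.
rewrite /out_edges in_fset_set; last exact: hE.
by apply/idP/eqP; rewrite inE.
Qed.

Lemma out_uniq (v : vert) : uniq (out_edges v).
Proof. exact: fset_uniq. Qed.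

Lemma weight_le (e : edge E) : (weight e <= w (esource e))%N.
Proof. by apply: leq_bigmax_seq => //; rewrite mem_out. Qed.

Definition gobj : choiceType := (vert + vert * nat)%type.
Definition gslot : choiceType := (gobj + edge E)%type.
Definition gedge : choiceType := {z : vert * nat | (z.2 < w z.1)%N}.

(* The object inr (v, k) is q(v, k), which vanishes for k = 0 and k = w(v)    *)
(* and therefore gets no slot there; the edge of ghyp labelled (v, k) splits  *)
(* k + 1 copies of v.                                                         *)
Definition sv (v : vert) : gslot := inl (inl v).
Definition sq (v : vert) (k : nat) : gslot := inl (inr (v, k)).
Definition glab (s : gslot) : gobj := match s with inl x => x | inr e => inl (erange e) end.

Definition slotsA (v : vert) (k : nat) : seq gslot :=
  sv v :: (if (0 < k)%N then [:: sq v k] else [::]).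
Definition slotsB (v : vert) (k : nat) : seq gslot :=
  [seq inr e | e <- out_edges v & weight e == k.+1] ++ (if (k.+1 < w v)%N then [:: sq v k.+1] else [::]).

Lemma slotsA_uniq v k : uniq (slotsA v k).
Proof. by rewrite /slotsA; case: ifP. Qed.

Lemma slotsB_uniq v k : uniq (slotsB v k).
Proof.
rewrite cat_uniq map_inj_uniq ?filter_uniq ?out_uniq //=; last by move=> ? ? [].
case: ifP => //= _; rewrite orbF andbT; apply/mapP => -[e _]; discriminate.
Qed.

(** For [k + 1 = w v] the slot of q(v, k + 1) is missing, but then some edge attains the maximal
    weight. *)
Lemma slotsB_neq0 v k : (k < w v)%N -> exists b, b \in slotsB v k.
Proof.
move=> kw; case: (ltnP k.+1 (w v)) => h.
  by exists (sq v k.+1); rewrite mem_cat h inE eqxx orbT.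
have [|e eo ew] := @bigmax_seq_attained _ (out_edges v) weight; first exact: leq_ltn_trans kw.
exists (inr e); rewrite mem_cat; apply/orP; left; apply/map_f.
by rewrite mem_filter eo andbT ew eqn_leq h.
Qed.

Definition ghyp : hypergraph := @Hypergraph gobj gslot gedge glab
  (fun z => slotsA (val z).1 (val z).2) (fun z => slotsB (val z).1 (val z).2)
  (fun z => slotsA_uniq _ _) (fun z => slotsB_uniq _ _)
  (fun z => ex_intro _ (sv (val z).1) (mem_head _ _)) (fun z => slotsB_neq0 (valP z)).

Local Notation Lam := (hyper_alg K ghyp).
Local Notation r := (hyper_rep K ghyp).

Definition XX (x : gobj) : Lam := rX r x.
(** Zero for [k >= w v], so that the recursions on [k] below carry no bound. *)
Definition PS v k a b : Lam := if insub (v, k) is Some z then rps r (z : gedge) a b else 0.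
Definition PH v k b a : Lam := if insub (v, k) is Some z then rph r (z : gedge) b a else 0.

Lemma PSE v k a b (kw : (k < w v)%N) : PS v k a b = rps r (Sub (v, k) kw : gedge) a b.
Proof. by rewrite /PS insubT. Qed.

Lemma PHE v k a b (kw : (k < w v)%N) : PH v k a b = rph r (Sub (v, k) kw : gedge) a b.
Proof. by rewrite /PH insubT. Qed.

Lemma PSl v k a b : XX (glab a) ** PS v k a b = PS v k a b.
Proof. by rewrite /PS; case: insubP => *; rewrite ?numulr0 // (rpsl r). Qed.
Lemma PSr v k a b : PS v k a b ** XX (glab b) = PS v k a b.
Proof. by rewrite /PS; case: insubP => *; rewrite ?numul0r // (rpsr r). Qed.
Lemma PHl v k a b : XX (glab b) ** PH v k b a = PH v k b a.
Proof. by rewrite /PH; case: insubP => *; rewrite ?numulr0 // (rphl r). Qed.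
Lemma PHr v k a b : PH v k b a ** XX (glab a) = PH v k b a.
Proof. by rewrite /PH; case: insubP => *; rewrite ?numul0r // (rphr r). Qed.

Lemma PS_out v k a b : b \notin slotsB v k -> PS v k a b = 0.
Proof.
rewrite /PS; case: insubP => // z _ zE bB; apply: (rps_out K (H := ghyp)).
by rewrite /= zE /= (negbTE bB) andbF.
Qed.

Lemma PSPH v k a a' : (k < w v)%N -> a \in slotsA v k -> a' \in slotsA v k ->
  \sum_(b <- slotsB v k) PS v k a b ** PH v k b a' = if a == a' then XX (glab a) else 0.
Proof.
move=> kw aA a'A; under eq_bigr do rewrite PSE PHE.
exact: (@rpsph _ _ _ r (Sub (v, k) kw)).
Qed.

Lemma PHPS v k b b' : (k < w v)%N -> b \in slotsB v k -> b' \in slotsB v k ->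
  PH v k b (sv v) ** PS v k (sv v) b'
  + (if (0 < k)%N then PH v k b (sq v k) ** PS v k (sq v k) b' else 0)
  = if b == b' then XX (glab b) else 0.
Proof.
move=> kw bB b'B; have := @rphps _ _ _ r (Sub (v, k) kw) b b' bB b'B.
rewrite /= /slotsA big_cons !PHE !PSE => <-; congr (_ + _).
by case: ifP => _; rewrite ?big_seq1 // big_nil.
Qed.

(** The first [k] steps compose to an isomorphism from [k] copies of [v], numbered from 0, to q(v,
    k) plus the r(e), e of weight at most [k]. Its entries between the copy [i] and q(v, k), and
    those of its inverse, are [comp_row v i k] and [comp_col v i k]; the entries at the slots split
    off by the next step are [rho] and [gam]. *)
Fixpoint comp_row (v : vert) (i k : nat) : Lam :=
  if k is k'.+1 then if i == k' then PS v k' (sv v) (sq v k)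
    else comp_row v i k' ** PS v k' (sq v k') (sq v k) else 0.
Fixpoint comp_col (v : vert) (i k : nat) : Lam :=
  if k is k'.+1 then if i == k' then PH v k' (sq v k) (sv v)
    else PH v k' (sq v k) (sq v k') ** comp_col v i k' else 0.

Definition rho v i k s : Lam := if i == k then PS v k (sv v) s else comp_row v i k ** PS v k (sq v k) s.
Definition gam v i k s : Lam := if i == k then PH v k s (sv v) else PH v k s (sq v k) ** comp_col v i k.

Lemma comp_rowS v i k : comp_row v i k.+1 = rho v i k (sq v k.+1). Proof. by []. Qed.
Lemma comp_colS v i k : comp_col v i k.+1 = gam v i k (sq v k.+1). Proof. by []. Qed.

Lemma comp_row0 v i k : (k <= i)%N -> comp_row v i k = 0.
Proof.
elim: k => // k IH ki /=; rewrite gtn_eqF // IH ?numul0r //; exact: ltnW.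
Qed.
Lemma comp_col0 v i k : (k <= i)%N -> comp_col v i k = 0.
Proof.
elim: k => // k IH ki /=; rewrite gtn_eqF // IH ?numulr0 //; exact: ltnW.
Qed.

Lemma rho0 v i k s : (k < i)%N -> rho v i k s = 0.
Proof. by move=> ki; rewrite /rho gtn_eqF // comp_row0 ?numul0r // ltnW. Qed.
Lemma gam0 v i k s : (k < i)%N -> gam v i k s = 0.
Proof. by move=> ki; rewrite /gam gtn_eqF // comp_col0 ?numulr0 // ltnW. Qed.

Lemma comp_row_l v i k : XX (inl v) ** comp_row v i k = comp_row v i k.
Proof.
elim: k => [|k IH] /=; first by rewrite numulr0.
by case: ifP => _; [exact: (PSl v k (sv v))|rewrite numulA IH].
Qed.
Lemma comp_col_r v i k : comp_col v i k ** XX (inl v) = comp_col v i k.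
Proof.
elim: k => [|k IH] /=; first by rewrite numul0r.
by case: ifP => _; [exact: (PHr v k (sv v))|rewrite -numulA IH].
Qed.
Lemma comp_col_l v i k : XX (inr (v, k)) ** comp_col v i k = comp_col v i k.
Proof.
case: k => [|k] /=; first by rewrite numulr0.
by case: ifP => _; rewrite ?numulA; [|congr (_ ** _)]; exact: (PHl v k _ (sq v k.+1)).
Qed.

Lemma rho_l v i k s : XX (inl v) ** rho v i k s = rho v i k s.
Proof. by rewrite /rho; case: ifP => _; [exact: (PSl v k (sv v))|rewrite numulA comp_row_l]. Qed.
Lemma rho_r v i k s : rho v i k s ** XX (glab s) = rho v i k s.
Proof. by rewrite /rho; case: ifP => _; rewrite ?PSr // -numulA PSr. Qed.
Lemma gam_l v i k s : XX (glab s) ** gam v i k s = gam v i k s.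
Proof. by rewrite /gam; case: ifP => _; rewrite ?PHl // numulA PHl. Qed.
Lemma gam_r v i k s : gam v i k s ** XX (inl v) = gam v i k s.
Proof. by rewrite /gam; case: ifP => _; [exact: (PHr v k (sv v))|rewrite -numulA comp_col_r]. Qed.

(** The sum over the B-slots turns [PS PH] into the identity on the A-slots. The copy [k] enters
    through [sv v] and the older copies through [sq v k], so the mixed terms vanish. *)
Lemma rho_gam_new v i j k : (k < w v)%N -> (i <= k)%N -> (j <= k)%N ->
  \sum_(s <- slotsB v k) rho v i k s ** gam v j k s =
  if (i == k) || (j == k) then (if i == j then XX (inl v) else 0) else comp_row v i k ** comp_col v j k.
Proof.
move=> kw ik jk; have svA : sv v \in slotsA v k by rewrite inE eqxx.
have sqA : (0 < k)%N -> sq v k \in slotsA v k by move=> k0; rewrite /slotsA k0 !inE eqxx orbT.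
rewrite /rho /gam; have [->|nik] := eqVneq i k; have [->|njk] := eqVneq j k; rewrite /=.
- by rewrite PSPH // !eqxx.
- rewrite ?(negbTE njk) ?[k == j]eq_sym ?(negbTE njk).
  under eq_bigr do rewrite numulA.
  have k0 : (0 < k)%N by case: (k) jk njk => //; case: (j).
  by rewrite -numul_suml PSPH ?sqA //= numul0r.
- rewrite ?(negbTE nik); under eq_bigr do rewrite -numulA.
  have k0 : (0 < k)%N by case: (k) ik nik => //; case: (i).
  by rewrite -numul_sumr PSPH ?sqA //= numulr0.
- have k0 : (0 < k)%N by case: (k) ik nik => //; case: (i).
  under eq_bigr do rewrite -numulA [X in _ ** X]numulA.
  by rewrite -numul_sumr -numul_suml PSPH ?sqA // eqxx comp_col_l.
Qed.

(** An edge of weight m is split off at step m - 1, and the copies that exist by then are those with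
    index below m; so the entries vanish from m on, as the convention for the [e_i] demands. *)
Definition rE (e : edge E) i := rho (esource e) i (weight e).-1 (inr e).
Definition gE (e : edge E) i := gam (esource e) i (weight e).-1 (inr e).

Lemma rE0 e i : (weight e <= i)%N -> rE e i = 0.
Proof. by move=> h; apply: rho0; rewrite prednK ?weight_gt0. Qed.
Lemma gE0 e i : (weight e <= i)%N -> gE e i = 0.
Proof. by move=> h; apply: gam0; rewrite prednK ?weight_gt0. Qed.

Lemma sum_slotsB (V : zmodType) v k (F : gslot -> V) :
  (~~ (k.+1 < w v)%N -> F (sq v k.+1) = 0) ->
  \sum_(s <- slotsB v k) F s = \sum_(e <- out_edges v | weight e == k.+1) F (inr e) + F (sq v k.+1).
Proof.
move=> F0; rewrite big_cat big_map big_filter; congr (_ + _).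
by case: ifP => h; rewrite ?big_seq1 // big_nil F0 ?h.
Qed.

Lemma sq_out v k : ~~ (k.+1 < w v)%N -> sq v k.+1 \notin slotsB v k.
Proof.
move=> h; rewrite mem_cat (negbTE h) orbF; apply/mapP => -[e _]; discriminate.
Qed.

(** One half of the invertibility of the composite isomorphism, by induction on the number of steps.
    For [k = w v] the term of q(v, k) is 0 and relation (iii) remains. *)
Lemma real_ghost_partial v k i j : (k <= w v)%N -> (i < k)%N -> (j < k)%N ->
  \sum_(e <- out_edges v | (weight e <= k)%N) rE e i ** gE e j + comp_row v i k ** comp_col v j k
  = if i == j then XX (inl v) else 0.
Proof.
elim: k => // k IH kw; rewrite !ltnS => ik jk.
have splitS : \sum_(e <- out_edges v | (weight e <= k.+1)%N) rE e i ** gE e j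
    = \sum_(e <- out_edges v | (weight e <= k)%N) rE e i ** gE e j
    + \sum_(e <- out_edges v | weight e == k.+1) rho v i k (inr e) ** gam v j k (inr e).
  rewrite (bigID (fun e => (weight e <= k)%N)) /=; congr (_ + _).
    by apply: eq_bigl => e; case: ltngtP => //; lia.
  rewrite big_seq_cond [RHS]big_seq_cond; apply: eq_big => [e|e].
    by congr (_ && _); rewrite -ltnNge eqn_leq.
  rewrite mem_out => /andP[/eqP <- wk]; rewrite /rE /gE.
  by have -> : (weight e).-1 = k by lia.
rewrite splitS -addrA comp_rowS comp_colS -(@sum_slotsB _ v k (fun s => rho v i k s ** gam v j k s)); last first.
  move=> h; have o := sq_out h; rewrite /rho; case: ifP => _; rewrite PS_out // ?numulr0 numul0r //.
rewrite rho_gam_new //; case: ifP => [/orP h|/norP[ik' jk']].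
  rewrite big1 ?add0r // => e wk; case: h => /eqP h.
    by rewrite rE0 ?numul0r // h.
  by rewrite gE0 ?numulr0 // h.
rewrite IH //; first exact: ltnW.
  by rewrite ltn_neqAle ik'.
by rewrite ltn_neqAle jk'.
Qed.

Definition rowk v k i (s : gslot) : Lam := match s with inr e => rE e i | inl _ => comp_row v i k end.
Definition colk v k i (s : gslot) : Lam := match s with inr e => gE e i | inl _ => comp_col v i k end.
Definition slotsC v k : seq gslot :=
  [seq inr e | e <- out_edges v & (weight e <= k)%N] ++ (if (0 < k < w v)%N then [:: sq v k] else [::]).

Lemma slotsC_cases v k s : s \in slotsC v k.+1 ->
  (exists2 e, s = inr e & (e \in out_edges v) && (weight e <= k)%N) \/
  s \in slotsB v k /\ forall i, rowk v k.+1 i s = rho v i k s /\ colk v k.+1 i s = gam v i k s.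
Proof.
rewrite mem_cat => /orP[/mapP[e]|].
  rewrite mem_filter => /andP[wk eo] ->; have [h|h] := leqP (weight e) k.
    by left; exists e; rewrite // eo h.
  right; split.
    by rewrite mem_cat; apply/orP; left; apply/map_f; rewrite mem_filter eo andbT eqn_leq wk.
  move: eo; rewrite mem_out => /eqP ev i; rewrite /rowk /colk /rE /gE ev.
  by have -> : (weight e).-1 = k by lia.
case: ifP => // /andP[_ kw]; rewrite inE => /eqP ->; right; split; last by [].
by rewrite mem_cat kw inE eqxx orbT.
Qed.

(** The other half, on the summands listed by [slotsC]; for [k = w v] it contains relation (iv). A
    summand is either old, so that its entry at the copy [k] is 0, or split off by the last step,
    where [PHPS] applies. *)
Lemma ghost_real_partial v k s s' : (k <= w v)%N -> s \in slotsC v k -> s' \in slotsC v k ->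
  \sum_(i < k) colk v k i s ** rowk v k i s' = if s == s' then XX (glab s) else 0.
Proof.
elim: k s s' => [|k IH] s s' kw sC s'C.
  move: sC; rewrite mem_cat /= orbF => /mapP[e]; rewrite mem_filter leqn0.
  by have := weight_gt0 e; case: (weight e).
have IH' := IH _ _ (ltnW kw); have {}IH := IH'; rewrite big_ord_recr /=.
have inC e : (e \in out_edges v) && (weight e <= k)%N -> inr e \in slotsC v k.
  by move=> /andP[eo wk]; rewrite mem_cat; apply/orP; left; apply/map_f; rewrite mem_filter wk.
have qC : (0 < k)%N -> sq v k \in slotsC v k.
  by move=> k0; rewrite mem_cat k0 kw /= inE eqxx orbT.
have notB e : (e \in out_edges v) && (weight e <= k)%N -> inr e \notin slotsB v k.
  move=> /andP[_ wk]; rewrite mem_cat negb_or; apply/andP; split; last by case: ifP.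
  apply/mapP => -[f]; rewrite mem_filter => /andP[/eqP wf _] [ef].
  by move: wk; rewrite ef wf ltnn.
have kpos e : (e \in out_edges v) && (weight e <= k)%N -> (0 < k)%N.
  by move=> /andP[_]; apply: leq_trans; apply: weight_gt0.
have newS t i : (i < k)%N -> rho v i k t = comp_row v i k ** PS v k (sq v k) t /\
    gam v i k t = PH v k t (sq v k) ** comp_col v i k.
  by move=> ik; rewrite /rho /gam ltn_eqF.
case: (slotsC_cases sC) => [[e -> eP]|[sB sE]]; case: (slotsC_cases s'C) => [[f -> fP]|[s'B s'E]].
- rewrite /= gE0 ?numul0r ?addr0; last by case/andP: eP.
  by rewrite (IH (inr e) (inr f)) ?inC.
- rewrite /= gE0 ?numul0r ?addr0; last by case/andP: eP.
  have -> : (inr e == s') = false.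
    by apply/negbTE; apply: contraNneq (notB _ eP) => ->.
  rewrite (eq_bigr (fun i : 'I_k => (gE e i ** comp_row v i k) ** PS v k (sq v k) s')); last first.
    by move=> i _; rewrite (s'E i).1 (newS s' i _).1 // numulA.
  by rewrite -numul_suml (IH (inr e) (sq v k)) ?inC ?qC ?(kpos e) // numul0r.
- rewrite /= rE0 ?numulr0 ?addr0; last by case/andP: fP.
  have -> : (s == inr f) = false.
    by apply/negbTE; apply: contraNneq (notB _ fP) => <-.
  rewrite (eq_bigr (fun i : 'I_k => PH v k s (sq v k) ** (comp_col v i k ** rE f i))); last first.
    by move=> i _; rewrite (sE i).2 (newS s i _).2 // numulA.
  by rewrite -numul_sumr (IH (sq v k) (inr f)) ?inC ?qC ?(kpos f) // numulr0.
rewrite (sE k).2 (s'E k).1 /gam /rho eqxx -(PHPS kw sB s'B) addrC; congr (_ + _).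
rewrite (eq_bigr (fun i : 'I_k => PH v k s (sq v k) ** ((comp_col v i k ** comp_row v i k) ** PS v k (sq v k) s'))); last first.
  by move=> i _; rewrite (sE i).2 (s'E i).1 (newS s i _).2 // (newS s' i _).1 // !numulA.
case: ifP => [k0|/negbT]; last by rewrite -leqNgt leqn0 => /eqP ->; rewrite big_ord0.
rewrite -numul_sumr -numul_suml (IH (sq v k) (sq v k)) ?qC // eqxx.
by congr (_ ** _); exact: (PSl v k (sq v k)).
Qed.

Definition gen_image (x : wlpa_gen E) : Lam :=
  match x with
  | Vertex v => XX (inl v)
  | RealEdge e i => rE e i
  | GhostEdge e i => gE e i
  end.

Lemma aeval_real e i : aeval gen_image (real_edge K e i) = rE e i.
Proof. by rewrite /real_edge; case: insubP => [j _ <-|]//=; rewrite -leqNgt => /rE0. Qed.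
Lemma aeval_ghost e i : aeval gen_image (ghost_edge K e i) = gE e i.
Proof. by rewrite /ghost_edge; case: insubP => [j _ <-|]//=; rewrite -leqNgt => /gE0. Qed.

Lemma gen_image_rel s t : wlpa_rel s t -> aeval gen_image s = aeval gen_image t.
Proof.
case=> [u v|e i _|e i _|e i _|e i _|v i j iw jw|v e f ev fv] /=;
  rewrite ?aeval_real ?aeval_ghost ?aeval_sum ?big_map.
- rewrite (rXX r) (inj_eq (@inl_inj _ _)); by case: eqP.
- exact: rho_l.
- exact: rho_r.
- exact: (gam_l _ _ _ (inr e)).
- exact: gam_r.
- have w0 : (0 < w v)%N by apply: leq_ltn_trans iw.
  (* There is no slot for q(v, w v), so the last factor [PS] is 0. *)
  have tw : comp_row v i (w v) = 0.
    have [k kE] : exists k, w v = k.+1 by exists (w v).-1; rewrite prednK.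
    rewrite kE comp_rowS /rho.
    by case: ifP => _; rewrite PS_out ?numulr0 // sq_out // kE ltnn.
  transitivity (if i == j then XX (inl v) else 0); last by case: ifP.
  rewrite -(real_ghost_partial (leqnn _) iw jw) tw numul0r addr0.
  rewrite [RHS]big_seq_cond [LHS]big_seq; apply: eq_big => e.
    by rewrite mem_out; case: eqP => //= <-; rewrite weight_le.
  by move=> _; rewrite /= aeval_real aeval_ghost.
- have inC g : esource g = v -> inr g \in slotsC v (w v).
    move=> graph_gen; rewrite mem_cat; apply/orP; left; apply/map_f.
    by rewrite mem_filter mem_out graph_gen eqxx andbT -graph_gen weight_le.
  transitivity (if (inr e : gslot) == inr f then XX (inl (erange e)) else 0).
    rewrite -(ghost_real_partial (leqnn _) (inC e ev) (inC f fv)).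
    have -> : iota 0 (w v) = index_iota 0 (w v) by rewrite /index_iota subn0.
    rewrite big_mkord; apply: eq_bigr => i _ /=.
    by rewrite aeval_real aeval_ghost.
  by rewrite (inj_eq (@inr_inj _ _)); case: ifP.
Qed.

Definition wlpa_hom : wlpa K E -> Lam := pres_map gen_image (rel := @wlpa_rel K E).

End GraphHypergraph.

(** * Matrices over L that realize the objects and their decompositions *)

Section CornerModule.
Variables (K : fieldType) (E : weighted_graph).
Hypothesis hE : row_finite E.
Local Notation w v := (@vertex_weight E v).
Local Notation vert := (vertex E).
Local Notation L := (wlpa K E).
Local Notation cls := (pres_class (@wlpa_rel K E)).
Local Notation ghyp := (ghyp hE).
Local Notation Lam := (hyper_alg K ghyp).
Local Notation r := (hyper_rep K ghyp).

Definition wlpa_vtx (v : vert) : L := cls (vtx K v).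
Definition wlpa_real (e : edge E) i : L := cls (real_edge K e i).
Definition wlpa_ghost (e : edge E) i : L := cls (ghost_edge K e i).
Local Notation vx := wlpa_vtx.
Local Notation re := wlpa_real.
Local Notation gh := wlpa_ghost.

Lemma wlpaE s t : wlpa_rel s t -> cls s = cls t.
Proof. by move=> st; apply/pres_classP/nucong_rel. Qed.

Lemma wcls_if (c : bool) t : cls (if c then t else NUZero) = if c then cls t else 0.
Proof. by case: c; rewrite // pres_class0. Qed.

Lemma re0 e i : (weight e <= i)%N -> re e i = 0.
Proof. by move=> h; rewrite /wlpa_real /real_edge insubF ?pres_class0 // ltnNge h. Qed.
Lemma gh0 e i : (weight e <= i)%N -> gh e i = 0.
Proof. by move=> h; rewrite /wlpa_ghost /ghost_edge insubF ?pres_class0 // ltnNge h. Qed.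

Lemma vxM u v : vx u ** vx v = if u == v then vx u else 0.
Proof. by rewrite -pres_classM (wlpaE (wlpa_vertex K u v)) wcls_if. Qed.

Lemma vx_re e i : vx (esource e) ** re e i = re e i.
Proof.
case: (ltnP i (weight e)) => h; last by rewrite re0 ?numulr0.
by rewrite -pres_classM; apply/wlpaE/wlpa_source.
Qed.
Lemma re_vx e i : re e i ** vx (erange e) = re e i.
Proof.
case: (ltnP i (weight e)) => h; last by rewrite re0 ?numul0r.
by rewrite -pres_classM; apply/wlpaE/wlpa_range.
Qed.
Lemma vx_gh e i : vx (erange e) ** gh e i = gh e i.
Proof.
case: (ltnP i (weight e)) => h; last by rewrite gh0 ?numulr0.
by rewrite -pres_classM; apply/wlpaE/wlpa_ghost_range.
Qed.
Lemma gh_vx e i : gh e i ** vx (esource e) = gh e i.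
Proof.
case: (ltnP i (weight e)) => h; last by rewrite gh0 ?numul0r.
by rewrite -pres_classM; apply/wlpaE/wlpa_ghost_source.
Qed.

Lemma re_gh v i j : (i < w v)%N -> (j < w v)%N ->
  \sum_(e <- out_edges v) re e i ** gh e j = if i == j then vx v else 0.
Proof.
move=> iw jw; rewrite -wcls_if -(wlpaE (wlpa_out K iw jw)) pres_classS big_map.
by apply: eq_bigr => e _; rewrite pres_classM.
Qed.

(** Relation (iv) with any bound [m] above both weights, because [re f i] is 0 from the weight of
    [f] on. *)
Lemma gh_re m e f : esource e = esource f -> (weight e <= m)%N -> (weight f <= m)%N ->
  \sum_(i < m) gh e i ** re f i = if e == f then vx (erange e) else 0.
Proof.
move=> ef em fm; rewrite -wcls_if -(wlpaE (wlpa_index K ef erefl)) pres_classS big_map.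
have -> : iota 0 (w (esource f)) = index_iota 0 (w (esource f)) by rewrite /index_iota subn0.
rewrite -(big_mkord predT (fun i => gh e i ** re f i)).
have cut n : (weight f <= n)%N ->
    \sum_(0 <= i < n) gh e i ** re f i = \sum_(0 <= i < weight f) gh e i ** re f i.
  move=> h; rewrite (big_cat_nat (leq0n _) h) /= [X in _ + X](_ : _ = 0) ?addr0 //.
  rewrite big_nat_cond big1 // => i /andP[/andP[wi _] _].
  by rewrite re0 ?numulr0.
rewrite cut // -(cut (w (esource f))) ?weight_le //.
by apply: eq_bigr => i _; rewrite pres_classM.
Qed.

Definition gdim (x : gobj E) : nat := match x with inl _ => 1 | inr vm => vm.2 end.

(* The image in L of the object x: for x = inr (v, m), what remains of m      *)
(* copies of v after splitting off the edges of weight at most m.             *)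
Definition eps (x : gobj E) (i j : nat) : L := match x with
  | inl v => if (i == 0)%N && (j == 0)%N then vx v else 0
  | inr (v, m) => if (i < m)%N && (j < m)%N then
      (if i == j then vx v else 0) - \sum_(e <- out_edges v | (weight e <= m)%N) re e i ** gh e j
      else 0
  end.

Definition mmul (n : nat) (A B : nat -> nat -> L) : nat -> nat -> L :=
  fun i j => \sum_(l < n) A i l ** B l j.

Lemma mmulA n m (A B C : nat -> nat -> L) : mmul n A (mmul m B C) = mmul m (mmul n A B) C.
Proof.
apply/funext => i; apply/funext => j; rewrite /mmul.
under eq_bigr do rewrite numul_sumr.
rewrite exchange_big; apply: eq_bigr => l _; rewrite numul_suml.
by apply: eq_bigr => l' _; rewrite numulA.
Qed.

Lemma eps_out x i j : (gdim x <= i)%N || (gdim x <= j)%N -> eps x i j = 0.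
Proof.
case: x => [v|[v m]] /=; first by case: i => [|i]; case: j.
by rewrite !ltnNge => /orP[->|->]; rewrite ?andbF.
Qed.

Lemma in_out (e : edge E) v : (e \in out_edges v) = (esource e == v). Proof. exact: mem_out. Qed.

(** By (iv), [eps (inr (v, m))] is the complement of the projection onto the edges of weight at most
    [m], hence it is orthogonal to each of them; [eps_re] is the same on the other side. *)
Lemma gh_eps v m (e : edge E) j : esource e = v -> (weight e <= m)%N ->
  \sum_(i < m) gh e i ** eps (inr (v, m)) i j = 0.
Proof.
move=> ev em; case: (ltnP j m) => jm; last first.
  by rewrite big1 // => i _; rewrite eps_out ?numulr0 //= jm orbT.
rewrite (eq_bigr (fun i : 'I_m => (if (i : nat) == j then gh e j else 0)
    - \sum_(f <- out_edges v | (weight f <= m)%N) (gh e i ** re f i) ** gh f j)); last first.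
  move=> i _; rewrite /= ltn_ord jm /= numulDr; congr (_ + _).
    by case: eqP => [->|_]; rewrite ?numulr0 // -ev gh_vx.
  by rewrite numulNr; congr (- _); rewrite numul_sumr; apply: eq_bigr => f _; rewrite numulA.
rewrite sumrB exchange_big /= (bigD1 (Ordinal jm)) //= eqxx big1 => [|i ij]; last by rewrite (negbTE (ij : (i : nat) != j)).
rewrite addr0 big_seq_cond (eq_bigr (fun f => if e == f then gh f j else 0)); last first.
  move=> f /andP[]; rewrite in_out => /eqP fv fm; rewrite -numul_suml gh_re ?ev ?fv //.
  by case: eqP => [->|_]; rewrite ?numul0r ?vx_gh.
rewrite -big_seq_cond -big_mkcondr (big_rem e) ?in_out ?ev //= em eqxx /=.
rewrite big_seq_cond big1 ?addr0 ?subrr // => f.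
by rewrite mem_rem_uniq ?out_uniq // inE => /andP[/andP[fe _] /andP[_ /eqP ef]]; rewrite ef eqxx in fe.
Qed.

Lemma eps_re v m (e : edge E) i : esource e = v -> (weight e <= m)%N ->
  \sum_(j < m) eps (inr (v, m)) i j ** re e j = 0.
Proof.
move=> ev em; case: (ltnP i m) => im; last first.
  by rewrite big1 // => j _; rewrite eps_out ?numul0r //= im.
rewrite (eq_bigr (fun j : 'I_m => (if (j : nat) == i then re e i else 0)
    - \sum_(f <- out_edges v | (weight f <= m)%N) re f i ** (gh f j ** re e j))); last first.
  move=> j _; rewrite /= ltn_ord im /= numulDl; congr (_ + _).
    by rewrite eq_sym; case: eqP => [->|_]; rewrite ?numul0r // -ev vx_re.
  by rewrite numulNl; congr (- _); rewrite numul_suml; apply: eq_bigr => f _; rewrite numulA.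
rewrite sumrB exchange_big /= (bigD1 (Ordinal im)) //= eqxx big1 => [|j ij]; last by rewrite (negbTE (ij : (j : nat) != i)).
rewrite addr0 big_seq_cond (eq_bigr (fun f => if e == f then re f i else 0)); last first.
  move=> f /andP[]; rewrite in_out => /eqP fv fm; rewrite -numul_sumr gh_re ?ev ?fv //.
  by have [->|_] := eqVneq f e; rewrite ?numulr0 ?re_vx.
rewrite -big_seq_cond -big_mkcondr (big_rem e) ?in_out ?ev //= em eqxx /=.
rewrite big_seq_cond big1 ?addr0 ?subrr // => f.
by rewrite mem_rem_uniq ?out_uniq // inE => /andP[/andP[fe _] /andP[_ /eqP ef]]; rewrite ef eqxx in fe.
Qed.

Lemma vx_eps v m i j : vx v ** eps (inr (v, m)) i j = eps (inr (v, m)) i j.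
Proof.
rewrite /=; case: ifP => _; rewrite ?numulr0 // numulDr; congr (_ + _).
  by case: ifP; rewrite ?numulr0 // vxM eqxx.
rewrite numulNr; congr (- _); rewrite numul_sumr big_seq_cond [RHS]big_seq_cond.
by apply: eq_bigr => e /andP[]; rewrite in_out => /eqP <- _; rewrite numulA vx_re.
Qed.

Lemma eps_idem x : mmul (gdim x) (eps x) (eps x) = eps x.
Proof.
apply/funext => i; apply/funext => j; rewrite /mmul.
case: x => [v|[v m]].
  rewrite big_ord1 /= eqxx andbT /=; case: (i == 0)%N; rewrite /= ?numul0r //.
  by case: (j == 0)%N; rewrite ?numulr0 // vxM eqxx.
rewrite [gdim _]/=; case: (ltnP i m) => im; last first.
  by rewrite [RHS]eps_out ?im // big1 // => l _; rewrite eps_out ?numul0r ?im.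
rewrite (eq_bigr (fun l : 'I_m => (if (l : nat) == i then eps (inr (v, m)) i j else 0)
    - \sum_(f <- out_edges v | (weight f <= m)%N) re f i ** (gh f l ** eps (inr (v, m)) l j))); last first.
  move=> l _; rewrite {1}/eps ltn_ord im [true && true]/= numulDl; congr (_ + _).
    by rewrite eq_sym; case: eqP => [->|_]; rewrite ?numul0r // vx_eps.
  by rewrite numulNl; congr (- _); rewrite numul_suml; apply: eq_bigr => f _; rewrite numulA.
rewrite sumrB exchange_big (bigD1 (Ordinal im)) // eqxx [X in _ + X - _]big1 => [|l /negbTE ij]; last first.
  by rewrite (ij : ((l : nat) == i) = false).
rewrite addr0 big_seq_cond big1 ?subr0 // => f /andP[]; rewrite in_out => /eqP fv fm.
by rewrite -numul_sumr (gh_eps j fv fm) numulr0.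
Qed.

(* The injection of the slot s into, and the projection onto it from, the     *)
(* space of k + 1 copies of v.                                                *)
Definition scol (v : vert) k (s : gslot E) (i l : nat) : L := match s with
  | inl (inl _) => if (i == k)%N && (l == 0)%N then vx v else 0
  | inl (inr vm) => eps (inr vm) i l
  | inr e => if (l == 0)%N then re e i else 0
  end.
Definition srow (v : vert) k (s : gslot E) (l i : nat) : L := match s with
  | inl (inl _) => if (l == 0)%N && (i == k)%N then vx v else 0
  | inl (inr vm) => eps (inr vm) l i
  | inr e => if (l == 0)%N then gh e i else 0
  end.

Lemma mem_slotsA (v : vert) k (s : gslot E) : s \in slotsA v k -> s = sv v \/ s = sq v k /\ (0 < k)%N.
Proof.
rewrite inE => /orP[/eqP|]; first by left.
by case: ifP => // k0; rewrite inE => /eqP; right.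
Qed.

Lemma mem_slotsB (v : vert) k (s : gslot E) : s \in slotsB v k ->
  (exists e, [/\ s = inr e, esource e = v & weight e = k.+1]) \/ s = sq v k.+1.
Proof.
rewrite mem_cat => /orP[/mapP[e]|].
  by rewrite mem_filter in_out => /andP[/eqP ? /eqP ?] ->; left; exists e.
by case: ifP => // _; rewrite inE => /eqP; right.
Qed.

Lemma scol_eps (v : vert) k (s : gslot E) : s \in slotsA v k \/ s \in slotsB v k ->
  mmul (gdim (glab s)) (scol v k s) (eps (glab s)) = scol v k s.
Proof.
move=> sAB; apply/funext => i; apply/funext => l; rewrite /mmul.
have cases : s = sv v \/ (exists e, s = inr e) \/ exists m, s = sq v m.
  case: sAB => [/mem_slotsA[->|[-> _]]|/mem_slotsB[[e [-> _ _]]|->]]; [by left| | |].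
  - by right; right; exists k.
  - by right; left; exists e.
  - by right; right; exists k.+1.
case: cases => [->|[[e ->]|[m ->]]].
- rewrite big_ord1 /= !eqxx andbT /=; case: (i == k); rewrite /= ?numul0r //.
  by case: (l == 0)%N; rewrite ?numulr0 // vxM eqxx.
- by rewrite big_ord1 /=; case: (l == 0)%N; rewrite ?numulr0 ?re_vx.
- exact: (congr1 (fun F => F i l) (eps_idem (inr (v, m)))).
Qed.

Lemma eps_srow (v : vert) k (s : gslot E) : s \in slotsA v k \/ s \in slotsB v k ->
  mmul (gdim (glab s)) (eps (glab s)) (srow v k s) = srow v k s.
Proof.
move=> sAB; apply/funext => l; apply/funext => i; rewrite /mmul.
have cases : s = sv v \/ (exists e, s = inr e) \/ exists m, s = sq v m.
  case: sAB => [/mem_slotsA[->|[-> _]]|/mem_slotsB[[e [-> _ _]]|->]]; [by left| | |].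
  - by right; right; exists k.
  - by right; left; exists e.
  - by right; right; exists k.+1.
case: cases => [->|[[e ->]|[m ->]]].
- rewrite big_ord1 /= !eqxx andbT /=; case: (l == 0)%N; rewrite /= ?numul0r //.
  by case: (i == k); rewrite ?numulr0 // vxM eqxx.
- by rewrite big_ord1 /= andbT; case: (l == 0)%N; rewrite ?numul0r ?vx_gh.
- exact: (congr1 (fun F => F l i) (eps_idem (inr (v, m)))).
Qed.

Lemma mmul_widen n m A B : (forall i l, (n <= l)%N -> A i l = 0) -> (n <= m)%N -> mmul m A B = mmul n A B.
Proof.
move=> A0 nm; apply/funext => i; apply/funext => j; rewrite /mmul.
rewrite -(big_mkord predT (fun l => A i l ** B l j)) (big_cat_nat (leq0n _) nm) /= big_mkord.
rewrite [X in _ + X](_ : _ = 0) ?addr0 // big_nat_cond big1 // => l /andP[/andP[h _] _].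
by rewrite A0 ?numul0r.
Qed.

(** The slots of one side are orthogonal summands of [k + 1] copies of [v]: here because q(v, k)
    lives on the copies below [k], in [srow_scolB] by (iv) and the orthogonality of q(v, k + 1) to
    the edges. *)
Lemma srow_scolA (v : vert) k (s s' : gslot E) : s \in slotsA v k -> s' \in slotsA v k ->
  mmul k.+1 (srow v k s) (scol v k s') = if s == s' then eps (glab s) else fun _ _ => 0.
Proof.
move=> /mem_slotsA[->|[-> k0]] /mem_slotsA[->|[-> _]]; apply/funext => l; apply/funext => l'.
- rewrite /mmul big_ord_recr big1 ?add0r => [|i _]; last by rewrite /= (ltn_eqF (ltn_ord i)) andbF numul0r.
  rewrite /= !eqxx andbT /= add0r; case: (l == 0)%N => /=; rewrite ?numul0r //.
  by case: (l' == 0)%N; rewrite ?numulr0 // vxM eqxx.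
- rewrite /mmul big_ord_recr big1 ?add0r => [|i _]; last by rewrite /= (ltn_eqF (ltn_ord i)) andbF numul0r.
  by rewrite /= ltnn /= numulr0 add0r.
- rewrite /mmul big_ord_recr big1 ?add0r => [|i _]; last by rewrite /= (ltn_eqF (ltn_ord i)) numulr0.
  by rewrite /= ltnn andbF numul0r add0r.
rewrite eqxx (@mmul_widen k) //; last by move=> i j kj; rewrite /= [(j < k)%N]ltnNge kj andbF.
exact: (congr1 (fun F => F l l') (eps_idem (inr (v, k)))).
Qed.

Lemma srow_scolB (v : vert) k (s s' : gslot E) : s \in slotsB v k -> s' \in slotsB v k ->
  mmul k.+1 (srow v k s) (scol v k s') = if s == s' then eps (glab s) else fun _ _ => 0.
Proof.
move=> /mem_slotsB[[e [-> ev ek]]|->] /mem_slotsB[[f [-> fv fk]]|->];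
  apply/funext => l; apply/funext => l'.
- rewrite /mmul (inj_eq (@inr_inj _ _)) (_ : _ l l' = if e == f then
      (if (l == 0)%N && (l' == 0)%N then vx (erange e) else 0) else 0); last by case: ifP.
  rewrite /=; case: (l == 0)%N; last by rewrite big1 ?if_same // => i _; rewrite numul0r.
  case: (l' == 0)%N; last by rewrite big1 ?if_same // => i _; rewrite numulr0.
  by rewrite gh_re ?ev ?fv ?ek ?fk.
- rewrite /mmul /=; case: (l == 0)%N; last by rewrite big1 // => i _; rewrite numul0r.
  by have := @gh_eps v k.+1 e l' ev; rewrite ek => ->.
- rewrite /mmul /=; case: (l' == 0)%N; last by rewrite big1 // => i _; rewrite numulr0.
  by have := @eps_re v k.+1 f l fv; rewrite fk => ->.
rewrite eqxx; exact: (congr1 (fun F => F l l') (eps_idem (inr (v, k.+1)))).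
Qed.

Lemma sum_out_split (v : vert) k i j :
  \sum_(e <- out_edges v | (weight e <= k.+1)%N) re e i ** gh e j
  = \sum_(e <- out_edges v | (weight e <= k)%N) re e i ** gh e j
  + \sum_(e <- out_edges v | weight e == k.+1) re e i ** gh e j.
Proof.
rewrite (bigID (fun e => (weight e <= k)%N)) /=; congr (_ + _).
  by apply: eq_bigl => e; case: ltngtP => //; lia.
by apply: eq_bigl => e; rewrite -ltnNge eqn_leq.
Qed.

(** Both sides decompose the complement of the edges of weight at most [k] in [k + 1] copies of
    [v]. *)
Lemma scol_srow (v : vert) k i j : (k < w v)%N -> (i <= k)%N -> (j <= k)%N ->
  \sum_(s <- slotsA v k) mmul (gdim (glab s)) (scol v k s) (srow v k s) i j
  = \sum_(s <- slotsB v k) mmul (gdim (glab s)) (scol v k s) (srow v k s) i j.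
Proof.
move=> kw ik jk.
have qE (m : nat) : mmul (gdim (glab (sq v m))) (scol v k (sq v m)) (srow v k (sq v m)) = eps (inr (v, m)).
  exact: (eps_idem (inr (v, m))).
rewrite sum_slotsB; last first.
  (* For the last step the slot of q(v, k + 1) is absent; its idempotent is 0 by relation (iii). *)
  move=> h; have wE : w v = k.+1 by apply/eqP; rewrite eqn_leq kw leqNgt h.
  rewrite qE /= !ltnS ik jk /= -(@re_gh v) ?wE ?ltnS // big_seq.
  rewrite [X in _ - X]big_seq_cond; apply/eqP; rewrite subr_eq0; apply/eqP; apply: eq_bigl => e.
  by rewrite in_out; case: eqP => //= ev; rewrite -wE -ev weight_le.
rewrite /slotsA big_cons qE.
have -> : \sum_(s <- (if (0 < k)%N then [:: sq v k] else [::]))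
    mmul (gdim (glab s)) (scol v k s) (srow v k s) i j = eps (inr (v, k)) i j.
  by case: ifP => [_|/negbT]; rewrite ?big_seq1 ?qE // -leqNgt leqn0 => /eqP ->; rewrite big_nil.
have -> : mmul (gdim (glab (sv v))) (scol v k (sv v)) (srow v k (sv v)) i j
    = if (i == k) && (j == k) then vx v else 0.
  rewrite /mmul big_ord1 /= ?andbT; case: (i == k); rewrite /= ?numul0r //.
  by case: (j == k); rewrite ?numulr0 // vxM eqxx.
rewrite (eq_bigr (fun e => re e i ** gh e j)); last first.
  by move=> e _; rewrite /mmul big_ord1.
rewrite [eps (inr (v, k.+1)) i j]/= !ltnS ik jk /= sum_out_split opprD [RHS]addrC addrA subrK /=.
(* With indices from 0, an edge of weight at most [k] has no entry at the copy [k]. *)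
have z0 : (i == k) || (j == k) -> \sum_(e <- out_edges v | (weight e <= k)%N) re e i ** gh e j = 0.
  move=> /orP[/eqP ->|/eqP ->]; rewrite big1 // => e ek; first by rewrite re0 ?numul0r.
  by rewrite gh0 ?numulr0.
have [ik'|nik] := eqVneq i k; first by rewrite z0 ?ik' ?eqxx //= ltnn addr0 subr0 eq_sym.
have [jk'|njk] := eqVneq j k.
  by rewrite z0 ?jk' ?eqxx ?orbT //= ltnn andbF addr0 subr0 (negbTE nik).
by rewrite add0r !ltn_neqAle nik njk ik jk.
Qed.

End CornerModule.

(** * The module of columns over L, and the passage from Lam back to L *)

Section TransferModule.
Variables (K : fieldType) (E : weighted_graph).
Hypothesis hE : row_finite E.
Local Notation w v := (@vertex_weight E v).
Local Notation vert := (vertex E).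
Local Notation L := (wlpa K E).
Local Notation ghyp := (ghyp E).
Local Notation Lam := (hyper_alg K ghyp).
Local Notation r := (hyper_rep K ghyp).
Local Notation vx := (@wlpa_vtx K E).
Local Notation re := (@wlpa_real K E).
Local Notation gh := (@wlpa_ghost K E).
Local Notation eps := (@eps K E).
Local Notation scol := (@scol K E).
Local Notation srow := (@srow K E).
Local Notation dim s := (gdim (glab s)).

Lemma mmul_sum (T : Type) (s : seq T) n m (D C : nat -> nat -> L) (F : T -> nat -> nat -> L) i j :
  mmul n D (mmul m (fun p q => \sum_(a <- s) F a p q) C) i j = \sum_(a <- s) mmul n D (mmul m (F a) C) i j.
Proof.
rewrite /mmul exchange_big; apply: eq_bigr => p _; rewrite -numul_sumr; congr (_ ** _).
by rewrite exchange_big; apply: eq_bigr => q _; rewrite -numul_suml.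
Qed.

Lemma mmul_suml (T : Type) (s : seq T) n (C : nat -> nat -> L) (F : T -> nat -> nat -> L) i j :
  mmul n (fun p q => \sum_(a <- s) F a p q) C i j = \sum_(a <- s) mmul n (F a) C i j.
Proof. by rewrite /mmul exchange_big; apply: eq_bigr => q _; rewrite -numul_suml. Qed.

Lemma mmul_sumr (T : Type) (s : seq T) n (D : nat -> nat -> L) (F : T -> nat -> nat -> L) i j :
  mmul n D (fun p q => \sum_(a <- s) F a p q) i j = \sum_(a <- s) mmul n D (F a) i j.
Proof. by rewrite /mmul exchange_big; apply: eq_bigr => q _; rewrite -numul_sumr. Qed.

Lemma eq_mmul n (A A' B B' : nat -> nat -> L) i j :
  (forall p, (p < n)%N -> A i p = A' i p) -> (forall p, (p < n)%N -> B p j = B' p j) ->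
  mmul n A B i j = mmul n A' B' i j.
Proof. by move=> AA BB; apply: eq_bigr => p _; rewrite AA ?BB. Qed.

Lemma mmul0l n (B : nat -> nat -> L) : mmul n (fun _ _ => 0) B = fun _ _ => 0.
Proof. by apply/funext => i; apply/funext => j; apply: big1 => p _; rewrite numul0r. Qed.

Lemma mmul0r n (B : nat -> nat -> L) : mmul n B (fun _ _ => 0) = fun _ _ => 0.
Proof. by apply/funext => i; apply/funext => j; apply: big1 => p _; rewrite numulr0. Qed.

(** The common idempotent of [scol_srow], written from the A-side and from the B-side; [rArB]
    identifies them for indices up to [k], which suffices inside products of size [k + 1]. *)
Definition rA v k : nat -> nat -> L := fun i j => \sum_(s <- slotsA v k) mmul (dim s) (scol v k s) (srow v k s) i j.
Definition rB v k : nat -> nat -> L := fun i j => \sum_(s <- slotsB v k) mmul (dim s) (scol v k s) (srow v k s) i j.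

Lemma rArB v k i j : (k < w v)%N -> (i <= k)%N -> (j <= k)%N -> rA v k i j = rB v k i j.
Proof. exact: scol_srow. Qed.

Lemma rAE v k i j : rA v k i j = (if (i == k) && (j == k) then vx v else 0) + eps (inr (v, k)) i j.
Proof.
have qE (m : nat) : mmul (dim (sq v m)) (scol v k (sq v m)) (srow v k (sq v m)) = eps (inr (v, m)).
  exact: (eps_idem K hE (inr (v, m))).
rewrite /rA /slotsA big_cons; congr (_ + _).
  rewrite /mmul big_ord1 /= ?andbT; case: (i == k); rewrite /= ?numul0r //.
  by case: (j == k); rewrite ?numulr0 // vxM eqxx.
by case: ifP => [_|/negbT]; rewrite ?big_seq1 ?qE // -leqNgt leqn0 => /eqP ->; rewrite big_nil.
Qed.

Lemma pick_fun (s : seq (gslot E)) b (F : gslot E -> nat -> nat -> L) (b' : gslot E) i j : uniq s -> b \in s ->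
  \sum_(c <- s) (if b == c then F c else fun _ _ => 0) i j = F b i j.
Proof.
move=> us bs; rewrite -[RHS](@big_pick L _ s b (fun c => F c i j)) //.
by apply: eq_bigr => c _; case: ifP.
Qed.

Lemma rA_scolA v k a : a \in slotsA v k -> mmul k.+1 (rA v k) (scol v k a) = scol v k a.
Proof.
move=> aA; apply/funext => i; apply/funext => j; rewrite mmul_suml big_seq.
rewrite (eq_bigr (fun s => (if a == s then scol v k s else fun _ _ => 0) i j)); last first.
  move=> s sA; rewrite -mmulA (srow_scolA K hE sA aA); have [->|_] := eqVneq s a; last by rewrite mmul0r.
  by rewrite scol_eps //; left.
by rewrite -big_seq pick_fun ?slotsA_uniq.
Qed.

Lemma rB_scolB v k b : b \in slotsB v k -> mmul k.+1 (rB v k) (scol v k b) = scol v k b.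
Proof.
move=> bB; apply/funext => i; apply/funext => j; rewrite mmul_suml big_seq.
rewrite (eq_bigr (fun s => (if b == s then scol v k s else fun _ _ => 0) i j)); last first.
  move=> s sB; rewrite -mmulA (srow_scolB K hE sB bB); have [->|_] := eqVneq s b; last by rewrite mmul0r.
  by rewrite scol_eps //; right.
by rewrite -big_seq pick_fun ?slotsB_uniq.
Qed.

Lemma srow_rB v k b : b \in slotsB v k -> mmul k.+1 (srow v k b) (rB v k) = srow v k b.
Proof.
move=> bB; apply/funext => i; apply/funext => j; rewrite mmul_sumr big_seq.
rewrite (eq_bigr (fun s => (if b == s then srow v k s else fun _ _ => 0) i j)); last first.
  move=> s sB; rewrite mmulA (srow_scolB K hE bB sB); have [<-|_] := eqVneq b s; last by rewrite mmul0l.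
  by rewrite eps_srow //; right.
by rewrite -big_seq pick_fun ?slotsB_uniq.
Qed.

Lemma rA_scolB v k b i j : (k < w v)%N -> (i <= k)%N -> b \in slotsB v k ->
  mmul k.+1 (rA v k) (scol v k b) i j = scol v k b i j.
Proof. by move=> kw ik bB; rewrite -[in RHS](rB_scolB bB); apply: eq_mmul => // p pk; apply: rArB. Qed.

Lemma srow_rAB v k b i j : (k < w v)%N -> (j <= k)%N -> b \in slotsB v k ->
  mmul k.+1 (srow v k b) (rA v k) i j = srow v k b i j.
Proof. by move=> kw jk bB; rewrite -[in RHS](srow_rB bB); apply: eq_mmul => // p pk; apply: rArB. Qed.

(** From a slot of one side into the space of [k + 1] copies of [v] and on to a slot of the other
    side. As both sides decompose the same idempotent, [TPh] and [TPs] are mutually inverse and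
    satisfy the relations of Lam. *)
Definition TPh (z : gedge E) b a : nat -> nat -> L := let (v, k) := val z in
  if (b \in slotsB v k) && (a \in slotsA v k) then mmul k.+1 (srow v k b) (scol v k a) else fun _ _ => 0.
Definition TPs (z : gedge E) a b : nat -> nat -> L := let (v, k) := val z in
  if (a \in slotsA v k) && (b \in slotsB v k) then mmul k.+1 (srow v k a) (scol v k b) else fun _ _ => 0.

Lemma TPhE v k (kw : (k < w v)%N) b a : TPh (Sub (v, k) kw) b a =
  if (b \in slotsB v k) && (a \in slotsA v k) then mmul k.+1 (srow v k b) (scol v k a) else fun _ _ => 0.
Proof. by []. Qed.
Lemma TPsE v k (kw : (k < w v)%N) a b : TPs (Sub (v, k) kw) a b =
  if (a \in slotsA v k) && (b \in slotsB v k) then mmul k.+1 (srow v k a) (scol v k b) else fun _ _ => 0.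
Proof. by []. Qed.

Lemma TPh_l z b a : mmul (dim b) (eps (glab b)) (TPh z b a) = TPh z b a.
Proof.
case: z => [[v k] kw]; rewrite TPhE; case: ifP => [/andP[bB _]|_]; last by rewrite mmul0r.
by rewrite mmulA eps_srow //; right.
Qed.
Lemma TPh_r z b a : mmul (dim a) (TPh z b a) (eps (glab a)) = TPh z b a.
Proof.
case: z => [[v k] kw]; rewrite TPhE; case: ifP => [/andP[_ aA]|_]; last by rewrite mmul0l.
by rewrite -mmulA scol_eps //; left.
Qed.
Lemma TPs_l z a b : mmul (dim a) (eps (glab a)) (TPs z a b) = TPs z a b.
Proof.
case: z => [[v k] kw]; rewrite TPsE; case: ifP => [/andP[aA _]|_]; last by rewrite mmul0r.
by rewrite mmulA eps_srow //; left.
Qed.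
Lemma TPs_r z a b : mmul (dim b) (TPs z a b) (eps (glab b)) = TPs z a b.
Proof.
case: z => [[v k] kw]; rewrite TPsE; case: ifP => [/andP[_ bB]|_]; last by rewrite mmul0l.
by rewrite -mmulA scol_eps //; right.
Qed.

Lemma TPhTPs (z : gedge E) b b' i j : b \in slotsB (val z).1 (val z).2 -> b' \in slotsB (val z).1 (val z).2 ->
  \sum_(a <- slotsA (val z).1 (val z).2) mmul (dim a) (TPh z b a) (TPs z a b') i j
  = if b == b' then eps (glab b) i j else 0.
Proof.
case: z => [[v k] kw] /= bB b'B; rewrite big_seq.
rewrite (eq_bigr (fun a => mmul k.+1 (srow v k b) (mmul k.+1 (mmul (dim a) (scol v k a) (srow v k a)) (scol v k b')) i j)).
  rewrite -big_seq -mmul_sum -/(rA v k).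
  rewrite (@eq_mmul _ _ (srow v k b) _ (scol v k b')) //; last by move=> p pk; apply: rA_scolB.
  by rewrite (srow_scolB K hE bB b'B); case: eqP.
by move=> a aA; rewrite TPhE TPsE aA bB b'B /= -!mmulA.
Qed.

Lemma TPsTPh (z : gedge E) a a' i j : a \in slotsA (val z).1 (val z).2 -> a' \in slotsA (val z).1 (val z).2 ->
  \sum_(b <- slotsB (val z).1 (val z).2) mmul (dim b) (TPs z a b) (TPh z b a') i j
  = if a == a' then eps (glab a) i j else 0.
Proof.
case: z => [[v k] kw] /= aA a'A; rewrite big_seq.
rewrite (eq_bigr (fun b => mmul k.+1 (srow v k a) (mmul k.+1 (mmul (dim b) (scol v k b) (srow v k b)) (scol v k a')) i j)).
  rewrite -big_seq -mmul_sum -/(rB v k).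
  rewrite (@eq_mmul _ _ (srow v k a) _ (scol v k a')) //; last first.
    move=> p pk; rewrite -[RHS](congr1 (fun F => F p j) (rA_scolA a'A)).
    by apply: eq_mmul => // q qk; rewrite rArB.
  by rewrite (srow_scolA K hE aA a'A); case: eqP.
by move=> b bB; rewrite TPhE TPsE bB aA a'A /= -!mmulA.
Qed.

Local Notation M := (gobj E -> nat -> L).

Definition opm (y0 x0 : gobj E) (T : nat -> nat -> L) (m : M) : M :=
  fun y l => if y == y0 then \sum_(l' < gdim x0) T l l' ** m x0 l' else 0.

Lemma opm_comp y0 x0 x1 T T' m : opm y0 x0 T (opm x0 x1 T' m) = opm y0 x1 (mmul (gdim x0) T T') m.
Proof.
apply/funext => y; apply/funext => l; rewrite /opm /mmul; case: eqP => // _.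
under eq_bigr do rewrite eqxx numul_sumr.
rewrite exchange_big; apply: eq_bigr => l' _; rewrite numul_suml.
by apply: eq_bigr => l1 _; rewrite numulA.
Qed.

Definition gop (x : hgen ghyp) : M -> M := match x with
  | HVtx x => opm x x (eps x)
  | HPhi z b a => opm (glab b) (glab a) (TPh z b a)
  | HPsi z a b => opm (glab a) (glab b) (TPs z a b)
  end.

Lemma opmD y0 x0 T m m' : opm y0 x0 T (m + m') = opm y0 x0 T m + opm y0 x0 T m'.
Proof.
apply/funext => y; apply/funext => l; rewrite -[RHS]/(opm y0 x0 T m y l + opm y0 x0 T m' y l) /opm.
case: ifP => _; last by rewrite addr0.
by rewrite -big_split; apply: eq_bigr => l' _; apply: numulDr.
Qed.

Lemma opmZ y0 x0 T c m : opm y0 x0 T (c *: m) = c *: opm y0 x0 T m.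
Proof.
apply/funext => y; apply/funext => l; rewrite -[RHS]/(c *: opm y0 x0 T m y l) /opm.
case: ifP => _; last by rewrite scaler0.
by rewrite scaler_sumr; apply: eq_bigr => l' _; rewrite nuscaleAr.
Qed.

Lemma opm0 y0 x0 m : opm y0 x0 (fun _ _ => 0) m = 0.
Proof.
apply/funext => y; apply/funext => l; rewrite /opm; case: ifP => // _.
by apply: big1 => l' _; rewrite numul0r.
Qed.

Lemma opm_sum (T : Type) (s : seq T) y0 x0 (F : T -> nat -> nat -> L) m :
  \sum_(a <- s) opm y0 x0 (F a) m = opm y0 x0 (fun i j => \sum_(a <- s) F a i j) m.
Proof.
elim: s => [|a s IH].
  rewrite big_nil -[LHS](opm0 y0 x0 m); congr opm.
  by apply/funext => i; apply/funext => j; rewrite big_nil.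
rewrite big_cons IH; apply/funext => y; apply/funext => l.
rewrite -[LHS]/(opm y0 x0 (F a) m y l + opm y0 x0 _ m y l) /opm; case: ifP => _; last by rewrite addr0.
by rewrite -big_split; apply: eq_bigr => l' _; rewrite big_cons; apply/esym/numulDl.
Qed.

Lemma gopD x m m' : gop x (m + m') = gop x m + gop x m'.
Proof. by case: x => *; apply: opmD. Qed.

Lemma gopZ x c m : gop x (c *: m) = c *: gop x m.
Proof. by case: x => *; apply: opmZ. Qed.

Lemma gop_rel s t : hrel s t -> forall m, oeval gop s m = oeval gop t m.
Proof.
case=> [x y|z b a|z b a|z a b|z a b|z b a h|z a b h|z b b' bB b'B|z a a' aA a'A] m.
- rewrite /=; case: eqP => [->|/eqP xy] /=; first by rewrite opm_comp eps_idem.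
  apply/funext => v; apply/funext => l; rewrite /opm; case: ifP => // _.
  by apply: big1 => l' _; rewrite (negbTE xy) numulr0.
- by rewrite /= opm_comp TPh_l.
- by rewrite /= opm_comp TPh_r.
- by rewrite /= opm_comp TPs_l.
- by rewrite /= opm_comp TPs_r.
- by move: h; case: z => [[v k] kw] h; rewrite [LHS]/= TPhE (negbTE h) opm0.
- by move: h; case: z => [[v k] kw] h; rewrite [LHS]/= TPsE (negbTE h) opm0.
- rewrite oeval_sum big_map /=; under eq_bigr do rewrite opm_comp.
  rewrite opm_sum; case: eqP => [<-|/eqP nb] /=.
    congr opm; apply/funext => i; apply/funext => j.
    by rewrite TPhTPs // eqxx.
  rewrite -[RHS](opm0 (glab b) (glab b') m); congr opm; apply/funext => i; apply/funext => j.
  by rewrite TPhTPs // (negbTE nb).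
- rewrite oeval_sum big_map /=; under eq_bigr do rewrite opm_comp.
  rewrite opm_sum; case: eqP => [<-|/eqP nb] /=.
    congr opm; apply/funext => i; apply/funext => j.
    by rewrite TPsTPh // eqxx.
  rewrite -[RHS](opm0 (glab a) (glab a') m); congr opm; apply/funext => i; apply/funext => j.
  by rewrite TPsTPh // (negbTE nb).
Qed.

Definition wmod : nmod Lam := omod gopD gopZ gop_rel.

Definition rmulM (m : wmod) (l : L) : wmod := fun y k => m y k ** l.

(** Lam acts by left multiplication with matrices, so it commutes with right multiplication by L.
    Hence its action is determined by the unit columns, and [theta] is multiplicative. *)
Lemma rmulM_act a (m : wmod) l : a $* rmulM m l = rmulM (a $* m) l.
Proof.
move: m; elim/presented_ind: a => [x||a b IHa IHb|a IHa|c a IHa|a b IHa IHb] m.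
- have gE (n : M) : pres_class _ (NUGen K x) $* (n : wmod) = gop x n := omod_gen gopD gopZ gop_rel x n.
  rewrite !gE.
  have opm_r y0 x0 T (n : M) : opm y0 x0 T (fun y k => n y k ** l) = fun y k => opm y0 x0 T n y k ** l.
    apply/funext => y; apply/funext => k; rewrite /opm; case: ifP => _; last by rewrite numul0r.
    by rewrite numul_suml; apply: eq_bigr => k' _; rewrite numulA.
  by case: x {gE} => *; apply: opm_r.
- by rewrite !nact0l; apply/funext => y; apply/funext => k; rewrite /rmulM numul0r.
- by rewrite !nactDl IHa IHb; apply/funext => y; apply/funext => k; apply/esym/numulDl.
- rewrite !nactNl IHa; apply/funext => y; apply/funext => k.
  rewrite -[LHS]/(- ((a $* m) y k ** l)) -[RHS]/((- (a $* m) y k) ** l).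
  by rewrite numulNl.
- rewrite !nactZl IHa; apply/funext => y; apply/funext => k; exact: nuscaleAl.
- by rewrite !nactM IHb IHa.
Qed.

Lemma wmod_vtx x (m : wmod) : rX r x $* m = opm x x (eps x) m.
Proof. exact: (omod_gen _ _ _ (HVtx x)). Qed.

Lemma wmod_phi z b a (m : wmod) : rph r z b a $* m = opm (glab b) (glab a) (TPh z b a) m.
Proof. exact: (omod_gen _ _ _ (HPhi z b a)). Qed.

Lemma wmod_psi z a b (m : wmod) : rps r z a b $* m = opm (glab a) (glab b) (TPs z a b) m.
Proof. exact: (omod_gen _ _ _ (HPsi z a b)). Qed.

Definition unitM (x : gobj E) l : wmod := fun y k => if y == x then eps x k l else 0.

(* The entries of the image of a under Lam -> End(wmod): wmod consists of     *)
(* columns over L, on which Lam acts by left multiplication with matrices.    *)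
Definition theta (a : Lam) y k x l : L := (a $* unitM x l) y k.

Lemma unitM_out x l : (gdim x <= l)%N -> unitM x l = 0.
Proof.
move=> h; apply/funext => y; apply/funext => k; rewrite /unitM; case: ifP => // _.
by rewrite eps_out // h orbT.
Qed.

Lemma theta_out a y k x l : (gdim x <= l)%N -> theta a y k x l = 0.
Proof. by move=> h; rewrite /theta unitM_out // nact0r. Qed.

Lemma wmod_sumE (I : Type) (s : seq I) (F : I -> wmod) y k : (\sum_(i <- s) F i) y k = \sum_(i <- s) F i y k.
Proof. by elim: s => [|i s IH]; rewrite ?big_nil // !big_cons -IH. Qed.

Lemma expand_unitM N x (m : wmod) : (gdim x <= N)%N -> rX r x $* m = m ->
  m = \sum_(l < N) rmulM (unitM x l) (m x l).
Proof.
move=> xN xm; apply/funext => y; apply/funext => k; rewrite wmod_sumE -{1}xm wmod_vtx /opm.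
rewrite /rmulM /unitM; case: ifP => _; last by rewrite big1 // => l _; rewrite numul0r.
apply/esym/(congr1 (fun F => F k 0%N) (@mmul_widen K E _ _ _ (fun l _ => m x l) _ xN)).
by move=> i l h; rewrite eps_out // h orbT.
Qed.

Lemma theta_mul N a b x y z k l : (gdim y <= N)%N -> rX r y ** b = b ->
  theta (a ** b) x k z l = \sum_(p < N) theta a x k y p ** theta b y p z l.
Proof.
move=> yN yb; rewrite /theta nactM.
have yE : rX r y $* (b $* unitM z l) = b $* unitM z l by rewrite -nactM yb.
rewrite {1}(expand_unitM yN yE) nact_sumr wmod_sumE.
by apply: eq_bigr => p _; rewrite rmulM_act.
Qed.

Lemma theta_X x k l : theta (rX r x) x k x l = eps x k l.
Proof.
rewrite /theta wmod_vtx /opm eqxx /unitM eqxx.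
exact: (congr1 (fun F => F k l) (eps_idem K hE x)).
Qed.

Lemma theta_sum (I : Type) (s : seq I) (F : I -> Lam) y k x l :
  theta (\sum_(i <- s) F i) y k x l = \sum_(i <- s) theta (F i) y k x l.
Proof. by rewrite /theta nact_suml wmod_sumE. Qed.

Lemma theta0 y k x l : theta 0 y k x l = 0.
Proof. by rewrite /theta nact0l. Qed.

Definition row_at (F : nat -> L) : nat -> nat -> L := fun l l' => if (l == 0)%N then F l' else 0.
Definition col_at (F : nat -> L) : nat -> nat -> L := fun l l' => if (l' == 0)%N then F l else 0.

Lemma mmul_row_at n F (B : nat -> nat -> L) l l' :
  mmul n (row_at F) B l l' = if (l == 0)%N then \sum_(p < n) F p ** B p l' else 0.
Proof. by rewrite /mmul /row_at; case: ifP => // _; apply: big1 => p _; apply: numul0r. Qed.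

Lemma mmul_col_at n F (B : nat -> nat -> L) l l' :
  mmul n B (col_at F) l l' = if (l' == 0)%N then \sum_(p < n) B l p ** F p else 0.
Proof. by rewrite /mmul /col_at; case: ifP => // _; apply: big1 => p _; apply: numulr0. Qed.

Lemma vx_scol v k s i l : s \in slotsB v k -> vx v ** scol v k s i l = scol v k s i l.
Proof.
move=> /(mem_slotsB hE)[[e [-> ev _]]|->]; last exact: vx_eps.
by rewrite /=; case: ifP => _; rewrite ?numulr0 // -ev vx_re.
Qed.

Lemma eps_vx v m i j : eps (inr (v, m)) i j ** vx v = eps (inr (v, m)) i j.
Proof.
rewrite /=; case: ifP => _; rewrite ?numul0r // numulDl; congr (_ + _).
  by case: ifP; rewrite ?numul0r // vxM eqxx.
rewrite numulNl; congr (- _); rewrite numul_suml big_seq_cond [RHS]big_seq_cond.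
by apply: eq_bigr => e /andP[]; rewrite (in_out hE) => /eqP <- _; rewrite -numulA gh_vx.
Qed.

Lemma srow_vx v k s l i : s \in slotsB v k -> srow v k s l i ** vx v = srow v k s l i.
Proof.
move=> /(mem_slotsB hE)[[e [-> ev _]]|->]; last exact: eps_vx.
by rewrite /=; case: ifP => _; rewrite ?numul0r // -ev gh_vx.
Qed.

(** The recursion defining [rho] acts through the closed form [scol]. In the inductive step the
    passage through q(v, k + 1) disappears: its idempotent has the same row [i] as [rA], which fixes
    [scol]. *)
Lemma rho_act v k s i (m : wmod) : (k < w v)%N -> (i <= k)%N -> s \in slotsB v k ->
  rho K v i k s $* m = opm (inl v) (glab s) (row_at (scol v k s i)) m.
Proof.
elim: k s i m => [|k IH] s i m kw ik sB.
  have -> : i = 0%N by case: i ik.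
  rewrite /rho eqxx (PSE _ _ _ kw) wmod_psi TPsE sB mem_head; congr opm.
  apply/funext => l; apply/funext => l'; rewrite /mmul big_ord1 /row_at /= andbT.
  by case: (l == 0)%N; rewrite ?numul0r // vx_scol.
rewrite /rho; have [->|nik] := eqVneq i k.+1.
  rewrite (PSE _ _ _ kw) wmod_psi TPsE sB mem_head; congr opm.
  apply/funext => l; apply/funext => l'; rewrite /mmul big_ord_recr big1 ?add0r => [|p _].
    by rewrite /row_at /= eqxx andbT; case: (l == 0)%N; rewrite ?numul0r ?add0r // vx_scol.
  by rewrite /= (ltn_eqF (ltn_ord p)) andbF /= numul0r.
have ik' : (i <= k)%N by rewrite -ltnS ltn_neqAle nik.
have sqB : sq v k.+1 \in slotsB v k by rewrite mem_cat kw inE eqxx orbT.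
have sqA : sq v k.+1 \in slotsA v k.+1 by rewrite /slotsA !inE eqxx orbT.
rewrite nactM comp_rowS (PSE _ _ _ kw) wmod_psi (IH _ _ _ (ltnW kw) ik' sqB) opm_comp TPsE sB sqA.
congr opm; apply/funext => l; apply/funext => l'; rewrite [glab _]/= [gdim _]/=.
rewrite mmul_row_at [RHS]/row_at; case: (l == 0)%N => //.
rewrite -[LHS]/(mmul k.+1 (eps (inr (v, k.+1))) (mmul k.+2 (eps (inr (v, k.+1))) (scol v k.+1 s)) i l').
rewrite mmulA [mmul k.+1 _ _](eps_idem K hE (inr (v, k.+1))).
rewrite -(rA_scolB _ kw ik sB); apply: eq_mmul => // p _; by rewrite rAE (negbTE nik) add0r.
Qed.

Lemma gam_act v k s i (m : wmod) : (k < w v)%N -> (i <= k)%N -> s \in slotsB v k ->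
  gam K v i k s $* m = opm (glab s) (inl v) (col_at (fun l => srow v k s l i)) m.
Proof.
elim: k s i m => [|k IH] s i m kw ik sB.
  have -> : i = 0%N by case: i ik.
  rewrite /gam eqxx (PHE _ _ _ kw) wmod_phi TPhE sB mem_head; congr opm.
  apply/funext => l; apply/funext => l'; rewrite /mmul big_ord1 /col_at /=.
  by case: (l' == 0)%N; rewrite ?numulr0 // srow_vx.
rewrite /gam; have [->|nik] := eqVneq i k.+1.
  rewrite (PHE _ _ _ kw) wmod_phi TPhE sB mem_head; congr opm.
  apply/funext => l; apply/funext => l'; rewrite /mmul big_ord_recr big1 ?add0r => [|p _].
    by rewrite /col_at /= eqxx; case: (l' == 0)%N; rewrite ?numulr0 ?add0r // srow_vx.
  by rewrite /= (ltn_eqF (ltn_ord p)) /= numulr0.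
have ik' : (i <= k)%N by rewrite -ltnS ltn_neqAle nik.
have sqB : sq v k.+1 \in slotsB v k by rewrite mem_cat kw inE eqxx orbT.
have sqA : sq v k.+1 \in slotsA v k.+1 by rewrite /slotsA !inE eqxx orbT.
rewrite nactM comp_colS (PHE _ _ _ kw) (IH _ _ _ (ltnW kw) ik' sqB) wmod_phi opm_comp TPhE sB sqA.
congr opm; apply/funext => l; apply/funext => l'; rewrite [glab _]/= [gdim _]/=.
rewrite mmul_col_at [RHS]/col_at; case: (l' == 0)%N => //.
rewrite -[LHS]/(mmul k.+1 (mmul k.+2 (srow v k.+1 s) (eps (inr (v, k.+1)))) (eps (inr (v, k.+1))) l i).
rewrite -mmulA [mmul k.+1 _ _](eps_idem K hE (inr (v, k.+1))).
rewrite -(srow_rAB _ kw ik sB); apply: eq_mmul => // p _; by rewrite rAE (negbTE nik) andbF add0r.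
Qed.

Definition embM (p : L) : wmod := fun y k => match y with
  | inl v => if (k == 0)%N then vx v ** p else 0 | inr _ => 0 end.

(** Restricted along [wlpa_hom], the vertex components of [wmod] reproduce left multiplication in
    L. *)
Lemma wlpa_hom_act c p : wlpa_hom c $* embM p = embM (c ** p).
Proof.
have last_edge (e : edge E) : ((weight e).-1 < w (esource e))%N /\ inr e \in slotsB (esource e) (weight e).-1.
  have wk : (weight e).-1.+1 = weight e by rewrite prednK // weight_gt0.
  split; first by rewrite wk weight_le.
  by rewrite mem_cat; apply/orP; left; apply/map_f; rewrite mem_filter mem_out // eqxx wk eqxx.
move: p; elim/presented_ind: c => [x||a b IHa IHb|a IHa|k a IHa|a b IHa IHb] p.
- rewrite /wlpa_hom (pres_map_class (gen_image_rel hE)); case: x => [v|e i|e i] /=.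
  + rewrite [LHS](wmod_vtx (inl v)); apply/funext => -[u|[u k']]; apply/funext => k //; rewrite /opm /embM.
    rewrite (inj_eq (@inl_inj _ _)) big_ord1 /= andbT -[pres_class _ _]/(vx v).
    rewrite [vx u ** _]numulA vxM; have [->|_] := eqVneq u v; last by rewrite numul0r if_same.
    by case: (k == 0)%N; rewrite ?numul0r // numulA vxM eqxx.
  + have [kw eB] := last_edge e; have ik : (i <= (weight e).-1)%N by rewrite -ltnS prednK ?weight_gt0.
    rewrite [LHS](rho_act _ kw ik eB); apply/funext => -[u|[u k']]; apply/funext => k //.
    rewrite /opm /embM (inj_eq (@inl_inj _ _)) big_ord1 /row_at /=.
    have -> : pres_class _ (NUGen K (RealEdge i)) = re e i.
      by rewrite /wlpa_real /real_edge valK.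
    rewrite -{2}(vx_re K e i) !numulA vxM; have [->|_] := eqVneq u; last by rewrite !numul0r if_same.
    by case: (k == 0)%N; rewrite ?numul0r // re_vx vx_re.
  + have [kw eB] := last_edge e; have ik : (i <= (weight e).-1)%N by rewrite -ltnS prednK ?weight_gt0.
    rewrite [LHS](gam_act _ kw ik eB); apply/funext => -[u|[u k']]; apply/funext => k //.
    rewrite /opm /embM [glab _]/= (inj_eq (@inl_inj _ _)) big_ord1 /col_at /=.
    have -> : pres_class _ (NUGen K (GhostEdge i)) = gh e i.
      by rewrite /wlpa_ghost /ghost_edge valK.
    rewrite -{2}(vx_gh K e i) !numulA vxM; have [->|_] := eqVneq u; last by rewrite !numul0r if_same.
    by case: (k == 0)%N; rewrite ?numul0r // gh_vx vx_gh.
- rewrite /wlpa_hom (pres_map0 (gen_image_rel hE)) nact0l; apply/funext => -[u|[u k']]; apply/funext => k //.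
  by rewrite /embM numul0r numulr0 if_same.
- rewrite /wlpa_hom (pres_mapD (gen_image_rel hE)) nactDl -!/(wlpa_hom _) IHa IHb.
  apply/funext => -[u|u]; apply/funext => k; last exact: addr0.
  rewrite -[LHS]/(embM (a ** p) (inl u) k + embM (b ** p) (inl u) k) /embM.
  by case: ifP; rewrite ?addr0 // numulDl numulDr.
- have -> : wlpa_hom (- a) = - wlpa_hom a.
    apply/eqP; rewrite -addr_eq0 /wlpa_hom -(pres_mapD (gen_image_rel hE)) addNr.
    by rewrite (pres_map0 (gen_image_rel hE)).
  rewrite nactNl IHa; apply/funext => -[u|u]; apply/funext => k; last exact: oppr0.
  rewrite -[LHS]/(- embM (a ** p) (inl u) k) /embM; case: ifP => _; rewrite ?oppr0 //.
  by rewrite numulNl numulNr.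
- have -> : wlpa_hom (k *: a) = k *: wlpa_hom a.
    move: a {IHa}; elim/quotW => s; rewrite -!/(pres_class _ _) -pres_classZ /wlpa_hom.
    by rewrite !(pres_map_class (gen_image_rel hE)).
  rewrite nactZl IHa; apply/funext => -[u|u]; apply/funext => j; last exact: scaler0.
  rewrite -[LHS]/(k *: embM (a ** p) (inl u) j) /embM; case: ifP => _; rewrite ?scaler0 //.
  by rewrite -nuscaleAl -nuscaleAr.
- by rewrite /wlpa_hom (pres_mapM (gen_image_rel hE)) nactM -!/(wlpa_hom _) IHb IHa numulA.
Qed.

(** Going from L to Lam and back through matrices recovers the part of [c] between two vertices. *)
Lemma theta_hom c u v : theta (wlpa_hom c) (inl u) 0 (inl v) 0 = vx u ** (c ** vx v).
Proof.
have unitE : unitM (inl v) 0 = embM (vx v).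
  apply/funext => -[x|x]; apply/funext => k //; rewrite /unitM /embM (inj_eq (@inl_inj _ _)) /= andbT.
  by rewrite vxM; case: eqP => [->//|_]; rewrite if_same.
by rewrite /theta unitE wlpa_hom_act.
Qed.

End TransferModule.

(** * The Grothendieck group *)

Section OrthogonalIdempotents.
Variable R : nuRingType.

Lemma big_codom (V : zmodType) (I J : finType) (h : I -> J) (F : J -> V) : injective h ->
  (forall j, j \notin codom h -> F j = 0) -> \sum_j F j = \sum_i F (h i).
Proof.
move=> h_inj F0; rewrite (bigID (fun j => j \in codom h)) /= [X in _ + X]big1 ?addr0 //.
by rewrite -big_uniq ?big_image //; apply/injectiveP.
Qed.

Lemma fcls_inj (I J : finType) (e : I -> I -> R) (f : J -> J -> R) (h : I -> J) :
  idemf f -> injective h -> (forall i i', e i i' = f (h i) (h i')) ->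
  (forall j j', j \notin codom h -> f j j' = 0) -> (forall j j', j' \notin codom h -> f j j' = 0) ->
  idemf e /\ fcls e = fcls f.
Proof.
move=> ff h_inj eE f0l f0r.
have sumE j j' : \sum_i f j (h i) ** f (h i) j' = f j j'.
  rewrite [RHS](idemfE ff) (big_codom h_inj) // => k kh; by rewrite f0r ?numul0r.
have ee : idemf e.
  apply/funext => i; apply/funext => i'; rewrite /fmul eE -sumE.
  by apply: eq_bigr => k _; rewrite !eE.
split=> //; apply: (@fcls_eq _ _ _ _ _ (fun i j => f (h i) j) (fun j i => f j (h i))) => //.
  by apply/funext => i; apply/funext => i'; rewrite /fmul eE [RHS](idemfE ff).
by apply/funext => j; apply/funext => j'; rewrite /fmul sumE.
Qed.

Lemma fcls_orth (I : finType) (e f : I -> I -> R) : idemf e -> idemf f ->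
  (forall i j, fmul e f i j = 0) -> (forall i j, fmul f e i j = 0) ->
  idemf (fun i j => e i j + f i j) /\ fcls (fun i j => e i j + f i j) = fcls e + fcls f.
Proof.
move=> ee ff ef fe; pose x i (u : I + I) := match u with inl j => e i j | inr j => f i j end.
pose y (u : I + I) i := match u with inl j => e j i | inr j => f j i end.
have xy : fmul x y = fun i j => e i j + f i j.
  apply/funext => i; apply/funext => j; rewrite /fmul big_sumType /=.
  by rewrite -!idemfE.
have yx : fmul y x = fblock e f.
  apply/funext => -[a|a]; apply/funext => -[b|b] /=.
  - by rewrite [RHS](idemfE ee).
  - exact: ef.
  - exact: fe.
  - by rewrite [RHS](idemfE ff).
have gg : idemf (fun i j => e i j + f i j).
  apply/funext => i; apply/funext => j; rewrite /fmul.
  under eq_bigr do rewrite numulDl !numulDr.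
  rewrite !big_split /= -!idemfE // -[\sum_k _]/(fmul e f i j) ef addr0.
  by rewrite -[\sum_k _]/(fmul f e i j) fe add0r.
split=> //; rewrite -fcls_block //; apply: (fcls_eq _ _ xy yx) => //; exact: fblock_idem.
Qed.

Definition fdiag (I J : finType) (e : I -> J -> J -> R) : I * J -> I * J -> R :=
  fun p q => if p.1 == q.1 then e p.1 p.2 q.2 else 0.

(** One component is split off at a time: [D s] keeps the components in [s], and [D [:: i]] is
    orthogonal to [D s] for [i] outside [s]. *)
Lemma fcls_diag (I J : finType) (e : I -> J -> J -> R) : (forall i, idemf (e i)) ->
  idemf (fdiag e) /\ fcls (fdiag e) = \sum_i fcls (e i).
Proof.
move=> ee; pose D (s : seq I) (p q : I * J) := if p.1 \in s then fdiag e p q else 0.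
have DM s t p q : fmul (D s) (D t) p q = if p.1 \in t then D s p q else 0.
  case: p q => [i k] [i' k']; rewrite /fmul /D /fdiag /=.
  rewrite -(pair_bigA _ (fun i1 k1 => (if i \in s then if i == i1 then e i k k1 else 0 else 0)
    ** (if i1 \in t then if i1 == i' then e i1 k1 k' else 0 else 0))) /=.
  rewrite (bigD1 i) //= [X in _ + X]big1 ?addr0 => [|i1 i1i]; last first.
    by apply: big1 => k1 _; rewrite eq_sym (negbTE i1i) if_same numul0r.
  rewrite eqxx; case: (i \in s); last by rewrite if_same big1 // => k1 _; rewrite numul0r.
  case: (i \in t); last by rewrite big1 // => k1 _; rewrite numulr0.
  by case: eqP => _; [rewrite [RHS](idemfE (ee i))|rewrite big1 // => k1 _; rewrite numulr0].
have DD s : idemf (D s).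
  by apply/funext => p; apply/funext => q; rewrite DM /D; case: (p.1 \in s).
have D1 i : fcls (D [:: i]) = fcls (e i).
  have [||||_ ->//] := @fcls_inj _ _ (e i) _ (pair i) (DD [:: i]).
  - by move=> k k' [].
  - by move=> k k'; rewrite /D /fdiag /= inE !eqxx.
  - move=> [j k] q jk; rewrite /D inE /=; case: eqP => // ji; case/negP: jk.
    by rewrite ji codom_f.
  - move=> [j' k'] [j k] jk; rewrite /D /fdiag inE /=; case: eqP => // ->.
    by case: eqP => // ij; case/negP: jk; rewrite -ij codom_f.
have Ds s : uniq s -> fcls (D s) = \sum_(i <- s) fcls (e i).
  elim: s => [_|i s IH /= /andP[is_ us]]; first by rewrite big_nil [D _](_ : _ = fun _ _ => 0) ?fcls0.
  rewrite big_cons -IH // -D1 -(fcls_orth (DD _) (DD _) _ _).2.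
  - congr fcls; apply/funext => p; apply/funext => q; rewrite /D !inE.
    by case: eqP => [->|_] /=; rewrite ?(negbTE is_) ?addr0 ?add0r.
  - by move=> p q; rewrite DM /D inE; case: ifP => // h; case: eqP => // pi; rewrite -pi h in is_.
  - by move=> p q; rewrite DM /D inE; case: eqP => // ->; rewrite (negbTE is_).
have -> : fdiag e = D (index_enum I).
  by apply/funext => p; apply/funext => q; rewrite /D mem_index_enum.
by split=> //; rewrite Ds ?index_enum_uniq.
Qed.

End OrthogonalIdempotents.

(** * Maps to group completions and from presented groups *)

Section GroupCompletionMap.
Variable M : nmodType.

Definition gcl (a : M) : group_completion M := gc_class (a, 0).

Lemma gclD a b : gcl (a + b) = gcl a + gcl b.
Proof.
rewrite -[RHS]/(gc_add (gc_class (a, 0)) (gc_class (b, 0))) gc_addE.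
by congr gc_class; rewrite /= addr0.
Qed.

Lemma gcl0 : gcl 0 = 0. Proof. by []. Qed.

Lemma gclMn a n : gcl (a *+ n) = gcl a *+ n.
Proof. by elim: n => [|n IH]; rewrite ?mulr0n // !mulrS gclD IH. Qed.

Lemma gcl_sum I (s : seq I) (P : pred I) (F : I -> M) :
  gcl (\sum_(i <- s | P i) F i) = \sum_(i <- s | P i) gcl (F i).
Proof. exact: (big_morph gcl gclD gcl0). Qed.

Lemma gcl_eq a b : gcl a = gcl b -> exists k, a + k = b + k.
Proof. by move/gc_classP => [k /= E]; exists k; move: E; rewrite !addr0. Qed.

Lemma gcl_diff (x : group_completion M) : exists a b, x = gcl a - gcl b.
Proof.
elim/quotW: x => -[a b]; exists a, b; rewrite -!/(gc_class _).
rewrite -[RHS]/(gc_add (gc_class (a, 0)) (gc_opp (gc_class (b, 0)))) gc_oppE gc_addE.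
by congr gc_class; rewrite /= addr0 add0r.
Qed.

End GroupCompletionMap.

Section PresentedGroupMaps.
Local Open Scope quotient_scope.
Variables (X : choiceType) (rel : set {freeg X}) (D : zmodType) (phi : X -> D).
Local Notation G := (presented_group rel).

Definition pgen (x : X) : G := \pi_G << x >>.

Definition freeg_lift (u : {freeg X}) : D := fglift (phi : X -> zmodule D) u.

Lemma freeg_liftB u v : freeg_lift (u - v) = freeg_lift u - freeg_lift v.
Proof. exact: (lift_is_additive (phi : X -> zmodule D)). Qed.

HB.instance Definition _ := GRing.isZmodMorphism.Build {freeg X} D freeg_lift freeg_liftB.

Lemma freeg_lift1 x : freeg_lift << x >> = phi x.
Proof. by rewrite /freeg_lift liftU scale1r. Qed.

(** The relator subgroup is an intersection of subgroups, so it lies in the kernel of the lift as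
    soon as this kernel is one of them. *)
Definition freeg_ker : {pred {freeg X}} := fun u => freeg_lift u == 0.

Lemma freeg_kerE u : (u \in freeg_ker) = (freeg_lift u == 0). Proof. by []. Qed.

Lemma freeg_ker_zmod : zmod_closed freeg_ker.
Proof.
split; first by rewrite freeg_kerE raddf0.
by move=> u v; rewrite !freeg_kerE => /eqP u0 /eqP v0; rewrite freeg_liftB u0 v0 subrr.
Qed.

HB.instance Definition _ := GRing.isZmodClosed.Build {freeg X} freeg_ker freeg_ker_zmod.

Lemma presented_group_lift : (forall u, rel u -> freeg_lift u = 0) ->
  exists f : {additive G -> D}, forall x, f (pgen x) = phi x.
Proof.
move=> rel0; have lift_pi u v : \pi_G u = \pi_G v -> freeg_lift u = freeg_lift v.
  move=> /eqP; rewrite -Quotient.idealrBE => /asboolP /(_ freeg_ker) h.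
  have /eqP : u - v \in freeg_ker by apply: h => z /rel0 z0; rewrite freeg_kerE z0.
  by rewrite freeg_liftB => /eqP; rewrite subr_eq0 => /eqP.
pose f (x : G) := freeg_lift (repr x).
have f_pi u : f (\pi_G u) = freeg_lift u by apply: lift_pi; rewrite reprK.
have fB : zmod_morphism f.
  by move=> x y; elim/quotW: x => u; elim/quotW: y => v; rewrite -raddfB !f_pi freeg_liftB.
pose fA : {additive G -> D} := HB.pack f (GRing.isZmodMorphism.Build _ _ f fB).
by exists fA => x; rewrite -[LHS]/(f _) f_pi freeg_lift1.
Qed.

Lemma presented_group_diff (x : G) : exists s t : seq X, x = \sum_(v <- s) pgen v - \sum_(v <- t) pgen v.
Proof.
elim/quotW: x => u; rewrite -(freeg_sumE u).
elim: (dom u) => [|v s [a [b ab]]]; first by exists [::], [::]; rewrite !big_nil subr0 raddf0.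
rewrite big_cons raddfD /= ab.
have nseqE n : \sum_(v <- nseq n v) pgen v = pgen v *+ n by rewrite big_nseq iter_addr_0.
have -> : << coeff v u *g v >> = << v >> *~ coeff v u by rewrite freegU_mulz intz.
rewrite raddfMz /= -/(pgen v); case: (coeff v u) => n.
  by exists (nseq n v ++ a), b; rewrite !big_cat nseqE /= addrA.
by exists a, (nseq n.+1 v ++ b); rewrite !big_cat nseqE /= opprD addrCA NegzE mulrNz.
Qed.

End PresentedGroupMaps.

(** * Classes of the vertices and of the objects q(v, m) over L *)

Section VertexClasses.
Variables (K : fieldType) (E : weighted_graph).
Hypothesis hE : row_finite E.
Local Notation vert := (vertex E).
Local Notation L := (wlpa K E).
Local Notation vx := (@wlpa_vtx K E).
Local Notation re := (@wlpa_real K E).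
Local Notation gh := (@wlpa_ghost K E).
Local Notation eps := (@eps K E).

Definition vcls (v : vert) : Vmonoid L := fcls (fun _ _ : 'I_1 => vx v).

Definition vdiag (I : finType) (l : I -> vert) : I -> I -> L :=
  fun i j => if i == j then vx (l i) else 0.

Lemma vdiag_mull (I J : finType) (l : I -> vert) (x : I -> J -> L) i j :
  fmul (vdiag l) x i j = vx (l i) ** x i j.
Proof.
rewrite /fmul /vdiag (bigD1 i) //= eqxx big1 ?addr0 // => k ki.
by rewrite eq_sym (negbTE ki) numul0r.
Qed.

Lemma vdiag_mulr (I J : finType) (l : J -> vert) (x : I -> J -> L) i j :
  fmul x (vdiag l) i j = x i j ** vx (l j).
Proof.
rewrite /fmul /vdiag (bigD1 j) //= eqxx big1 ?addr0 // => k kj.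
by rewrite (negbTE kj) numulr0.
Qed.

Lemma vx_idem v : vx v ** vx v = vx v. Proof. by rewrite vxM eqxx. Qed.

Lemma vdiag_idem (I : finType) (l : I -> vert) : idemf (vdiag l).
Proof.
apply/funext => i; apply/funext => j; rewrite vdiag_mull /vdiag.
by case: eqP => [->|_]; rewrite ?numulr0 // vx_idem.
Qed.

Lemma fcls_vdiag (I : finType) (l : I -> vert) : fcls (vdiag l) = \sum_i vcls (l i).
Proof.
have e1 i : idemf (fun _ _ : 'I_1 => vx (l i)).
  by apply/funext => k; apply/funext => k'; rewrite /fmul big_ord1 vx_idem.
have [dd <-] := fcls_diag e1.
have [||||_ ->//] := @fcls_inj _ _ _ (vdiag l) _ (fun i => (i, ord0)) dd.
- by move=> i j [].
- by [].
- by move=> [i k]; rewrite (ord1 k) (codom_f (fun i : I => (i, ord0 : 'I_1))).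
- by move=> ? [i k]; rewrite (ord1 k) (codom_f (fun i : I => (i, ord0 : 'I_1))).
Qed.

(** The property is required for all larger [t] as well, so that the vertex lists of two elements
    can be concatenated. *)
Lemma local_unit (c : L) : exists s : seq vert,
  forall t, uniq t -> {subset s <= t} ->
  (\sum_(v <- t) vx v) ** c = c /\ c ** (\sum_(v <- t) vx v) = c.
Proof.
have one v : exists s : seq vert, forall t, uniq t -> {subset s <= t} -> forall x : L,
    (vx v ** x = x -> (\sum_(u <- t) vx u) ** x = x) /\ (x ** vx v = x -> x ** (\sum_(u <- t) vx u) = x).
  exists [:: v] => t ut vt x; have tv : v \in t by apply: vt; rewrite inE.
  split=> vx_x; rewrite -{1}vx_x.
    rewrite numulA numul_suml (bigD1_seq v) //= vx_idem big1 ?addr0 // => u uv.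
    by rewrite vxM (negbTE uv).
  rewrite -numulA numul_sumr (bigD1_seq v) //= vx_idem big1 ?addr0 // => u uv.
  by rewrite vxM eq_sym (negbTE uv).
have two u v (x : L) : vx u ** x = x -> x ** vx v = x -> exists s : seq vert,
    forall t, uniq t -> {subset s <= t} -> (\sum_(u <- t) vx u) ** x = x /\ x ** (\sum_(u <- t) vx u) = x.
  move=> ux xv; have [[s hs] [s' hs']] := (one u, one v).
  exists (s ++ s') => t ut st; split.
    by apply: (hs t ut _ x).1 => // y ys; apply: st; rewrite mem_cat ys.
  by apply: (hs' t ut _ x).2 => // y ys; apply: st; rewrite mem_cat ys orbT.
elim/presented_ind: c => [x||a b [s hs] [s' hs']|a [s hs]|k a [s hs]|a b [s hs] [s' hs']].
- case: x => [v|e i|e i].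
  + by apply: (two v v); apply: vx_idem.
  + have -> : pres_class _ (NUGen K (RealEdge i)) = re e i by rewrite /wlpa_real /real_edge valK.
    exact: two (vx_re K e i) (re_vx K e i).
  + have -> : pres_class _ (NUGen K (GhostEdge i)) = gh e i by rewrite /wlpa_ghost /ghost_edge valK.
    exact: two (vx_gh K e i) (gh_vx K e i).
- by exists [::] => t _ _; rewrite numulr0 numul0r.
- exists (s ++ s') => t ut st; have [|a1 a2] := hs t ut; first by move=> y ys; apply: st; rewrite mem_cat ys.
  have [|b1 b2] := hs' t ut; first by move=> y ys; apply: st; rewrite mem_cat ys orbT.
  by rewrite numulDr numulDl a1 a2 b1 b2.
- exists s => t ut st; have [a1 a2] := hs t ut st.
  by rewrite numulNr numulNl a1 a2.
- exists s => t ut st; have [a1 a2] := hs t ut st.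
  by rewrite -nuscaleAr -nuscaleAl a1 a2.
- exists (s ++ s') => t ut st; have [|a1 a2] := hs t ut; first by move=> y ys; apply: st; rewrite mem_cat ys.
  have [|b1 b2] := hs' t ut; first by move=> y ys; apply: st; rewrite mem_cat ys orbT.
  by rewrite numulA a1 -numulA b2.
Qed.

Lemma local_unit_family (I : finType) (F : I -> L) : exists2 t : seq vert, uniq t &
  forall i, (\sum_(v <- t) vx v) ** F i = F i /\ F i ** (\sum_(v <- t) vx v) = F i.
Proof.
have [s sP] := choice (fun i => local_unit (F i)).
exists (undup (flatten [seq s i | i <- enum I])); first exact: undup_uniq.
move=> i; apply: sP; first exact: undup_uniq.
by move=> y ys; rewrite mem_undup; apply/flatten_mapP; exists i; rewrite ?mem_enum.
Qed.

Definition vlabelled n (l : 'I_n -> vert) (c : 'I_n -> 'I_n -> L) :=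
  forall i j, vx (l i) ** c i j = c i j /\ c i j ** vx (l j) = c i j.

(** A local unit is a sum of orthogonal vertices; it splits every index of an idempotent matrix into
    one index for each of these vertices. *)
Lemma labelled_class (k : Vmonoid L) : exists n (l : 'I_n -> vert) (c : 'I_n -> 'I_n -> L),
  [/\ idemf c, k = fcls c & vlabelled l c].
Proof.
elim/quotW: k => e; rewrite -/(Vclass e); have [n [f [ff eE]]] := fcls_surj e; rewrite eE.
have [t ut tP] := local_unit_family (fun p : 'I_n * 'I_n => f p.1 p.2).
pose I : finType := ('I_n * 'I_(size t))%type; pose s (p : I) := tnth (in_tuple t) p.2.
pose x i (p : I) := f i p.1 ** vx (s p); pose y (p : I) i := vx (s p) ** f p.1 i.
have sumP (F : 'I_n -> vert -> L) : \sum_(p : I) F p.1 (s p) = \sum_i \sum_(v <- t) F i v.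
  rewrite -(pair_bigA _ (fun i k => F i (tnth (in_tuple t) k))); apply: eq_bigr => i _.
  by rewrite [RHS](big_tnth _ _ t).
have xy : fmul x y = f.
  apply/funext => i; apply/funext => j; rewrite /fmul /x /y.
  rewrite (sumP (fun k v => (f i k ** vx v) ** (vx v ** f k j))) [RHS](idemfE ff).
  apply: eq_bigr => k _; rewrite -{2}(tP (k, j)).1 numul_suml numul_sumr.
  by apply: eq_bigr => v _; rewrite -numulA (numulA (vx v)) vx_idem.
have yx p q : fmul y x p q = vx (s p) ** f p.1 q.1 ** vx (s q).
  rewrite /fmul [f p.1 q.1](idemfE ff) numul_sumr numul_suml.
  by apply: eq_bigr => k _; rewrite /x /y !numulA.
have gg : idemf (fmul y x).
  by rewrite /idemf -fmulA [fmul x _]fmulA xy; congr (fmul y _); apply/funext => i;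
    apply/funext => p; rewrite /fmul /x [f i p.1](idemfE ff) numul_suml;
    apply: eq_bigr => k _; rewrite numulA.
pose m := #|I|; pose c (i j : 'I_m) := fmul y x (enum_val i) (enum_val j).
have [||||cc cE] := @fcls_inj _ _ _ c _ (@enum_val I predT) gg.
- exact: enum_val_inj.
- by [].
- by move=> p q; rewrite -[p]enum_rankK codom_f.
- by move=> p q; rewrite -[q]enum_rankK codom_f.
exists m, (fun i => s (enum_val i)), c; split=> //.
  by rewrite cE; apply: (fcls_eq ff gg xy).
by move=> i j; rewrite /c yx !numulA vx_idem; split=> //; rewrite -numulA vx_idem.
Qed.

(** A labelled idempotent is absorbed on both sides by the diagonal of its labels, so the difference
    is an orthogonal idempotent. *)
Lemma vlabelled_complement n (l : 'I_n -> vert) (c : 'I_n -> 'I_n -> L) : idemf c -> vlabelled l c ->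
  exists k, fcls c + k = \sum_i vcls (l i).
Proof.
move=> cc cl; pose d i j := vdiag l i j - c i j.
have vc i j : fmul (vdiag l) c i j = c i j by rewrite vdiag_mull (cl i j).1.
have cv i j : fmul c (vdiag l) i j = c i j by rewrite vdiag_mulr (cl i j).2.
have cd i j : fmul c d i j = 0.
  rewrite /fmul /d; under eq_bigr do rewrite numulDr numulNr.
  by rewrite sumrB [X in X - _]cv -idemfE // subrr.
have dc i j : fmul d c i j = 0.
  rewrite /fmul /d; under eq_bigr do rewrite numulDl numulNl.
  by rewrite sumrB [X in X - _]vc -idemfE // subrr.
have dd : idemf d.
  apply/funext => i; apply/funext => j; rewrite /fmul {1}/d.
  under eq_bigr do rewrite numulDl numulNl.
  rewrite sumrB [X in _ - X]cd subr0 /d.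
  under eq_bigr do rewrite numulDr numulNr.
  by rewrite sumrB [X in _ - X]vc -(idemfE (vdiag_idem l)).
exists (fcls d); rewrite -(fcls_orth cc dd cd dc).2 -fcls_vdiag.
by congr fcls; apply/funext => i; apply/funext => j; rewrite addrC subrK.
Qed.

Definition kappa (x : gobj E) : Vmonoid L := fcls (fun k k' : 'I_(gdim x) => eps x k k').

Lemma eps_idemf N x : (gdim x <= N)%N -> idemf (fun k k' : 'I_N => eps x k k').
Proof.
move=> xN; apply/funext => k; apply/funext => k'.
have h i l : (gdim x <= l)%N -> eps x i l = 0 by move=> h; rewrite eps_out // h orbT.
rewrite -[LHS]/(mmul N (eps x) (eps x) k k') (mmul_widen _ h xN).
by rewrite (eps_idem K hE x).
Qed.

(** Padding by zeros: a common size [N] puts a whole family of objects into one matrix. *)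
Lemma kappaE N x : (gdim x <= N)%N -> fcls (fun k k' : 'I_N => eps x k k') = kappa x.
Proof.
move=> xN; apply/esym; rewrite /kappa.
have notin (j : 'I_N) : j \notin codom (widen_ord xN) -> (gdim x <= j)%N.
  rewrite leqNgt; apply: contra => jx; rewrite (_ : j = widen_ord xN (Ordinal jx)) ?codom_f //.
  exact: val_inj.
have [||||_ ->//] := @fcls_inj _ _ _ (fun k k' : 'I_(gdim x) => eps x k k') _ (widen_ord xN) (eps_idemf xN).
- by move=> i j ij; apply/val_inj/(congr1 val ij).
- by [].
- by move=> j j' /notin h; rewrite eps_out // h.
- by move=> j j' /notin h; rewrite eps_out // h orbT.
Qed.

Lemma kappa_vtx v : kappa (inl v) = vcls v.
Proof. by congr fcls; apply/funext => i; apply/funext => j; rewrite !ord1. Qed.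

(** The edges of weight at most [m], next to [eps], decompose [m] copies of [v]: [x y] is the
    identity by the definition of [eps], and [y x] is block diagonal by (iv) and orthogonality. *)
Lemma kappa_complement v m :
  vcls v *+ m = \sum_(e <- out_edges v | (weight e <= m)%N) vcls (erange e) + kappa (inr (v, m)).
Proof.
pose s := [seq e <- out_edges v | (weight e <= m)%N]; pose ed := tnth (in_tuple s).
have edP t : esource (ed t) = v /\ (weight (ed t) <= m)%N.
  by have := mem_tnth t (in_tuple s); rewrite mem_filter (in_out hE) => /andP[wm /eqP].
pose x (i : 'I_m) (u : 'I_(size s) + 'I_m) := match u with
  inl t => re (ed t) i | inr j => eps (inr (v, m)) i j end.
pose y (u : 'I_(size s) + 'I_m) (i : 'I_m) := match u with
  inl t => gh (ed t) i | inr j => eps (inr (v, m)) j i end.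
pose eM (i j : 'I_m) := eps (inr (v, m)) i j.
have ee : idemf eM by apply: eps_idemf.
have ed_inj t t' : (ed t == ed t') = (t == t').
  apply/eqP/eqP => [|->//]; rewrite /ed !(tnth_nth (ed t)) => /eqP.
  by rewrite nth_uniq ?filter_uniq ?out_uniq // => /eqP/val_inj.
have xy : fmul x y = vdiag (fun _ => v).
  apply/funext => i; apply/funext => j; rewrite /fmul big_sumType /x /y /=.
  rewrite -(idemfE ee) /eM /eps !ltn_ord /= -(big_tnth _ _ s predT (fun e => re e i ** gh e j)).
  by rewrite big_filter addrC subrK.
have yx : fmul y x = fblock (vdiag (fun t => erange (ed t))) eM.
  apply/funext => -[t|j]; apply/funext => -[t'|j'].
  - by rewrite -[LHS]/(\sum_(i < m) gh (ed t) i ** re (ed t') i) gh_re ?(edP _).1 ?(edP _).2 // ed_inj.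
  - exact: (gh_eps K hE j' (edP t).1 (edP t).2).
  - exact: (eps_re K hE j (edP t').1 (edP t').2).
  - by rewrite [RHS](idemfE ee).
have := fcls_eq (vdiag_idem _) (fblock_idem (vdiag_idem _) ee) xy yx.
rewrite fcls_block ?fcls_vdiag //; last exact: vdiag_idem.
rewrite sumr_const card_ord => ->; congr (_ + _).
by rewrite -(big_tnth _ _ s predT (fun e => vcls (erange e))) big_filter.
Qed.

Lemma kappa_full v : kappa (inr (v, vertex_weight v)) = 0.
Proof.
rewrite -(fcls0 L 'I_(vertex_weight v)); congr fcls; apply/funext => i; apply/funext => j.
rewrite /eps !ltn_ord /= -(re_gh K (ltn_ord i) (ltn_ord j)); apply/eqP; rewrite subr_eq0; apply/eqP.
rewrite big_seq [RHS]big_seq_cond; apply: eq_bigl => e; rewrite (in_out hE).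
by case: eqP => //= <-; rewrite weight_le.
Qed.

Lemma vcls_relation v : vcls v *+ vertex_weight v = \sum_(e <- out_edges v) vcls (erange e).
Proof.
rewrite kappa_complement kappa_full addr0 big_seq_cond [RHS]big_seq; apply: eq_bigl => e.
by rewrite (in_out hE); case: eqP => //= <-; rewrite weight_le.
Qed.

End VertexClasses.

(** * Comparison of V(L) with the graph group *)

Section Transport.
Variables (K : fieldType) (E : weighted_graph).
Hypothesis hE : row_finite E.
Local Notation vert := (vertex E).
Local Notation L := (wlpa K E).
Local Notation ghyp := (ghyp E).
Local Notation Lam := (hyper_alg K ghyp).
Local Notation r := (hyper_rep K ghyp).
Local Notation vx := (@wlpa_vtx K E).
Local Notation eps := (@eps K E).
Local Notation theta := (theta hE).

Lemma theta_outl (a : Lam) y k x l : (gdim y <= k)%N -> rX r y ** a = a -> theta a y k x l = 0.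
Proof.
move=> yk ya; rewrite /theta -ya nactM wmod_vtx /opm eqxx big1 // => l' _.
by rewrite eps_out ?yk // numul0r.
Qed.

Section ThetaMatrices.
Variable N : nat.

Definition theta_mx (I J : finType) (la : I -> gobj E) (lb : J -> gobj E) (A : I -> J -> Lam) :
    I * 'I_N -> J * 'I_N -> L :=
  fun p q => theta (A p.1 q.1) (la p.1) p.2 (lb q.1) q.2.

Lemma theta_mx_mul (I J M : finType) (la : I -> gobj E) (lb : J -> gobj E) (lc : M -> gobj E)
    (A : I -> J -> Lam) (B : J -> M -> Lam) :
  (forall j, gdim (lb j) <= N)%N -> (forall j m, rX r (lb j) ** B j m = B j m) ->
  fmul (theta_mx la lb A) (theta_mx lb lc B) = theta_mx la lc (fmul A B).
Proof.
move=> bN lB; apply/funext => -[i k]; apply/funext => -[m k'].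
rewrite /theta_mx /fmul theta_sum /=.
rewrite -(pair_bigA _ (fun j (l : 'I_N) => theta (A i j) (la i) k (lb j) l ** theta (B j m) (lb j) l (lc m) k')).
by apply: eq_bigr => j _; apply/esym/theta_mul.
Qed.

Lemma theta_mx_diag (I : finType) (l : I -> gobj E) :
  theta_mx l l (@diag K ghyp _ l) = fdiag (fun i (k k' : 'I_N) => eps (l i) k k').
Proof.
apply/funext => -[i k]; apply/funext => -[j k']; rewrite /theta_mx /fdiag /diag /=.
by case: eqP => [->|_]; rewrite ?theta_X ?theta0.
Qed.

End ThetaMatrices.

Lemma wlpa_homM (a b : L) : wlpa_hom (a ** b) = wlpa_hom a ** wlpa_hom b.
Proof. exact: (pres_mapM (gen_image_rel hE)). Qed.

Lemma wlpa_hom_sum (I : Type) (s : seq I) (P : pred I) (F : I -> L) :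
  wlpa_hom (\sum_(i <- s | P i) F i) = \sum_(i <- s | P i) wlpa_hom (F i).
Proof. exact: (pres_map_sum (gen_image_rel hE)). Qed.

Lemma wlpa_hom0 : wlpa_hom (0 : L) = 0.
Proof. exact: (pres_map0 (gen_image_rel hE)). Qed.

Lemma wlpa_hom_vx v : wlpa_hom (vx v) = rX r (inl v).
Proof. exact: (pres_map_class (gen_image_rel hE)). Qed.

Lemma wlpa_hom_vxl v (a : L) : vx v ** a = a -> rX r (inl v) ** wlpa_hom a = wlpa_hom a.
Proof. by move=> va; rewrite -wlpa_hom_vx -wlpa_homM va. Qed.

(** Resolve the image of [c] in Lam and apply [theta] to the entries of the two mutually inverse
    matrices: the diagonals become the [eps], and [theta_hom] returns [c] itself. *)
Lemma class_resolution n (l : 'I_n -> vert) (c : 'I_n -> 'I_n -> L) : idemf c -> vlabelled l c ->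
  exists (p : nat) (lp : 'I_p -> gobj E) (J : finType) (lj : J -> gobj E),
    fcls c + \sum_j kappa K (lj j) = \sum_i kappa K (lp i).
Proof.
move=> cc cl; pose e i j := wlpa_hom (c i j); pose lb i : gobj E := inl (l i).
have e_idem i j : \sum_k e i k ** e k j = e i j.
  rewrite /e [c i j](idemfE cc) wlpa_hom_sum; apply: eq_bigr => k _; by rewrite wlpa_homM.
have e_lab i j : rX r (lb i) ** e i j = e i j by apply: wlpa_hom_vxl; apply: (cl i j).1.
have [p [lp [J [lj [A [B [lA lB AB BA]]]]]]] := @idempotent_resolution K ghyp n lb e e_idem e_lab.
exists p, lp, J, lj.
pose lu u := match u with inl i => lb i | inr j => lj j end.
(* A common size for all objects; the successor guarantees the index 0, where the vertices [lb i]
   live. *)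
pose N := (\max_i gdim (lp i) + \max_j gdim (lj j)).+1.
have pN i : (gdim (lp i) <= N)%N.
  by apply: leqW; apply: leq_trans (leq_addr _ _); apply: (leq_bigmax i).
have jN j : (gdim (lj j) <= N)%N.
  by apply: leqW; apply: leq_trans (leq_addl _ _); apply: (leq_bigmax j).
have uN u : (gdim (lu u) <= N)%N by case: u => //= j.
pose TA := @theta_mx N _ _ lp lu A; pose TB := @theta_mx N _ _ lu lp B.
have [pp ppE] := fcls_diag (fun i => eps_idemf K hE (pN i)).
have [jj jjE] := fcls_diag (fun j => eps_idemf K hE (jN j)).
have TAB : fmul TA TB = fdiag (fun i (k k' : 'I_N) => eps (lp i) k k').
  by rewrite theta_mx_mul // AB theta_mx_diag.
have TBA : fmul TB TA = @theta_mx N _ _ lu lu (fblock e (@diag K ghyp _ lj)).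
  by rewrite theta_mx_mul // BA.
have uu : idemf (@theta_mx N _ _ lu lu (fblock e (@diag K ghyp _ lj))).
  rewrite -TBA /idemf -fmulA [fmul TA _]fmulA TAB.
  rewrite -theta_mx_diag theta_mx_mul //; congr (fmul TB (theta_mx _ _ _)).
  apply/funext => i; apply/funext => u; rewrite -[RHS](lA i u) /fmul /diag (bigD1 i) //= eqxx.
  by rewrite big1 ?addr0 // => i' i'i; rewrite eq_sym (negbTE i'i) numul0r.
(* A vertex has dimension 1, so its rows and columns vanish at every index other than 0: the image
   of [h] contains the support of the matrix. *)
pose h (u : 'I_n + J * 'I_N) : ('I_n + J) * 'I_N :=
  match u with inl i => (inl i, ord0) | inr q => (inr q.1, q.2) end.
pose jM := fdiag (fun j (k k' : 'I_N) => eps (lj j) k k').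
have hC v : v \notin codom h -> exists i k, v = (inl i, k) /\ (0 < k)%N.
  case: v => -[i|j] k vh; last by case/negP: vh; rewrite (codom_f h (inr (j, k))).
  exists i, k; split=> //; rewrite lt0n; apply: contraNneq vh => k0.
  by rewrite (_ : (_, _) = h (inl i)) ?codom_f //; congr pair; apply: val_inj.
have [||||_ uE] := @fcls_inj _ _ _ (fblock c jM) _ h uu.
- by move=> [i|[j k]] [i'|[j' k']] //= [] => [->|-> ->].
- move=> [i|[j k]] [i'|[j' k']]; rewrite /theta_mx /=.
  + by rewrite /e theta_hom (cl i i').2 (cl i i').1.
  + by rewrite theta0.
  + by rewrite theta0.
  + by rewrite /jM -theta_mx_diag.
- move=> u v /hC[i [k [-> k0]]]; rewrite /theta_mx /=.
  by case: v => -[i'|j'] k'; rewrite /= ?theta0 // theta_outl.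
- move=> u v /hC[i [k [-> k0]]]; rewrite /theta_mx /=.
  by rewrite theta_out.
have <- : fcls jM = \sum_j kappa K (lj j).
  by rewrite jjE; apply: eq_bigr => j _; rewrite kappaE.
rewrite -fcls_block // uE.
have <- : fcls (fdiag (fun i (k k' : 'I_N) => eps (lp i) k k')) = \sum_i kappa K (lp i).
  by rewrite ppE; apply: eq_bigr => i _; rewrite kappaE.
exact: fcls_eq uu pp TBA TAB.
Qed.

Local Notation G := (graph_group E).
Local Notation rel := [set r | exists v : vert,
  r = << v >> *+ vertex_weight v - \sum_(e <- out_edges v) << erange e >>]%classic.
Definition graph_gen (v : vert) : G := pgen rel v.

Lemma graph_relation v : graph_gen v *+ vertex_weight v = \sum_(e <- out_edges v) graph_gen (erange e).
Proof.
apply/eqP; rewrite -subr_eq0 /graph_gen /pgen -raddfMn -raddf_sum -raddfB; apply/eqP.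
rewrite -(raddf0 (\pi_G)%qT); apply/eqP; rewrite -Quotient.idealrBE subr0.
by apply/asboolP => S; apply; exists v.
Qed.

(* The value of xi on inr (v, m) is forced by kappa_complement. *)
Definition xi (x : gobj E) : G := match x with
  | inl v => graph_gen v
  | inr (v, m) => graph_gen v *+ m - \sum_(e <- out_edges v | (weight e <= m)%N) graph_gen (erange e)
  end.

Lemma xi_full v : xi (inr (v, vertex_weight v)) = 0.
Proof.
rewrite /= graph_relation big_seq [X in _ - X]big_seq_cond; apply/eqP; rewrite subr_eq0; apply/eqP.
by apply: eq_bigl => e; rewrite (in_out hE); case: eqP => //= <-; rewrite weight_le.
Qed.

Lemma xi0 v : xi (inr (v, 0%N)) = 0.
Proof. by rewrite /= mulr0n big1 ?subrr // => e; rewrite leqn0 gtn_eqF // weight_gt0. Qed.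

(** Both sides are [k + 1] times [v] minus the r(e), e of weight at most [k]. The slots left out at
    [k = 0] and at [k + 1 = w v] have value 0. *)
Lemma xi_balanced : balanced (H := ghyp) xi.
Proof.
case=> -[v k] kw /=; rewrite big_cons [glab _]/= [xi (inl v)]/=.
have -> : \sum_(a <- (if (0 < k)%N then [:: sq v k] else [::])) xi (glab a) = xi (inr (v, k)).
  case: ifP => [_|/negbT]; first by rewrite big_seq1.
  by rewrite -leqNgt leqn0 => /eqP ->; rewrite big_nil xi0.
rewrite sum_slotsB; last first.
  move=> h; have -> : k.+1 = vertex_weight v by apply/eqP; rewrite eqn_leq kw leqNgt h.
  exact: xi_full.
rewrite /= mulrS (bigID (fun e => (weight e <= k)%N) (fun e => (weight e <= k.+1)%N)) /= opprD.
have -> : \sum_(e <- out_edges v | (weight e <= k.+1)%N && (weight e <= k)%N) graph_gen (erange e)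
    = \sum_(e <- out_edges v | (weight e <= k)%N) graph_gen (erange e).
  by apply: eq_bigl => e; case: (leqP (weight e) k) => h; rewrite ?andbF // leqW.
have -> : \sum_(e <- out_edges v | (weight e <= k.+1)%N && ~~ (weight e <= k)%N) graph_gen (erange e)
    = \sum_(e <- out_edges v | weight e == k.+1) graph_gen (erange e).
  by apply: eq_bigl => e; rewrite -ltnNge eqn_leq.
by rewrite [RHS]addrC [X in _ = X + _]addrA subrK addrA.
Qed.

(** The mutually inverse matrices over L remain inverse in Lam, where [invertible_balanced] applies
    to [xi]. *)
Lemma vcls_sum_inj (s t : seq vert) :
  \sum_(v <- s) vcls K v = \sum_(v <- t) vcls K v -> \sum_(v <- s) graph_gen v = \sum_(v <- t) graph_gen v.
Proof.
pose a := tnth (in_tuple s); pose b := tnth (in_tuple t).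
rewrite !(big_tnth _ _ s) !(big_tnth _ _ t) -/a -/b -!fcls_vdiag => ab.
have [x [y [xy yx xE yE]]] := fcls_inv (vdiag_idem K a) (vdiag_idem K b) ab.
have xl i j : vx (a i) ** x i j = x i j.
  by rewrite -vdiag_mull -{1}xE fmulA (vdiag_idem K a) xE.
have yl j i : vx (b j) ** y j i = y j i.
  by rewrite -vdiag_mull -{1}yE fmulA (vdiag_idem K b) yE.
apply: (@invertible_balanced K ghyp _ (fun j => inl (b j)) _ (fun i => inl (a i))
  (fun i j => wlpa_hom (x i j)) (fun j i => wlpa_hom (y j i)) _ xi xi_balanced).
- move=> i i'; under eq_bigr do rewrite -wlpa_homM; rewrite -wlpa_hom_sum.
  rewrite -[\sum_j _]/(fmul x y i i') xy /vdiag.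
  by case: eqP => _; rewrite ?wlpa_hom_vx ?wlpa_hom0.
- move=> j j'; under eq_bigr do rewrite -wlpa_homM; rewrite -wlpa_hom_sum.
  rewrite -[\sum_i _]/(fmul y x j j') yx /vdiag.
  by case: eqP => _; rewrite ?wlpa_hom_vx ?wlpa_hom0.
- by move=> i j; apply: wlpa_hom_vxl.
- by move=> j i; apply: wlpa_hom_vxl.
Qed.

Lemma graph_group_to_K0 : exists f : {additive G -> K0 (wlpa K E)}, forall v, f (graph_gen v) = gcl (vcls K v).
Proof.
apply: presented_group_lift => u [v ->]; rewrite raddfB raddfMn raddf_sum /= freeg_lift1.
under eq_bigr do rewrite freeg_lift1.
by rewrite -gclMn (vcls_relation K hE) gcl_sum subrr.
Qed.

End Transport.

Theorem mainTheorem2 (K : fieldType) (E : weighted_graph) (hE : row_finite E) :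
  exists f : {additive K0 (wlpa K E) -> graph_group E}, bijective f.
Proof.
(* [I] is the map from vertices to their classes; the isomorphism is its inverse. *)
have [I I_gv] := graph_group_to_K0 K hE.
have I_sum s : I (\sum_(v <- s) graph_gen v) = gcl (\sum_(v <- s) vcls K v).
  by rewrite raddf_sum gcl_sum; apply: eq_bigr => v _; apply: I_gv.
have I_xi x : I (xi x) = gcl (kappa K x).
  case: x => [v|[v m]]; first by rewrite kappa_vtx I_gv.
  rewrite raddfB raddfMn raddf_sum /= I_gv; under eq_bigr do rewrite I_gv.
  by rewrite -gclMn (kappa_complement K hE) gclD gcl_sum addrC addKr.
have I_inj : injective I.
  move=> x y /eqP; rewrite -subr_eq0 -raddfB => /eqP Ixy; apply/eqP; rewrite -subr_eq0; apply/eqP.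
  have [s [t xyE]] := presented_group_diff (x - y).
  move: Ixy; rewrite xyE raddfB !I_sum => /eqP; rewrite subr_eq0 => /eqP/gcl_eq [k].
  (* Equality in K_0 is equality in V(L) after adding some [k]. As [k] is a summand of a sum of
     vertices, its complement can be added too, and both sides become sums of vertices. *)
  have [n [l [c [cc -> cl]]]] := labelled_class k.
  have [k' kE] := vlabelled_complement cc cl.
  move=> /(congr1 (fun z => z + k')); rewrite -!addrA kE.
  have -> : \sum_i vcls K (l i) = \sum_(v <- codom l) vcls K v by rewrite big_image.
  rewrite -!big_cat => /(vcls_sum_inj hE); rewrite !big_cat => /addIr ->.
  by rewrite subrr.
have I_class k : exists x, I x = gcl k.
  have [n [l [c [cc -> cl]]]] := labelled_class k.
  have [p [lp [J [lj E1]]]] := class_resolution hE cc cl.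
  (* By the resolution the class is a difference of sums of objects, and the class of each object
     [x] is the image of [xi x]. *)
  exists (\sum_i xi (lp i) - \sum_j xi (lj j)).
  have I_sum_xi (A : finType) (h : A -> gobj E) : I (\sum_i xi (h i)) = gcl (\sum_i kappa K (h i)).
    by rewrite raddf_sum gcl_sum; apply: eq_bigr => i _; apply: I_xi.
  by rewrite raddfB !I_sum_xi -E1 gclD addrK.
have I_surj y : exists x, I x = y.
  have [a [b ->]] := gcl_diff y; have [[x xa] [z zb]] := (I_class a, I_class b).
  by exists (x - z); rewrite raddfB xa zb.
pose f y := sval (cid (I_surj y)).
have fK : cancel f I by move=> y; apply: svalP (cid (I_surj y)).
have fB : zmod_morphism f by move=> x y; apply: I_inj; rewrite raddfB !fK.
pose fA : {additive K0 (wlpa K E) -> graph_group E} := HB.pack f (GRing.isZmodMorphism.Build _ _ f fB).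
by exists fA, I => // x; apply: I_inj; rewrite fK.
Qed.
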